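(* The twisted cubic is the only algebraically skew curve in $\mathbb{P}^3$: a smooth projective curve $X\subset\mathbb{P}^3$ over $\mathbb{C}$ is algebraically skew if and only if $X$ is a twisted cubic (i.e. projectively equivalent to the image of $(s:t)\mapsto(s^3:s^2t:st^2:t^3)$).
   Context: For a smooth projective curve $X\subset\mathbb{P}^N=\mathbb{P}(V)$, let $T_{x,X}\subset\mathbb{P}^N$ be the embedded tangent line at $x$. $X$ is skew if $T_{x,X}\cap T_{y,X}=\emptyset$ for any two distinct $x,y\in X$. $X$ is algebraically skew if it is skew and its third osculating planes are nowhere degenerate: for every point $x_0\in X$ and every local analytic lifting $f$ of $X$ to $V$, defined near $0\in\mathbb{C}$ (with $t\mapsto[f(t)]$ a local parametrization of $X$) and with $[f(0)]=x_0$, the vectors $f(0),f'(0),f''(0),f'''(0)$ are linearly independent. *)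

(* Defs.v *)
From HB Require Import structures.
From mathcomp Require Import all_boot all_order all_algebra.
From mathcomp Require Import all_classical all_reals all_analysis.
From mathcomp Require Import complex.
From mathcomp Require mpoly.
(* No notations: they clash with those of MathComp-Analysis. *)
Import (canonicals, coercions) mpoly.

Set Implicit Arguments.
Unset Strict Implicit.
Unset Printing Implicit Defensive.

Import Order.TTheory GRing.Theory Num.Theory.
Import numFieldNormedType.Exports.

Local Open Scope classical_set_scope.
Local Open Scope ring_scope.

(* The definitions are stated over a [numClosedFieldType] with the topology of
   its norm, because [R[i]] itself carries no canonical topology; they are
   meant to be used at [C := R[i]] with [R : realType]. *)
Section ProjectiveSpace.
Context (C : numClosedFieldType) (N : nat).

Definition projspace : Type :=
  {L : {vspace 'rV[C]_N.+1} | \dim L == 1%N}.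

Fact dim_vline_e0 : \dim <[(delta_mx 0 0 : 'rV[C]_N.+1)%R]> == 1%N.
Proof.
rewrite dim_vline eqb1; apply/eqP => /matrixP /(_ 0 0).
by rewrite !mxE !eqxx => /eqP; rewrite oner_eq0.
Qed.

(* The point [v] with homogeneous coordinates v; an arbitrary value at v = 0. *)
Definition ppoint (v : 'rV[C]_N.+1) : projspace :=
  insubd (exist (fun L => \dim L == 1%N) _ dim_vline_e0) <[v]>%VS.

(* The linear subspace P(U) of P^N, of dimension \dim U - 1. *)
Definition plinear (U : {vspace 'rV[C]_N.+1}) : set projspace :=
  [set x : projspace | (sval x <= U)%VS].

Definition homogeneous (F : mpoly.mpoly N.+1 C) : Prop :=
  exists d, F \is mpoly.ishomog1 d mpoly.mdeg.

Definition vanishes_at (F : mpoly.mpoly N.+1 C) (x : projspace) : Prop :=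
  forall v : 'rV[C]_N.+1, v \in sval x -> mpoly.meval (v 0) F = 0.

Definition zariski_closed (Z : set projspace) : Prop :=
  exists2 S : set (mpoly.mpoly N.+1 C),
    S `<=` homogeneous & Z = [set x | forall F, S F -> vanishes_at F x].

Definition irreducible_closed (Z : set projspace) : Prop :=
  [/\ zariski_closed Z, Z !=set0 &
      forall Z1 Z2, zariski_closed Z1 -> zariski_closed Z2 ->
        Z `<=` Z1 `|` Z2 -> Z `<=` Z1 \/ Z `<=` Z2].

Definition irreducible_chain (X : set projspace) (n : nat)
    (Z : nat -> set projspace) : Prop :=
  (forall i, (i <= n)%N -> irreducible_closed (Z i) /\ Z i `<=` X) /\
  (forall i, (i < n)%N -> Z i `<` Z i.+1).

(* Krull dimension *)
Definition has_dimension (X : set projspace) (n : nat) : Prop :=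
  (exists Z, irreducible_chain X n Z) /\
  ~ (exists Z, irreducible_chain X n.+1 Z).

(* The homogeneous elements of the ideal I(X). *)
Definition vanishing_forms (X : set projspace) : set (mpoly.mpoly N.+1 C) :=
  [set F | homogeneous F /\ forall x, X x -> vanishes_at F x].

(* The embedded tangent space T_{x,X}: the common zeros [w] of the linear forms
   dF_v, for F in I(X) and x = [v]. *)
Definition tangent_space (X : set projspace) (x : projspace) : set projspace :=
  [set y : projspace | forall F, vanishing_forms X F ->
     forall v w : 'rV[C]_N.+1, v \in sval x -> w \in sval y ->
       \sum_(i < N.+1) mpoly.meval (v 0) (mpoly.mderiv i F) * w 0 i = 0].

Definition smooth_projective_variety (X : set projspace) (n : nat) : Prop :=
  [/\ irreducible_closed X, has_dimension X n &
      forall x, X x ->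
        exists2 U : {vspace 'rV[C]_N.+1},
          \dim U = n.+1 & tangent_space X x = plinear U].

Definition smooth_projective_curve (X : set projspace) : Prop :=
  smooth_projective_variety X 1.

Definition skew (X : set projspace) : Prop :=
  forall x y, X x -> X y -> x <> y ->
    tangent_space X x `&` tangent_space X y = set0.

(* The classical topology on P^N: the quotient topology from C^(N+1) \ {0}. *)
Definition classical_open (O : set projspace) : Prop :=
  open [set v : 'rV[C]_N.+1 | v != 0 /\ O (ppoint v)].

Definition analytic_at (f : C -> 'rV[C]_N.+1) (z : C) : Prop :=
  exists a : nat -> 'rV[C]_N.+1,
    \forall w \near z, series (fun k => (w - z) ^+ k *: a k) @ \oo --> f w.

(* The immersion condition on t |-> [f t] is the independence of f t and f' t;
   together with the last two conditions it says that t |-> [f t] is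
   biholomorphic from U onto an open neighbourhood of x0 in X. *)
Definition local_lifting (X : set projspace) (x0 : projspace)
    (f : C -> 'rV[C]_N.+1) : Prop :=
  exists U : set C,
    [/\ open U /\ U 0, ppoint (f 0) = x0,
        forall t, U t ->
          [/\ analytic_at f t, f t != 0, X (ppoint (f t)) &
              free [:: f t; derive1 f t]],
        forall s t, U s -> U t -> ppoint (f s) = ppoint (f t) -> s = t &
        forall V : set C, open V -> V `<=` U ->
          exists2 O : set projspace, classical_open O &
            [set ppoint (f t) | t in V] = O `&` X].

Definition algebraically_skew (X : set projspace) : Prop :=
  skew X /\
  forall x0 (f : C -> 'rV[C]_N.+1), X x0 -> local_lifting X x0 f ->
    free [:: f 0; derive1n 1 f 0; derive1n 2 f 0; derive1n 3 f 0].

Definition projectively_equivalent (X Y : set projspace) : Prop :=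
  exists2 A : 'M[C]_N.+1, A \in unitmx &
    X = [set ppoint (v *m A) | v in [set v | v != 0 /\ Y (ppoint v)]].

End ProjectiveSpace.

Definition standard_twisted_cubic (C : numClosedFieldType) :
    set (projspace C 3) :=
  [set x | exists s t : C, (s, t) <> (0, 0) /\
     x = ppoint (\row_(i < 4) (s ^+ (3 - i) * t ^+ i))].

Definition twisted_cubic (C : numClosedFieldType) (X : set (projspace C 3)) :
    Prop :=
  projectively_equivalent X (@standard_twisted_cubic C).

(* Main.v *)
Require Import Defs.
From HB Require Import structures.
From mathcomp Require Import all_boot all_order all_algebra.
From mathcomp Require Import cyclic separable cyclotomic.
From mathcomp Require Import all_classical all_reals all_analysis.
From mathcomp Require Import complex.
From mathcomp Require Import ring lra zify.
From mathcomp Require mpoly.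
Import (canonicals, coercions) mpoly.

Set Implicit Arguments.
Unset Strict Implicit.
Unset Printing Implicit Defensive.
Import Order.TTheory GRing.Theory Num.Theory.
Local Open Scope ring_scope.

(** Why the theorem holds.

    Twisted cubics are algebraically skew.  The three quadrics containing the
    cubic, linearized at the point with parameters [(s : t)], say that the
    coordinates [z0, ..., z3] of a tangent vector are apolar to the square of the
    linear form vanishing at [(s : t)] ([tangent_apolar]); the conditions at two
    different parameters force [z = 0] ([apolar_eq0]).  For osculation, an
    analytic lifting is a vector of power series satisfying the quadrics.  Its
    composite with a linear form is, up to a unit, a polynomial of degree at most
    3 in a local parameter, hence vanishes to order at most 3 unless the form is
    zero ([contact_order]).

    Algebraically skew curves are twisted cubics.  Fix a point [v] of the curve.
    In the coordinates [xi0, ..., xi3] dual to the osculating frame at [v], which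
    exist because the osculating flag is nondegenerate, the curve is
    [(t^3, t^2, t, 1)] up to higher order terms.  Project from the tangent line
    at [v], that is, consider [u = xi0 / xi1].  The tangent line at [v] meets no
    other tangent line, so it meets the curve at [v] only ([base_unique]) and [u]
    is a local parameter wherever [xi1] does not vanish ([u_chart]); at [v],
    [u = t + O(t^2)].  Near [u = 0] the curve is thus parametrized by a vector
    [P] of power series in [u], normalized by [xi0(P) = u^3] and
    [xi1(P) = u^2] ([exists_germ]).
    - [P] is entire ([germ_entire]).  The curve is compact and [u] is a local
      parameter, so the local inverses of [u] over an annulus have a common
      radius of convergence and common bounds; by the identity theorem they agree
      with [P], and the radius of convergence of [P] can always be enlarged by a
      fixed amount.
    - [P] grows at most like [u^3] ([growth_bound]): where [|u|] is at least 1
      one is away from [v], and there compactness bounds every coordinate by a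
      multiple of [xi0].
    By Cauchy's estimate [P] is a polynomial vector of degree 3
    ([germ_polynomial]), and its initial terms are independent.  So the curve
    contains a twisted cubic ([exists_cubic_subset]), and equals it because both
    are irreducible of dimension 1 ([dim1_maximal]).

    The analysis uses power series with complex coefficients and the majorant
    [\sum_k |a_k| s^k], for which compositions, inverses and fixed points have
    explicit estimates.  Charts of a smooth curve come from an analytic inverse
    function theorem applied to two linear forms and two equations of the curve
    ([exists_chart]).  That the resulting arc lies on the curve is not formal,
    since two equations may cut out more than the curve: a form that vanishes on
    the curve but not on the arc would make [v] an isolated point, contradicting
    irreducibility ([forms_vanish_on_arc]). *)

(** * Formal power series *)

Record fps (K : Type) := FPS { coef : nat -> K }.

Section FpsRing.
Variable K : comNzRingType.
Implicit Types (a b : fps K) (p q : {poly K}).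

HB.instance Definition _ := gen_eqMixin (fps K).
HB.instance Definition _ := gen_choiceMixin (fps K).

Lemma fpsP a b : (forall n, coef a n = coef b n) -> a = b.
Proof. by case: a b => [a] [b] /= h; congr FPS; apply/funext. Qed.

Definition fps_add a b := FPS (fun n => coef a n + coef b n).
Definition fps_opp a := FPS (fun n => - coef a n).
Definition fps_mul a b :=
  FPS (fun n => \sum_(i < n.+1) coef a i * coef b (n - i)%N).
Definition fps_const (c : K) := FPS (fun n => if n == 0%N then c else 0).

Fact fps_addA : associative fps_add.
Proof. by move=> a b c; apply: fpsP => n /=; rewrite addrA. Qed.
Fact fps_addC : commutative fps_add.
Proof. by move=> a b; apply: fpsP => n /=; rewrite addrC. Qed.
Fact fps_add0 : left_id (fps_const 0) fps_add.
Proof. by move=> a; apply: fpsP => n /=; rewrite if_same add0r. Qed.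
Fact fps_addN : left_inverse (fps_const 0) fps_opp fps_add.
Proof. by move=> a; apply: fpsP => n /=; rewrite if_same addNr. Qed.

HB.instance Definition _ :=
  GRing.isZmodule.Build (fps K) fps_addA fps_addC fps_add0 fps_addN.

(** The truncation of [a]; ring identities are transported from polynomials. *)
Definition trunc n a : {poly K} := \poly_(i < n) coef a i.

Lemma coef_trunc n a i : (trunc n a)`_i = if (i < n)%N then coef a i else 0.
Proof. by rewrite coef_poly. Qed.

Lemma coef_mul_trunc n a b i :
  (i < n)%N -> coef (fps_mul a b) i = (trunc n a * trunc n b)`_i.
Proof.
move=> lt_in; rewrite coefM; apply: eq_bigr => j _; rewrite !coef_trunc.
by rewrite (leq_ltn_trans _ lt_in) ?(leq_ltn_trans _ lt_in) ?leq_subr // -ltnS.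
Qed.

Lemma coefM_low (p p' q q' : {poly K}) n :
  (forall i, (i <= n)%N -> p`_i = p'`_i) ->
  (forall i, (i <= n)%N -> q`_i = q'`_i) -> (p * q)`_n = (p' * q')`_n.
Proof.
move=> hp hq; rewrite !coefM; apply: eq_bigr => j _.
by rewrite hp ?hq ?leq_subr // -ltnS.
Qed.

Fact fps_mulA : associative fps_mul.
Proof.
move=> a b c; apply: fpsP => n.
rewrite (coef_mul_trunc a _ (ltnSn n)) (coef_mul_trunc _ c (ltnSn n)).
transitivity ((trunc n.+1 a * (trunc n.+1 b * trunc n.+1 c))`_n).
  apply: coefM_low => // i le_in; rewrite coef_trunc ltnS le_in.
  exact: coef_mul_trunc.
rewrite mulrA; apply: coefM_low => // i le_in; rewrite coef_trunc ltnS le_in.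
by apply/esym; exact: coef_mul_trunc.
Qed.
Fact fps_mulC : commutative fps_mul.
Proof.
move=> a b; apply: fpsP => n; rewrite !(coef_mul_trunc _ _ (ltnSn n)).
by rewrite mulrC.
Qed.
Fact fps_mul1 : left_id (fps_const 1) fps_mul.
Proof.
move=> a; apply: fpsP => n /=; rewrite big_ord_recl /= subn0 mul1r.
by rewrite big1 ?addr0 // => i _; rewrite mul0r.
Qed.
Fact fps_mulDl : left_distributive fps_mul fps_add.
Proof.
move=> a b c; apply: fpsP => n /=; rewrite -big_split.
by apply: eq_bigr => i _; rewrite mulrDl.
Qed.
Fact fps_1neq0 : fps_const 1 != fps_const 0.
Proof.
apply/eqP => /(congr1 (fun a => coef a 0%N)) /= /eqP.
by rewrite oner_eq0.
Qed.

HB.instance Definition _ := GRing.Zmodule_isComNzRing.Build (fps K)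
  fps_mulA fps_mulC fps_mul1 fps_mulDl fps_1neq0.

Lemma fcoef0 n : coef (0 : fps K) n = 0. Proof. exact: if_same. Qed.
Lemma fcoefD a b n : coef (a + b) n = coef a n + coef b n. Proof. by []. Qed.
Lemma fcoefN a n : coef (- a) n = - coef a n. Proof. by []. Qed.
Lemma fcoefB a b n : coef (a - b) n = coef a n - coef b n. Proof. by []. Qed.
Lemma fcoef1 n : coef (1 : fps K) n = (n == 0%N)%:R.
Proof. by rewrite /=; case: eqP. Qed.
Lemma fcoefM a b n :
  coef (a * b) n = \sum_(i < n.+1) coef a i * coef b (n - i)%N.
Proof. by []. Qed.
Lemma coef_sums I (r : seq I) (P : pred I) (F : I -> fps K) n :
  coef (\sum_(i <- r | P i) F i) n = \sum_(i <- r | P i) coef (F i) n.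
Proof.
by apply: (big_morph (fun a => coef a n)) => [? ?|]; rewrite ?fcoef0.
Qed.

Fact fps_const_monoid : monoid_morphism fps_const.
Proof.
split=> // c d; apply: fpsP => n; rewrite fcoefM big_ord_recl /= subn0.
rewrite big1 ?addr0 => [|i _]; last by rewrite mul0r.
by case: eqP; rewrite ?mulr0.
Qed.
Fact fps_const_zmod : zmod_morphism fps_const.
Proof. by move=> c d; apply: fpsP => n; rewrite fcoefB /=; case: eqP; rewrite ?subr0. Qed.
HB.instance Definition _ := GRing.isZmodMorphism.Build K (fps K) fps_const fps_const_zmod.
HB.instance Definition _ := GRing.isMonoidMorphism.Build K (fps K) fps_const fps_const_monoid.

Lemma coef_constM (c : K) a n : coef (fps_const c * a) n = c * coef a n.
Proof.
rewrite fcoefM big_ord_recl /= subn0 big1 ?addr0 // => i _.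
by rewrite mul0r.
Qed.
Lemma fcoefM0 a b : coef (a * b) 0 = coef a 0 * coef b 0.
Proof. by rewrite fcoefM big_ord_recl big_ord0 addr0. Qed.

Lemma fcoefM1 a b : coef (a * b) 1 = coef a 0 * coef b 1 + coef a 1 * coef b 0.
Proof. by rewrite fcoefM big_ord_recl big_ord1. Qed.

Definition fpsX : fps K := FPS (fun n => (n == 1%N)%:R).

Lemma coef_XM a n : coef (fpsX * a) n = if n is m.+1 then coef a m else 0.
Proof.
rewrite fcoefM; case: n => [|n]; first by rewrite big_ord1 mul0r.
rewrite big_ord_recl big_ord_recl /= mul0r add0r mul1r subSS subn0.
by rewrite big1 ?addr0 // => i _; rewrite mul0r.
Qed.
Lemma coef_XnM a k n :
  coef (fpsX ^+ k * a) n = if (n < k)%N then 0 else coef a (n - k)%N.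
Proof.
elim: k n => [|k IH] n; first by rewrite expr0 mul1r subn0.
by rewrite exprS -mulrA coef_XM; case: n => [|n] //; rewrite IH ltnS subSS.
Qed.
Lemma coef_Xn k n : coef (fpsX ^+ k) n = (n == k)%:R.
Proof.
rewrite -[_ ^+ k]mulr1 coef_XnM fcoef1 subn_eq0.
by case: ltngtP.
Qed.

(** ** Order of vanishing *)

Definition ord_ge k a := forall n, (n < k)%N -> coef a n = 0.

Lemma ord_ge0 a : ord_ge 0 a. Proof. by []. Qed.
Lemma ord_ge_zero k : ord_ge k 0. Proof. by move=> n _; rewrite fcoef0. Qed.
Lemma ord_ge1 a : coef a 0 = 0 -> ord_ge 1 a.
Proof. by move=> h [|n]. Qed.
Lemma ord_geD k a b : ord_ge k a -> ord_ge k b -> ord_ge k (a + b).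
Proof. by move=> ha hb n lt_nk; rewrite fcoefD ha ?hb ?addr0. Qed.
Lemma ord_geN k a : ord_ge k a -> ord_ge k (- a).
Proof. by move=> ha n lt_nk; rewrite fcoefN ha ?oppr0. Qed.
Lemma ord_ge_sum k I (r : seq I) (P : pred I) (F : I -> fps K) :
  (forall i, P i -> ord_ge k (F i)) -> ord_ge k (\sum_(i <- r | P i) F i).
Proof. by move=> h; elim/big_ind: _ => //; [exact: ord_ge_zero|exact: ord_geD]. Qed.
Lemma ord_geW j k a : (j <= k)%N -> ord_ge k a -> ord_ge j a.
Proof. by move=> le_jk ha n lt_nj; apply: ha; apply: leq_trans le_jk. Qed.
Lemma ord_geM j k a b : ord_ge j a -> ord_ge k b -> ord_ge (j + k) (a * b).
Proof.
move=> ha hb n lt_n; rewrite fcoefM big1 // => i _.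
have [lt_ij|le_ji] := ltnP i j; first by rewrite ha ?mul0r.
by rewrite hb ?mulr0 //; have := ltn_ord i; lia.
Qed.
Lemma ord_geMl k a b : ord_ge k a -> ord_ge k (b * a).
Proof. by move=> ha; apply: (@ord_geM 0). Qed.
Lemma ord_ge_exp k a : ord_ge 1 a -> ord_ge k (a ^+ k).
Proof.
move=> ha; elim: k => [|k IH]; first exact: ord_ge0.
by rewrite exprS -add1n; apply: ord_geM.
Qed.
Lemma ord_ge_eq0 a : (forall k, ord_ge k a) -> a = 0.
Proof. by move=> h; apply: fpsP => n; rewrite fcoef0 (h n.+1). Qed.
Lemma ord_geP k a : ord_ge k a -> {b | a = fpsX ^+ k * b & coef b 0 = coef a k}.
Proof.
move=> ha; exists (FPS (fun n => coef a (n + k)%N)) => //.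
apply: fpsP => n; rewrite coef_XnM /=.
by case: ltnP => [/ha//|le_kn]; rewrite subnK.
Qed.
Lemma ord_geB_coef k a b n : ord_ge k (a - b) -> (n < k)%N -> coef a n = coef b n.
Proof. by move=> h /h; rewrite fcoefB => /eqP; rewrite subr_eq0 => /eqP. Qed.
Lemma coef_ord_ge_mul k a b :
  ord_ge k a -> coef (a * b) k = coef a k * coef b 0.
Proof.
move=> ha; rewrite fcoefM big_ord_recr /= subnn big1 ?add0r // => i _.
by rewrite ha ?mul0r.
Qed.

(** ** Composition *)

(** The composite is meaningful when [b] has no constant term: then [b ^+ k]
    starts in degree [k], and only finitely many terms reach each degree. *)
Definition fps_comp a b := FPS (fun n => \sum_(k < n.+1) coef a k * coef (b ^+ k) n).

Definition poly_at b (p : {poly K}) : fps K := (map_poly fps_const p).[b].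

Lemma poly_atM b p q : poly_at b (p * q) = poly_at b p * poly_at b q.
Proof. by rewrite /poly_at rmorphM hornerM. Qed.

Lemma poly_at_sum b p n : (size p <= n)%N ->
  poly_at b p = \sum_(i < n) fps_const p`_i * b ^+ i.
Proof.
move=> le_pn; rewrite /poly_at (@horner_coef_wide _ n); last first.
  by apply: leq_trans le_pn; exact: size_poly.
by apply: eq_bigr => i _; rewrite coef_map.
Qed.

(** Up to any fixed order, composition is evaluation of a polynomial, from which
    it inherits multiplicativity. *)
Lemma comp_poly_at a b n N : coef b 0 = 0 -> (n < N)%N ->
  coef (fps_comp a b) n = coef (poly_at b (trunc N a)) n.
Proof.
move=> b0 lt_nN; rewrite (poly_at_sum _ (size_poly _ _)) coef_sums.
have -> : coef (fps_comp a b) n = \sum_(k < n.+1) coef a k * coef (b ^+ k) n by [].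
rewrite (big_ord_widen_cond N xpredT (fun k => coef a k * coef (b ^+ k) n)) //.
rewrite big_mkcond; apply: eq_bigr => i _; rewrite coef_constM coef_trunc ltn_ord /=.
case: ifP => // /negbT; rewrite -leqNgt => lt_ni.
by rewrite (ord_ge_exp (ord_ge1 b0)) ?mulr0.
Qed.

Lemma poly_at_low b p N : coef b 0 = 0 -> (forall i, (i < N)%N -> p`_i = 0) ->
  ord_ge N (poly_at b p).
Proof.
move=> b0 hp; rewrite (poly_at_sum _ (leqnn _)); apply: ord_ge_sum => i _.
have [/hp->|le_Ni] := ltnP i N; first by rewrite rmorph0 mul0r; exact: ord_ge_zero.
by apply: ord_geMl; apply: ord_geW le_Ni _; apply: ord_ge_exp; apply: ord_ge1.
Qed.

Lemma fps_compD a a' b : fps_comp (a + a') b = fps_comp a b + fps_comp a' b.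
Proof.
apply: fpsP => n; rewrite fcoefD /= -big_split; apply: eq_bigr => i _.
by rewrite mulrDl.
Qed.
Lemma fps_compM a a' b : coef b 0 = 0 ->
  fps_comp (a * a') b = fps_comp a b * fps_comp a' b.
Proof.
move=> b0; apply: fpsP => n; rewrite (comp_poly_at _ b0 (ltnSn n)).
transitivity (coef (poly_at b (trunc n.+1 a * trunc n.+1 a')) n).
  apply: (@ord_geB_coef n.+1) => //.
  have -> : forall p q, poly_at b p - poly_at b q = poly_at b (p - q).
    by move=> p q; rewrite /poly_at rmorphB hornerD hornerN.
  apply: poly_at_low => // i lt_i.
  rewrite coefB coef_trunc lt_i [coef _ _](@coef_mul_trunc n.+1 a a') //.
  by rewrite subrr.
rewrite poly_atM !fcoefM; apply: eq_bigr => i _.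
by rewrite !(@comp_poly_at _ _ _ n.+1) // ltnS leq_subr.
Qed.
Lemma fps_comp_const (c : K) b : fps_comp (fps_const c) b = fps_const c.
Proof.
apply: fpsP => n /=; rewrite big_ord_recl /= big1 => [|i _]; last by rewrite mul0r.
by rewrite addr0; case: eqP => _; rewrite ?mulr0 ?mulr1.
Qed.
Lemma fps_compX b : coef b 0 = 0 -> fps_comp fpsX b = b.
Proof.
move=> b0; apply: fpsP => -[|n]; first by rewrite /= big_ord1 mul0r b0.
have -> : coef (fps_comp fpsX b) n.+1 = \sum_(k < n.+2) (k == 1%N :> nat)%:R * coef (b ^+ k) n.+1 by [].
rewrite (bigD1 (Ordinal (isT : 1 < n.+2)%N)) //= mul1r expr1 big1 ?addr0 //.
by move=> i; rewrite -val_eqE /= => /negbTE ->; rewrite mul0r.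
Qed.
Lemma coef_comp0 a b : coef (fps_comp a b) 0 = coef a 0.
Proof. by rewrite /= big_ord1 mulr1. Qed.
End FpsRing.

(** * The modulus and limits of complex sequences *)

Section Modulus.
Variable R : realType.
Local Notation C := R[i].
Implicit Types (z w : C) (e : R).

(** The norm of [C] takes its values in [C], whose order is partial; a real
    valued modulus gives access to real inequalities. *)
Definition cn z : R := Normc.normc z.

Lemma cnE z : `|z| = (cn z)%:C%C. Proof. by case: z. Qed.
Lemma cn0 : cn 0 = 0. Proof. exact: Normc.normc0. Qed.
Lemma cn1 : cn 1 = 1. Proof. exact: Normc.normc1. Qed.
Lemma cnM z w : cn (z * w) = cn z * cn w. Proof. exact: Normc.normcM. Qed.
Lemma cnV z : cn z^-1 = (cn z)^-1. Proof. exact: Normc.normcV. Qed.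
Lemma cnD z w : cn (z + w) <= cn z + cn w. Proof. exact: le_normcD. Qed.
Lemma cnN z : cn (- z) = cn z. Proof. exact: normcN. Qed.
Lemma cn_ge0 z : 0 <= cn z. Proof. by case: z => a b; exact: sqrtr_ge0. Qed.
Lemma cn_eq0 z : (cn z == 0) = (z == 0).
Proof. by apply/eqP/eqP => [/Normc.eq0_normc|->]; rewrite ?cn0. Qed.
Lemma cn_gt0 z : (0 < cn z) = (z != 0).
Proof. by rewrite lt_def cn_eq0 cn_ge0 andbT. Qed.
Lemma cnX z n : cn (z ^+ n) = cn z ^+ n.
Proof. by elim: n => [|n IH]; rewrite ?expr0 ?cn1 // !exprS cnM IH. Qed.
Lemma cn_real (x : R) : cn x%:C%C = `|x|.
Proof. by rewrite /cn /= expr0n addr0 sqrtr_sqr. Qed.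
Lemma cn_nat n : cn n%:R = n%:R.
Proof.
have -> : (n%:R : C) = (n%:R : R)%:C%C.
  elim: n => // n IH; rewrite !mulrS IH.
  by apply/eqP; rewrite eq_complex /= addr0 !eqxx.
by rewrite cn_real ger0_norm.
Qed.
Lemma cn_distC z w : cn (z - w) = cn (w - z).
Proof. by rewrite -cnN opprB. Qed.
Lemma cn_triangle v z w : cn (z - w) <= cn (z - v) + cn (v - w).
Proof. by rewrite -[z - w](subrKA v); exact: cnD. Qed.
Lemma cn_sum I (r : seq I) (P : pred I) (F : I -> C) :
  cn (\sum_(i <- r | P i) F i) <= \sum_(i <- r | P i) cn (F i).
Proof.
elim/big_rec2: _ => [|i x y _ le_xy]; first by rewrite cn0.
by apply: le_trans (cnD _ _) _; rewrite lerD2l.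
Qed.
Lemma cn_Re z : `|complex.Re z| <= cn z.
Proof.
case: z => a b; rewrite /cn /= -sqrtr_sqr.
by rewrite ler_sqrt ?addr_ge0 ?sqr_ge0 // lerDl sqr_ge0.
Qed.
Lemma cn_Im z : `|complex.Im z| <= cn z.
Proof.
case: z => a b; rewrite /cn /= -sqrtr_sqr.
by rewrite ler_sqrt ?addr_ge0 ?sqr_ge0 // lerDr sqr_ge0.
Qed.
Lemma cn_ReIm z : cn z <= `|complex.Re z| + `|complex.Im z|.
Proof.
case: z => a b /=; rewrite /cn /=.
have /ger0_norm <- : 0 <= `|a| + `|b| by rewrite addr_ge0.
rewrite -sqrtr_sqr ler_sqrt ?sqr_ge0 // sqrrD !real_normK ?num_real //.
have := normr_ge0 a; have := normr_ge0 b; nra.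
Qed.

Lemma le_small (x y : R) : (forall e, 0 < e -> x <= y + e) -> x <= y.
Proof. by move=> h; apply/ler_addgt0Pr. Qed.

Definition clim (u : nat -> C) (l : C) :=
  forall e, 0 < e -> exists n0, forall n, (n0 <= n)%N -> cn (u n - l) < e.

Lemma clim_uniq u l l' : clim u l -> clim u l' -> l = l'.
Proof.
move=> h h'; apply/eqP; rewrite -subr_eq0 -cn_eq0 eq_le cn_ge0 andbT.
apply: le_small => e e0; have e2 : 0 < e / 2 by lra.
have [n0 H] := h _ e2; have [n1 H'] := h' _ e2.
have := cn_triangle (u (maxn n0 n1)) l l'; rewrite (cn_distC l (u _)).
have := H _ (leq_maxl n0 n1); have := H' _ (leq_maxr n0 n1); lra.
Qed.

Lemma clim_le u l M n0 : clim u l -> (forall n, (n0 <= n)%N -> cn (u n) <= M) -> cn l <= M.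
Proof.
move=> h hM; apply: le_small => e /h [n1 /(_ (maxn n0 n1) (leq_maxr _ _)) H].
have := hM _ (leq_maxl n0 n1); have := cn_triangle (u (maxn n0 n1)) l 0.
by rewrite !subr0 (cn_distC l (u _)); lra.
Qed.

Lemma climD u v l m : clim u l -> clim v m -> clim (fun n => u n + v n) (l + m).
Proof.
move=> h h' e e0; have e2 : 0 < e / 2 by lra.
have [n0 H] := h _ e2; have [n1 H'] := h' _ e2.
exists (maxn n0 n1) => n; rewrite geq_max => /andP[/H ? /H' ?].
have -> : u n + v n - (l + m) = (u n - l) + (v n - m) by ring.
by have := cnD (u n - l) (v n - m); lra.
Qed.

Lemma climM u v l m : clim u l -> clim v m -> clim (fun n => u n * v n) (l * m).
Proof.
move=> h h' e e0.
have d0 : 0 < 1 + cn l + cn m by have := cn_ge0 l; have := cn_ge0 m; lra.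
pose e2 := Num.min 1 (e / (1 + cn l + cn m) / 2).
have e20 : 0 < e2 by rewrite lt_min ltr01 divr_gt0 // divr_gt0.
have [n0 H] := h _ e20; have [n1 H'] := h' _ e20.
exists (maxn n0 n1) => n; rewrite geq_max => /andP[/H ? /H' ?].
have -> : u n * v n - l * m = (u n - l) * (v n - m) + l * (v n - m) + m * (u n - l) by ring.
have le1 : e2 <= 1 by rewrite ge_min lexx.
have lt2 : e2 * (1 + cn l + cn m) < e.
  rewrite -ltr_pdivlMr //.
  have : e2 <= e / (1 + cn l + cn m) / 2 by rewrite /e2 ge_min lexx orbT.
  have : 0 < e / (1 + cn l + cn m) by rewrite divr_gt0.
  lra.
have := cnD ((u n - l) * (v n - m) + l * (v n - m)) (m * (u n - l)).
have := cnD ((u n - l) * (v n - m)) (l * (v n - m)).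
rewrite !cnM; have := cn_ge0 (u n - l); have := cn_ge0 (v n - m); have := cn_ge0 l; have := cn_ge0 m.
move=> ? ? ? ?.
have : cn (u n - l) * cn (v n - m) <= e2 * 1 by apply: ler_pM => //; lra.
have : cn l * cn (v n - m) <= cn l * e2 by apply: ler_wpM2l => //; lra.
have : cn m * cn (u n - l) <= cn m * e2 by apply: ler_wpM2l => //; lra.
nra.
Qed.

Lemma clim_const l : clim (fun=> l) l.
Proof. by move=> e e0; exists 0%N => n _; rewrite subrr cn0. Qed.

Lemma clim_eq u v l : u =1 v -> clim u l -> clim v l.
Proof. by move=> /funext ->. Qed.

Lemma clim_sum n (u : nat -> nat -> C) (l : nat -> C) :
  (forall i, clim (u i) (l i)) ->
  clim (fun k => \sum_(i < n) u i k) (\sum_(i < n) l i).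
Proof.
move=> h; elim: n => [|n IH].
  by apply: clim_eq (@clim_const _) => k; rewrite !big_ord0.
rewrite big_ord_recr /=; apply: clim_eq (climD IH (h n)) => k.
by rewrite big_ord_recr.
Qed.

Lemma clim_shift u l k : clim u l -> clim (fun n => u (n + k)%N) l.
Proof.
move=> h e /h [n0 H]; exists n0 => n le_n; apply: H.
by rewrite (leq_trans le_n) ?leq_addr.
Qed.

(** The limit is the supremum of the eventual lower bounds. *)
Lemma real_cauchy_lim (x : nat -> R) :
  (forall e, 0 < e -> exists n0, forall m n, (n0 <= m)%N -> (n0 <= n)%N ->
     `|x m - x n| < e) ->
  exists l, forall e, 0 < e -> exists n0, forall n, (n0 <= n)%N -> `|x n - l| < e.
Proof.
move=> h.
pose E : set R := [set y | exists n0, forall n, (n0 <= n)%N -> y <= x n]%classic.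
have near_x e (e0 : 0 < e) : exists n0, (forall n, (n0 <= n)%N -> `|x n - x n0| < e) /\
    (x n0 - e <= sup E <= x n0 + e).
  have [n0 H] := h _ e0; have H1 n : (n0 <= n)%N -> `|x n - x n0| < e.
    by move=> le_n; apply: H.
  have E0 : E (x n0 - e).
    by exists n0 => n /H1; rewrite ltr_norml => /andP[? _]; lra.
  have Eub : ubound E (x n0 + e).
    move=> y [n1 H']; have := H' _ (leq_maxr n0 n1).
    by have := H1 _ (leq_maxl n0 n1); rewrite ltr_norml => /andP[_ ?]; lra.
  exists n0; split=> //; apply/andP; split.
    by apply: ub_le_sup => //; exists (x n0 + e).
  by apply: ge_sup => //; exists (x n0 - e).
exists (sup E) => e e0; have e2 : 0 < e / 2 by lra.
have [n0 [H /andP[? ?]]] := near_x _ e2; exists n0 => n /H.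
by rewrite !ltr_norml => /andP[? ?]; apply/andP; split; lra.
Qed.

Lemma complex_cauchy_lim (u : nat -> C) :
  (forall e, 0 < e -> exists n0, forall m n, (n0 <= m)%N -> (n0 <= n)%N ->
     cn (u m - u n) < e) ->
  exists l, clim u l.
Proof.
move=> h.
have [a Ha] : exists l, forall e, 0 < e -> exists n0, forall n, (n0 <= n)%N -> `|complex.Re (u n) - l| < e.
  apply: real_cauchy_lim => e /h [n0 H]; exists n0 => m n lm ln.
  apply: le_lt_trans (H m n lm ln).
  by rewrite -[_ - _]/(complex.Re (u m) - complex.Re (u n)) -raddfB; exact: cn_Re.
have [b Hb] : exists l, forall e, 0 < e -> exists n0, forall n, (n0 <= n)%N -> `|complex.Im (u n) - l| < e.
  apply: real_cauchy_lim => e /h [n0 H]; exists n0 => m n lm ln.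
  apply: le_lt_trans (H m n lm ln).
  by rewrite -raddfB; exact: cn_Im.
exists (a +i* b)%C => e e0; have e2 : 0 < e / 2 by lra.
have [n0 H0] := Ha _ e2; have [n1 H1] := Hb _ e2.
exists (maxn n0 n1) => n; rewrite geq_max => /andP[/H0 ? /H1 ?].
by apply: le_lt_trans (cn_ReIm _) _; rewrite !raddfB /=; lra.
Qed.
End Modulus.

(** * Convergent power series *)

Section TriangularSums.
Variable V : nmodType.

(** Both Cauchy products and the re-expansion of a series at another point are
    sums over triangles of indices. *)
Lemma triangular_sum (f : nat -> nat -> V) n :
  \sum_(k < n) \sum_(i < k.+1) f i (k - i)%N =
  \sum_(i < n) \sum_(j < n - i) f i j.
Proof.
elim: n => [|n IH]; first by rewrite !big_ord0.
rewrite !big_ord_recr /= IH subnn subSn // subnn big_ord1 addrA; congr (_ + _).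
rewrite -big_split; apply: eq_bigr => i _ /=.
by rewrite subSn 1?ltnW // big_ord_recr.
Qed.
End TriangularSums.

Section PartialSums.
Variable K : comNzRingType.
Implicit Types (a b : fps K) (t : K).

Definition psum a t n := \sum_(k < n) coef a k * t ^+ k.

Lemma psumD a b t n : psum (a + b) t n = psum a t n + psum b t n.
Proof. by rewrite -big_split; apply: eq_bigr => i _; rewrite fcoefD mulrDl. Qed.

Lemma psum_mul a b t n : psum (a * b) t n =
  \sum_(i < n) \sum_(j < n - i) (coef a i * t ^+ i) * (coef b j * t ^+ j).
Proof.
rewrite -(triangular_sum (fun i j => (coef a i * t ^+ i) * (coef b j * t ^+ j))).
apply: eq_bigr => k _; rewrite fcoefM big_distrl /=.
by apply: eq_bigr => i _; rewrite mulrACA -exprD subnKC // -ltnS.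
Qed.

(** The series of [a^(k) / k!]. *)
Definition dshift k a := FPS (fun m => 'C(m + k, k)%:R * coef a (m + k)).

Lemma psum_binomial a v h n : psum a (v + h) n =
  \sum_(k < n) h ^+ k * psum (dshift k a) v (n - k).
Proof.
transitivity (\sum_(k < n) \sum_(m < n - k)
   ('C(m + k, k)%:R * coef a (m + k) * v ^+ m * h ^+ k)).
  rewrite -(triangular_sum (fun k m => 'C(m + k, k)%:R * coef a (m + k) * v ^+ m * h ^+ k)).
  apply: eq_bigr => N _; rewrite exprDn big_distrr /=.
  apply: eq_bigr => k _; have le_kN : (k <= N)%N by rewrite -ltnS.
  by rewrite subnK // -mulr_natl; ring.
apply: eq_bigr => k _; rewrite /psum big_distrr /=; apply: eq_bigr => m _.
by rewrite mulrC.
Qed.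
End PartialSums.

Section Convergence.
Variable R : realType.
Local Notation C := R[i].
Implicit Types (a b : fps C) (t v h z : C) (s r e M : R).

Definition fps_abs a : fps R := FPS (fun n => cn (coef a n)).
(** The partial sums of the majorant at radius [s]: subadditive,
    submultiplicative and monotone, so every estimate on series is made on them. *)
Definition pn s a n : R := psum (fps_abs a) s n.
(** Absolute convergence on the closed disc of radius [s]. *)
Definition acv s a := exists M, forall n, pn s a n <= M.

Lemma pnE s a n : pn s a n = \sum_(k < n) cn (coef a k) * s ^+ k. Proof. by []. Qed.
Lemma pnS s a n : pn s a n.+1 = pn s a n + cn (coef a n) * s ^+ n.
Proof. by rewrite !pnE big_ord_recr. Qed.
Lemma pn_term_ge0 s a k : 0 <= s -> 0 <= cn (coef a k) * s ^+ k.
Proof. by move=> s0; rewrite mulr_ge0 ?cn_ge0 ?exprn_ge0. Qed.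
Lemma pn_ge0 s a n : 0 <= s -> 0 <= pn s a n.
Proof. by move=> s0; apply: sumr_ge0 => i _; apply: pn_term_ge0. Qed.
Lemma pn_homo s a m n : 0 <= s -> (m <= n)%N -> pn s a m <= pn s a n.
Proof.
move=> s0 /subnK <-; elim: (n - m)%N => // k IH; rewrite addSn pnS.
by rewrite (le_trans IH) // lerDl pn_term_ge0.
Qed.
Lemma pn_le_radius r s a n : 0 <= r -> r <= s -> pn r a n <= pn s a n.
Proof.
move=> r0 rs; apply: ler_sum => i _; apply: ler_wpM2l; first exact: cn_ge0.
by rewrite lerXn2r // nnegrE (le_trans r0).
Qed.
Lemma pnD s a b n : 0 <= s -> pn s (a + b) n <= pn s a n + pn s b n.
Proof.
move=> s0; rewrite !pnE -big_split; apply: ler_sum => i _ /=.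
by rewrite -mulrDl ler_wpM2r ?exprn_ge0 // cnD.
Qed.
Lemma pnN s a n : pn s (- a) n = pn s a n.
Proof. by apply: eq_bigr => i _ /=; rewrite cnN. Qed.
Lemma pnB s a b n : 0 <= s -> pn s (a - b) n <= pn s a n + pn s b n.
Proof. by move=> s0; rewrite -(pnN s b); exact: pnD. Qed.
Lemma pn0 s n : pn s 0 n = 0.
Proof. by rewrite pnE big1 // => i _; rewrite fcoef0 cn0 mul0r. Qed.
Lemma pn_const s c n : 0 <= s -> pn s (fps_const c) n <= cn c.
Proof.
case: n => [|n] s0; first by rewrite pnE big_ord0 cn_ge0.
rewrite pnE big_ord_recl expr0 mulr1 big1 ?addr0 // => i _.
by rewrite lift0 cn0 mul0r.
Qed.
Lemma pn_constM s c a n : pn s (fps_const c * a) n = cn c * pn s a n.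
Proof.
rewrite !pnE big_distrr; apply: eq_bigr => i _.
by rewrite coef_constM cnM -mulrA.
Qed.
Lemma pnX s n : 0 <= s -> pn s (fpsX C) n <= s.
Proof.
move=> s0; apply: le_trans (pn_homo _ s0 (leq_addr 2 n)) _.
rewrite addn2 pnE 2!big_ord_recl big1 => [|i _]; last by rewrite !lift0 cn0 mul0r.
by rewrite lift0 cn0 cn1 mul0r mul1r expr1 add0r addr0.
Qed.

Lemma pnM s a b n : 0 <= s -> pn s (a * b) n <= pn s a n * pn s b n.
Proof.
move=> s0; apply: (@le_trans _ _ (psum (fps_abs a * fps_abs b) s n)).
  apply: ler_sum => k _; rewrite ler_wpM2r ?exprn_ge0 //.
  by apply: le_trans (cn_sum _ _ _) _; apply: ler_sum => i _; rewrite cnM.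
rewrite psum_mul !pnE big_distrl /=; apply: ler_sum => i _.
rewrite big_distrr /= (big_ord_widen n (fun j => (cn (coef a i) * s ^+ i) * (cn (coef b j) * s ^+ j))) ?leq_subr //.
rewrite big_mkcond /=; apply: ler_sum => j _; case: ifP => // _.
by rewrite mulr_ge0 // mulr_ge0 ?cn_ge0 ?exprn_ge0.
Qed.
Lemma pn_exp s a n k : 0 <= s -> (0 < n)%N -> pn s (a ^+ k) n <= pn s a n ^+ k.
Proof.
move=> s0 n0; elim: k => [|k IH].
  by rewrite !expr0; apply: le_trans (pn_const _ _ s0) _; rewrite cn1.
rewrite !exprS; apply: le_trans (pnM _ _ _ s0) _.
by apply: ler_wpM2l => //; exact: pn_ge0.
Qed.

Lemma acvD s a b : 0 <= s -> acv s a -> acv s b -> acv s (a + b).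
Proof.
move=> s0 [M hM] [N hN]; exists (M + N) => n.
by apply: le_trans (pnD _ _ _ s0) _; apply: lerD.
Qed.
Lemma acvM s a b : 0 <= s -> acv s a -> acv s b -> acv s (a * b).
Proof.
move=> s0 [M hM] [N hN]; exists (M * N) => n.
by apply: le_trans (pnM _ _ _ s0) _; apply: ler_pM; rewrite ?pn_ge0.
Qed.
Lemma acv_const s c : 0 <= s -> acv s (fps_const c).
Proof. by move=> s0; exists (cn c) => n; exact: pn_const. Qed.
Lemma acvN s a : acv s a -> acv s (- a).
Proof. by move=> [M hM]; exists M => n; rewrite pnN. Qed.
Lemma acvB s a b : 0 <= s -> acv s a -> acv s b -> acv s (a - b).
Proof. by move=> s0 ha hb; apply: acvD => //; apply: acvN. Qed.
Lemma acvX s : 0 <= s -> acv s (fpsX C).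
Proof. by move=> s0; exists s => n; exact: pnX. Qed.
Lemma acvXn s a k : 0 <= s -> acv s a -> acv s (a ^+ k).
Proof.
move=> s0 ha; elim: k => [|k IH]; first exact: acv_const.
by rewrite exprS; apply: acvM.
Qed.
Lemma acv_le r s a : 0 <= r -> r <= s -> acv s a -> acv r a.
Proof.
by move=> r0 rs [M hM]; exists M => n; apply: le_trans (hM n); apply: pn_le_radius.
Qed.

(** Comparison with a geometric series. *)
Lemma acv_bound s a M r : 0 <= r -> r < s ->
  (forall k, cn (coef a k) * s ^+ k <= M) -> acv r a.
Proof.
move=> r0 rs hM; have s0 : 0 < s by apply: le_lt_trans rs.
have M0 : 0 <= M by apply: le_trans (hM 0%N); apply: pn_term_ge0; apply: ltW.
have q0 : 0 <= r / s by rewrite divr_ge0 // ltW.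
have q1 : r / s < 1 by rewrite ltr_pdivrMr // mul1r.
exists (M / (1 - r / s)) => n.
apply: (@le_trans _ _ (\sum_(k < n) M * (r / s) ^+ k)).
  apply: ler_sum => k _ /=; rewrite expr_div_n mulrA -(mulrC (s ^+ k)^-1) mulrA.
  apply: ler_wpM2r; first exact: exprn_ge0.
  by rewrite mulrC ler_pdivlMr ?exprn_gt0 //; apply: hM.
rewrite -big_distrr /= ler_pdivlMr ?subr_gt0 // -mulrA ler_piMr //.
rewrite mulrC -opprB mulNr -subrX1 opprB lerBlDr lerDl exprn_ge0 //.
Qed.

(** A bounded monotone sequence is Cauchy. *)
Lemma acv_tail s a e : 0 <= s -> acv s a -> 0 < e ->
  exists n0, forall m n, (n0 <= m)%N -> pn s a n - pn s a m <= e.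
Proof.
move=> s0 [M hM] e0; pose E : set R := range (pn s a).
have hE : has_sup E by split; [exists (pn s a 0), 0%N | exists M => _ [n _ <-]].
have [_ [n0 _ <-] h] := sup_adherent e0 hE.
exists n0 => m n le_m; have := pn_homo a s0 le_m.
have : pn s a n <= sup E by apply: ub_le_sup; [case: hE | exists n].
lra.
Qed.

Lemma psum_diff s a t m n : 0 <= s -> cn t <= s -> (m <= n)%N ->
  cn (psum a t n - psum a t m) <= pn s a n - pn s a m.
Proof.
move=> s0 ts /subnK <-; elim: (n - m)%N => [|k IH].
  by rewrite !subrr cn0.
rewrite addSn pnS {1}/psum big_ord_recr /= -/(psum a t (k + m)).
rewrite addrAC [leRHS]addrAC; apply: le_trans (cnD _ _) _; apply: lerD => //.
rewrite cnM cnX ler_wpM2l ?cn_ge0 // lerXn2r // nnegrE ?cn_ge0 //.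
Qed.

Lemma psum_clim s a t : 0 <= s -> cn t <= s -> acv s a ->
  exists l, clim (psum a t) l.
Proof.
move=> s0 ts ha; apply: complex_cauchy_lim => e e0.
have e2 : 0 < e / 2 by lra.
have [n0 H] := acv_tail s0 ha e2; exists n0 => m n.
wlog le_mn : m n / (m <= n)%N => [hw|] n0m n0n.
  by case/orP: (leq_total m n) => le; [|rewrite cn_distC]; apply: hw.
rewrite cn_distC; apply: le_lt_trans (psum_diff a s0 ts le_mn) _.
by have := H _ n n0m; lra.
Qed.

(** The sum of the series at [t]; meaningful where it converges. *)
Definition ev a t : C := xget 0 [set l | clim (psum a t) l]%classic.

Lemma ev_lim a t l : clim (psum a t) l -> ev a t = l.
Proof. by move=> h; rewrite /ev; case: xgetP => [x _ /= hx|/(_ l)//]; exact: clim_uniq hx h. Qed.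

Lemma ev_clim s a t : 0 <= s -> acv s a -> cn t <= s -> clim (psum a t) (ev a t).
Proof. by move=> s0 ha ts; have [l h] := psum_clim s0 ts ha; rewrite (ev_lim h). Qed.

Lemma ev_tail s a e : 0 <= s -> acv s a -> 0 < e -> exists n0, forall n t,
  (n0 <= n)%N -> cn t <= s -> cn (psum a t n - ev a t) <= e.
Proof.
move=> s0 ha e0; have [n0 H] := acv_tail s0 ha e0; exists n0 => n t n0n ts.
have hl := climD (clim_const (psum a t n)) (climM (clim_const (-1)) (ev_clim s0 ha ts)).
rewrite -mulN1r; apply: (clim_le (n0 := n) hl) => m le_nm.
rewrite mulN1r cn_distC; apply: le_trans (psum_diff a s0 ts le_nm) _.
exact: H.
Qed.

Lemma ev_le_pn s a t M : 0 <= s -> cn t <= s -> (forall n, pn s a n <= M) -> cn (ev a t) <= M.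
Proof.
move=> s0 ts hM; have ha : acv s a by exists M.
apply: (clim_le (n0 := 0) (ev_clim s0 ha ts)) => n _.
have := psum_diff a s0 ts (leq0n n).
by rewrite /pn /psum !big_ord0 !subr0 => /le_trans; apply; exact: hM.
Qed.

Lemma ev_const c t : ev (fps_const c) t = c.
Proof.
apply: ev_lim => e e0; exists 1%N => -[//|n] _.
rewrite /psum big_ord_recl expr0 mulr1 big1 ?addr0 ?subrr ?cn0 // => i _.
by rewrite lift0 mul0r.
Qed.
Lemma ev0 t : ev 0 t = 0. Proof. by rewrite -(rmorph0 (@fps_const C)) ev_const. Qed.
Lemma evX t : ev (fpsX C) t = t.
Proof.
apply: ev_lim => e e0; exists 2%N => -[|[|n]] // _.
rewrite /psum 2!big_ord_recl big1 => [|i _]; last by rewrite !lift0 mul0r.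
by rewrite lift0 mul0r add0r addr0 mul1r expr1 subrr cn0.
Qed.

Section Eval.
Variables (s : R) (t : C).
Hypotheses (s0 : 0 <= s) (ts : cn t <= s).

Lemma evD a b : acv s a -> acv s b -> ev (a + b) t = ev a t + ev b t.
Proof.
move=> ha hb; apply: ev_lim; apply: clim_eq (climD (ev_clim s0 ha ts) (ev_clim s0 hb ts)).
by move=> n; rewrite psumD.
Qed.

(** Cauchy products: the terms of [psum a * psum b] missing from
    [psum (a * b)] have indices [i + j >= n], and those with [i, j < n/2] are
    all present, so the difference is controlled by the tails of the majorants. *)
Lemma psumM_diff a b n : cn (psum a t n * psum b t n - psum (a * b) t n) <=
  pn s a n * pn s b n - pn s a n./2 * pn s b n./2.
Proof.
pose f i j := (coef a i * t ^+ i) * (coef b j * t ^+ j).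
pose g i j := (cn (coef a i) * s ^+ i) * (cn (coef b j) * s ^+ j).
have g0 i j : 0 <= g i j by rewrite mulr_ge0 ?pn_term_ge0.
have fg i j : cn (f i j) <= g i j.
  rewrite /f /g !cnM !cnX; apply: ler_pM; rewrite ?mulr_ge0 ?cn_ge0 ?exprn_ge0 ?cn_ge0 //;
  by apply: ler_wpM2l; rewrite ?cn_ge0 // lerXn2r // nnegrE ?cn_ge0.
have psq (K : comNzRingType) (x y : nat -> K) m : (m <= n)%N ->
    (\sum_(i < m) x i) * (\sum_(j < m) y j) =
    \sum_(i < n) \sum_(j < n | (i < m)%N && (j < m)%N) x i * y j.
  move=> le_mn; rewrite big_distrl (big_ord_widen n (fun i => x i * \sum_(j < m) y j)) //=.
  rewrite big_mkcond; apply: eq_bigr => i _; case: ifP => im; last first.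
    by rewrite big_pred0.
  by rewrite big_distrr (big_ord_widen n (fun j => x i * y j)).
have hn : (n./2 <= n)%N by lia.
rewrite psum_mul !pnE {1 2}/psum.
rewrite (psq C (fun i => coef a i * t ^+ i) (fun i => coef b i * t ^+ i) n (leqnn n)).
have psqR := psq R (fun i => cn (coef a i) * s ^+ i) (fun i => cn (coef b i) * s ^+ i).
rewrite (psqR n (leqnn n)) (psqR _ hn) -!sumrB; apply: le_trans (cn_sum _ _ _) _; apply: ler_sum => i _.
rewrite (big_ord_widen n (f i)) ?leq_subr //.
rewrite big_mkcond [X in _ - X]big_mkcond [X in _ <= X - _]big_mkcond.
rewrite [X in _ <= _ - X]big_mkcond -!sumrB.
apply: le_trans (cn_sum _ _ _) _; apply: ler_sum => j _.
rewrite !ltn_ord /=; case: ifP => [|/negbT] ij.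
  by rewrite subrr cn0; case: ifP => _; rewrite ?subrr ?subr0 //; exact: g0.
rewrite subr0; case: ifP => [/andP[i2 j2]|_]; last by rewrite subr0; exact: fg.
by exfalso; move: ij i2 j2 (ltn_ord i); lia.
Qed.

Lemma evM a b : acv s a -> acv s b -> ev (a * b) t = ev a t * ev b t.
Proof.
move=> ha hb; have [M hM] := ha; have [N hN] := hb.
have M0 : 0 <= M by apply: le_trans (hM 0%N); exact: pn_ge0.
have N0 : 0 <= N by apply: le_trans (hN 0%N); exact: pn_ge0.
apply: ev_lim => e e0; have e2 : 0 < e / 2 by lra.
pose d := e / 2 / (1 + M + N) / 2.
have d0 : 0 < d by rewrite !divr_gt0 // -addrA ltr_wpDr ?addr_ge0.
have [n0 H0] := acv_tail s0 ha d0; have [n1 H1] := acv_tail s0 hb d0.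
have [n2 H2] := climM (ev_clim s0 ha ts) (ev_clim s0 hb ts) e2.
exists (maxn n2 (maxn n0 n1).*2) => n; rewrite geq_max => /andP[/H2 ltn2 le_n].
apply: le_lt_trans (cn_triangle (psum a t n * psum b t n) _ _) _.
rewrite cn_distC; have := psumM_diff a b n.
have le_h : ((maxn n0 n1) <= n./2)%N by lia.
have [le0 le1] : (n0 <= n./2)%N /\ (n1 <= n./2)%N by move: le_h; rewrite geq_max => /andP.
have A := H0 _ n le0; have B := H1 _ n le1.
have := pn_ge0 a n./2 s0; have := pn_ge0 b n s0; have := hM n./2; have := hN n.
set p := pn s a n in A *; set q := pn s b n in B *.
set p' := pn s a n./2 in A *; set q' := pn s b n./2 in B *.
move=> qN p'M q0 p'0; have -> : p * q - p' * q' = (p - p') * q + p' * (q - q') by ring.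
have : (p - p') * q <= d * N.
  by apply: le_trans (ler_wpM2l (ltW d0) qN); apply: ler_wpM2r.
have : p' * (q - q') <= M * d.
  by apply: le_trans (ler_wpM2r (ltW d0) p'M); apply: ler_wpM2l.
have : d * (1 + M + N) = e / 4.
  by rewrite /d; field; lra.
nra.
Qed.
End Eval.
End Convergence.

(** * Recentring, Cauchy estimates and the identity theorem *)

Section Recenter.
Variable R : realType.
Local Notation C := R[i].
Implicit Types (a b : fps C) (t v h z : C) (s r e M rho : R).

Lemma fps_abs_dshift k a : fps_abs (dshift k a) = dshift k (fps_abs a).
Proof. by apply: fpsP => m /=; rewrite cnM cn_nat. Qed.

Lemma pn_binomial rho r a N : pn (rho + r) a N =
  \sum_(k < N) r ^+ k * pn rho (dshift k a) (N - k).
Proof.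
by rewrite /pn psum_binomial; apply: eq_bigr => k _; rewrite fps_abs_dshift.
Qed.

(** The majorant of the double series obtained by expanding around a point of
    modulus [rho]: its terms all occur in the majorant of [a] at [rho + r]. *)
Lemma pn_dshift_sum rho r a n K : 0 <= rho -> 0 <= r ->
  \sum_(k < K) r ^+ k * pn rho (dshift k a) n <= pn (rho + r) a (n + K).
Proof.
move=> p0 r0; rewrite pn_binomial.
rewrite (big_ord_widen (n + K) (fun k => r ^+ k * pn rho (dshift k a) n)) ?leq_addl //.
rewrite big_mkcond; apply: ler_sum => k _.
case: ifP => [lt_kK|_]; last by rewrite mulr_ge0 ?exprn_ge0 ?pn_ge0.
by rewrite ler_wpM2l ?exprn_ge0 // pn_homo //; lia.
Qed.

Lemma acv_dshift rho r s a k : 0 <= rho -> 0 < r -> rho + r <= s ->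
  acv s a -> acv rho (dshift k a).
Proof.
move=> p0 r0 prs [M hM]; exists (M / r ^+ k) => n.
rewrite ler_pdivlMr ?exprn_gt0 // mulrC.
apply: le_trans (hM (n + k.+1)%N).
apply: le_trans (pn_le_radius _ _ _ prs); last by rewrite addr_ge0 // ltW.
apply: le_trans (pn_dshift_sum _ n k.+1 p0 (ltW r0)).
rewrite big_ord_recr /= lerDr sumr_ge0 // => i _.
by rewrite mulr_ge0 ?exprn_ge0 ?pn_ge0 // ltW.
Qed.

Lemma pn_diff_le_radius r s a m j : 0 <= r -> r <= s ->
  pn r a (m + j) - pn r a m <= pn s a (m + j) - pn s a m.
Proof.
move=> r0 rs; elim: j => [|j IH]; first by rewrite addn0 !subrr.
rewrite addnS !pnS addrAC [leRHS]addrAC; apply: lerD => //.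
by apply: ler_wpM2l; rewrite ?cn_ge0 // lerXn2r // nnegrE (le_trans r0).
Qed.

(** The Taylor coefficients at [v] of the sum of [a]. *)
Definition recenter a v : fps C := FPS (fun k => ev (dshift k a) v).

Lemma phase z : exists2 w, cn w <= 1 & w * z = (cn z)%:C%C.
Proof.
have [->|z0] := eqVneq z 0; first by exists 0; rewrite ?cn0 ?mul0r ?ler01.
exists ((cn z)%:C%C / z); last by rewrite divfK.
by rewrite cnM cnV cn_real ger0_norm ?cn_ge0 // divff ?cn_eq0.
Qed.

Lemma psum_le_pn s a t n : 0 <= s -> cn t <= s -> cn (psum a t n) <= pn s a n.
Proof.
move=> s0 ts; have := psum_diff a s0 ts (leq0n n).
by rewrite /pn /psum !big_ord0 !subr0.
Qed.

Section Radii.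
Variables (rho r s : R) (a : fps C) (v : C).
Hypotheses (p0 : 0 <= rho) (r0 : 0 < r) (prs : rho + r <= s) (vp : cn v <= rho).

(** Multiplying the coefficients by suitable phases turns the majorant into the
    modulus of a limit of finite sums, to which the previous bound applies. *)
Lemma recenter_pn M : (forall n, pn s a n <= M) ->
  forall K, pn r (recenter a v) K <= M.
Proof.
move=> hM K; have ha : acv s a by exists M.
have /choice [w hw] : forall k, exists w, cn w <= 1 /\
    w * ev (dshift k a) v = (cn (ev (dshift k a) v))%:C%C.
  by move=> k; have [w w1 w2] := phase (ev (dshift k a) v); exists w.
pose L := \sum_(k < K) (w k * (r%:C)%C ^+ k) * ev (dshift k a) v.
have -> : pn r (recenter a v) K = cn L.
  have -> : L = (pn r (recenter a v) K)%:C%C.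
    rewrite pnE /L raddf_sum /=; apply: eq_bigr => k _.
    by rewrite mulrAC (hw k).2 rmorphM rmorphXn.
  by rewrite cn_real ger0_norm // pn_ge0 // ltW.
have hL : clim (fun n => \sum_(k < K) (w k * (r%:C)%C ^+ k) * psum (dshift k a) v n) L.
  apply: (@clim_sum R K (fun k n => (w k * (r%:C)%C ^+ k) * psum (dshift k a) v n)
    (fun k => (w k * (r%:C)%C ^+ k) * ev (dshift k a) v)) => k.
  by apply: climM (clim_const _) (ev_clim p0 _ vp); apply: acv_dshift prs ha.
apply: (clim_le (n0 := 0) hL) => n _.
apply: le_trans (hM (n + K)%N).
apply: le_trans (pn_le_radius _ _ _ prs); last by rewrite addr_ge0 // ltW.
apply: le_trans (pn_dshift_sum _ n K p0 (ltW r0)).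
apply: le_trans (cn_sum _ _ _) _; apply: ler_sum => k _.
rewrite !cnM cnX cn_real ger0_norm ?(ltW r0) //; apply: ler_pM.
- by rewrite mulr_ge0 ?cn_ge0 ?exprn_ge0 // ltW.
- exact: cn_ge0.
- by rewrite ler_piMl ?exprn_ge0 ?(hw k).1 // ltW.
- exact: psum_le_pn.
Qed.

Lemma acv_recenter : acv s a -> acv r (recenter a v).
Proof. by move=> [M hM]; exists M => n; exact: recenter_pn. Qed.

(** For fixed [N], the error of the double series truncated at [N] is a limit
    of differences of partial sums of [a], hence bounded by the tail at [N]. *)
Lemma recenter_ev h : cn h <= r -> acv s a ->
  ev (recenter a v) h = ev a (v + h).
Proof.
move=> hr ha; have s0 : 0 <= s by apply: le_trans prs; rewrite addr_ge0 // ltW.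
have vh : cn (v + h) <= s.
  by apply: le_trans (cnD _ _) _; apply: le_trans prs; apply: lerD.
apply: ev_lim => e e0; have e2 : 0 < e / 4 by lra.
have [n0 H0] := acv_tail s0 ha e2; have [n1 H1] := ev_tail s0 ha e2.
exists (maxn n0 n1) => N; rewrite geq_max => /andP[le0 le1].
apply: le_lt_trans (cn_triangle (psum a (v + h) N) _ _) _.
have := H1 N _ le1 vh.
suff : cn (psum (recenter a v) h N - psum a (v + h) N) <= e / 4 by lra.
pose u j := \sum_(k < N) h ^+ k * (psum (dshift k a) v (N - k + j) - psum (dshift k a) v (N - k)).
have hu : clim u (psum (recenter a v) h N - psum a (v + h) N).
  rewrite psum_binomial -sumrB.
  apply: clim_eq (@clim_sum R N
    (fun k j => h ^+ k * (psum (dshift k a) v (j + (N - k)) - psum (dshift k a) v (N - k)))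
    (fun k => ev (dshift k a) v * h ^+ k - h ^+ k * psum (dshift k a) v (N - k)) _).
    by move=> j; apply: eq_bigr => k _; rewrite (addnC j).
  move=> k; rewrite (mulrC _ (h ^+ k)) -mulrBr.
  apply: climM (clim_const _) _.
  apply: (climD (v := fun=> - psum (dshift k a) v (N - k))); last exact: clim_const.
  by apply: clim_shift; apply: ev_clim p0 _ vp; apply: acv_dshift prs ha.
apply: (clim_le (n0 := 0) hu) => j _.
apply: le_trans (H0 _ (N + j)%N le0).
apply: (@le_trans _ _ (pn (rho + r) a (N + j) - pn (rho + r) a N)); last first.
  by apply: pn_diff_le_radius => //; rewrite addr_ge0 // ltW.
apply: le_trans (cn_sum _ _ _) _.
rewrite !pn_binomial.
rewrite (big_ord_widen (N + j) (fun k => r ^+ k * pn rho (dshift k a) (N - k))) ?leq_addr //.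
rewrite (big_ord_widen (N + j) (fun k => cn (h ^+ k *
  (psum (dshift k a) v (N - k + j) - psum (dshift k a) v (N - k))))) ?leq_addr //.
rewrite [leLHS]big_mkcond [X in _ <= _ - X]big_mkcond -sumrB; apply: ler_sum => k _.
case: ifP => [lt_kN|_]; last by rewrite subr0 mulr_ge0 ?exprn_ge0 ?pn_ge0 // ltW.
rewrite -mulrBr cnM cnX; apply: ler_pM; rewrite ?exprn_ge0 ?cn_ge0 //.
  by rewrite lerXn2r // nnegrE ?cn_ge0 ?ltW.
by rewrite -addnBAC 1?ltnW //; apply: psum_diff => //; rewrite leq_addr.
Qed.
End Radii.

(** ** Cauchy estimates *)

Lemma exists_prim_root n : (0 < n)%N -> exists w : C, n.-primitive_root w.
Proof.
pose p : {poly C} := 'X^n - 1; have [r Dp] := closed_field_poly_normal p => n_gt0.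
move: Dp; rewrite (monicP _) ?monicXnsubC // scale1r => Dp.
have rn1 : all n.-unity_root r by apply/allP=> z; rewrite -root_prod_XsubC -Dp.
have sz_r : (n < (size r).+1)%N.
  by rewrite -(size_prod_XsubC r id) -Dp size_XnsubC.
have [|z] := hasP (has_prim_root n_gt0 rn1 _ sz_r); last by exists z.
by rewrite -separable_prod_XsubC -Dp separable_Xn_sub_1 // pnatr_eq0 -lt0n.
Qed.

Lemma cn_unity (w : C) n : (0 < n)%N -> w ^+ n = 1 -> cn w = 1.
Proof.
move=> n0 /(congr1 (@cn R)); rewrite cnX cn1 => /eqP.
by rewrite pexpr_eq1 ?cn_ge0 // => /eqP.
Qed.

(** Orthogonality of the characters of the group of [n]-th roots of unity. *)
Lemma sum_prim_root n (w : C) (i k : 'I_n) : n.-primitive_root w ->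
  \sum_(j < n) (w ^+ j) ^+ i * (w ^+ j) ^- k = if i == k then n%:R else 0.
Proof.
move=> hw; have n0 := prim_order_gt0 hw; have wn := prim_expr_order hw.
have w0 : w != 0 by rewrite (prim_root_eq0 hw) -lt0n.
pose q := w ^+ i / w ^+ k.
have -> : \sum_(j < n) (w ^+ j) ^+ i * (w ^+ j) ^- k = \sum_(j < n) q ^+ j.
  apply: eq_bigr => j _; rewrite /q expr_div_n -!exprM.
  by rewrite (mulnC j i) (mulnC j k).
case: eqP => [ik|/eqP ik].
  rewrite (eq_bigr (fun=> 1)) ?sumr_const ?card_ord // => j _.
  by rewrite /q ik divff ?expf_neq0 // expr1n.
have q1 : q - 1 != 0.
  rewrite subr_eq0; apply: contra ik => /eqP /(congr1 (fun x => x * w ^+ k)).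
  rewrite mul1r /q divfK ?expf_neq0 // => /eqP; rewrite (eq_prim_root_expr hw).
  by rewrite !modn_small.
apply: (mulfI q1); rewrite mulr0 -subrX1 /q expr_div_n -!exprM.
by rewrite mulnC exprM wn expr1n mulnC exprM wn expr1n divr1 subrr.
Qed.

(** Averaging a partial sum of degree [< n] against the [n]-th roots of unity
    isolates each coefficient. *)
Lemma cauchy_est s a M : 0 <= s -> acv s a ->
  (forall u, cn u = s -> cn (ev a u) <= M) ->
  forall k, cn (coef a k) * s ^+ k <= M.
Proof.
move=> s0 ha hM k; apply: le_small => e e0.
have [n0 H] := ev_tail s0 ha e0; pose n := (maxn n0 k.+1).
have ngt : (0 < n)%N by rewrite leq_max orbT.
have [w hw] := exists_prim_root ngt.
have lt_kn : (k < n)%N by rewrite leq_max leqnn orbT.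
have w1 (j : nat) : cn (w ^+ j) = 1 by rewrite cnX (cn_unity ngt (prim_expr_order hw)) expr1n.
have key : \sum_(j < n) (w ^+ j) ^- k * psum a (s%:C%C * w ^+ j) n =
   n%:R * (coef a k * s%:C%C ^+ k).
  have -> : n%:R * (coef a k * s%:C%C ^+ k) =
     \sum_(i < n) (coef a i * s%:C%C ^+ i) * (if i == Ordinal lt_kn then n%:R else 0).
    rewrite (bigD1 (Ordinal lt_kn)) //= eqxx big1 ?addr0 ?(mulrC _ n%:R) //.
    by move=> i /negbTE ->; rewrite mulr0.
  under eq_bigr => j _ do rewrite /psum big_distrr /=.
  rewrite exchange_big /=; apply: eq_bigr => i _.
  rewrite -(sum_prim_root _ _ hw) big_distrr /=; apply: eq_bigr => j _.
  by rewrite exprMn; ring.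
have ngtR : 0 < n%:R :> R by rewrite ltr0n.
rewrite -(ler_pM2l ngtR).
have -> : n%:R * (cn (coef a k) * s ^+ k) = cn (n%:R * (coef a k * s%:C%C ^+ k)).
  by rewrite !cnM cn_nat cnX cn_real ger0_norm.
rewrite -key; apply: le_trans (cn_sum _ _ _) _.
have -> : n%:R * (M + e) = \sum_(j < n) (M + e) by rewrite sumr_const card_ord mulr_natl.
apply: ler_sum => j _; rewrite cnM cnV cnX w1 expr1n invr1 mul1r.
have sw : cn (s%:C%C * w ^+ j) = s by rewrite cnM w1 mulr1 cn_real ger0_norm.
have hu := hM _ sw; have := H n (s%:C%C * w ^+ j) (leq_maxl _ _); rewrite sw => /(_ (lexx _)).
have := cnD (psum a (s%:C%C * w ^+ j) n - ev a (s%:C%C * w ^+ j)) (ev a (s%:C%C * w ^+ j)).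
rewrite subrK; lra.
Qed.

(** Identity theorem: Cauchy's estimate for [a - b], with bound 0 on the circle. *)
Lemma ev_inj s a b : 0 < s -> acv s a -> acv s b ->
  (forall t, cn t <= s -> ev a t = ev b t) -> a = b.
Proof.
move=> s0 ha hb h; apply/eqP; rewrite -subr_eq0; apply/eqP/fpsP => k.
have hab : acv s (a - b) by apply: acvB => //; exact: ltW.
have := cauchy_est (M := 0) (ltW s0) hab _ k; rewrite fcoef0 => H.
apply/eqP; rewrite -cn_eq0 eq_le cn_ge0 andbT.
rewrite -(pmulr_lle0 _ (exprn_gt0 k s0)) H // => u us.
have us' : cn u <= s by rewrite us.
have -> : a - b = a + fps_const (-1) * b by rewrite rmorphN1 mulN1r.
have hc : acv s (fps_const (-1) : fps C) by apply: acv_const; exact: ltW.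
rewrite (evD (ltW s0) us') ?(evM (ltW s0) us') //; last by apply: acvM => //; exact: ltW.
by rewrite ev_const h // mulN1r subrr cn0.
Qed.
End Recenter.

(** * Polynomials in several variables *)

Section MPoly.
Variables (K : comNzRingType) (n : nat).
Local Notation mp := (mpoly.mpoly n K).
Implicit Types (F G : mp) (v : 'I_n -> K).

Definition pX i : mp := mpoly.mpolyX K (mpoly.mnm1 i).
Definition pC (c : K) : mp := mpoly.mpolyC n c.

(** Statements about polynomials are proved below by induction on the way they
    are built from constants and variables, which avoids monomials. *)
Lemma mpoly_ring_ind (P : mp -> Prop) :
  (forall c, P (pC c)) -> (forall i, P (pX i)) ->
  (forall F G, P F -> P G -> P (F + G)) ->
  (forall F G, P F -> P G -> P (F * G)) -> forall F, P F.
Proof.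
move=> hC hX hD hM F; rewrite (mpoly.mpolyE F).
have h0 : P 0 by have := hC 0; rewrite /pC mpoly.mpolyC0.
have h1 : P 1 by exact: hC 1.
elim/big_ind: _ => // m _; rewrite -mpoly.mul_mpolyC; apply: (hM _ _ (hC _)).
rewrite mpoly.mpolyXE_id; elim/big_ind: _ => // i _.
by elim: (mpoly.fun_of_multinom m i) => [|k IH]; rewrite ?expr0 // exprS; apply: hM (hX i) IH.
Qed.

Section Evaluation.
Variables (S : comNzRingType) (f : {rmorphism K -> S}) (h : 'I_n -> S).

Lemma mmap_pX i : mpoly.mmap f h (pX i) = h i.
Proof. by rewrite /pX mpoly.mmapX mpoly.mmap1U. Qed.
Lemma mmap_pC c : mpoly.mmap f h (pC c) = f c.
Proof. exact: mpoly.mmapC. Qed.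
Lemma mmap_add F G : mpoly.mmap f h (F + G) = mpoly.mmap f h F + mpoly.mmap f h G.
Proof. exact: rmorphD. Qed.
Lemma mmap_mul F G : mpoly.mmap f h (F * G) = mpoly.mmap f h F * mpoly.mmap f h G.
Proof. exact: rmorphM. Qed.
End Evaluation.

Lemma meval_pX v i : mpoly.meval v (pX i) = v i.
Proof. exact: mpoly.mevalXU. Qed.
Lemma meval_pC v c : mpoly.meval v (pC c) = c.
Proof. exact: mpoly.mevalC. Qed.

Lemma mderiv_pX i k : mpoly.mderiv i (pX k) = pC (k == i)%:R.
Proof.
rewrite /pX mpoly.mderivX mpoly.mnm1E; case: eqP => [->|_]; last first.
  by rewrite scale0r /pC mpoly.mpolyC0.
rewrite scale1r; set u := mpoly.mnm1 i.
have -> : mpoly.mnm_sub u u = mpoly.mnm0 by apply/mpoly.mnmP => j; rewrite mpoly.mnmBE mpoly.mnm0E subnn.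
by rewrite mpoly.mpolyX0.
Qed.

(** The Taylor formula to second order, with polynomial remainder: one identity
    that can be evaluated both at points and at power series. *)
Lemma taylor2 F v : exists H : 'I_n -> 'I_n -> mp,
  F = pC (mpoly.meval v F)
    + \sum_i pC (mpoly.meval v (mpoly.mderiv i F)) * (pX i - pC (v i))
    + \sum_i \sum_j (pX i - pC (v i)) * (pX j - pC (v j)) * H i j.
Proof.
have pCD : {morph pC : x y / x + y} by move=> x y; exact: mpoly.mpolyCD.
have pCM : {morph pC : x y / x * y} by move=> x y; exact: mpoly.mpolyCM.
have pC0 : pC 0 = 0 by exact: mpoly.mpolyC0.
pose Q (H : 'I_n -> 'I_n -> mp) : mp := \sum_i \sum_j (pX i - pC (v i)) * (pX j - pC (v j)) * H i j.
have Q0 : Q (fun _ _ => 0) = 0.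
  by rewrite /Q big1 // => i _; rewrite big1 // => j _; rewrite mulr0.
have QD (H H' : 'I_n -> 'I_n -> mp) : Q H + Q H' = Q (fun i j => H i j + H' i j).
  rewrite -big_split; apply: eq_bigr => i _; rewrite -big_split.
  by apply: eq_bigr => j _ /=; apply/esym; exact: mulrDr.
have QM (H : 'I_n -> 'I_n -> mp) (A : mp) : Q H * A = Q (fun i j => H i j * A).
  rewrite big_distrl; apply: eq_bigr => i _; rewrite big_distrl.
  by apply: eq_bigr => j _ /=; rewrite mulrA.
elim/mpoly_ring_ind: F => [c|k|F G [H eF] [H' eG]|F G [H eF] [H' eG]].
- exists (fun _ _ => 0); rewrite -/(Q _) Q0 addr0 meval_pC.
  rewrite big1 ?addr0 // => i _.
  by rewrite /pC mpoly.mderivC mpoly.meval0 mpoly.mpolyC0 mul0r.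
- exists (fun _ _ => 0); rewrite -/(Q _) Q0 addr0 meval_pX.
  rewrite (bigD1 k) //= big1 => [|i /negbTE nik].
    by rewrite mderiv_pX eqxx meval_pC mul1r addr0 addrC subrK.
  by rewrite mderiv_pX eq_sym nik meval_pC pC0 mul0r.
- exists (fun i j => H i j + H' i j); rewrite -/(Q _) -QD.
  rewrite {1}eF {1}eG -/(Q H) -/(Q H') mpoly.mevalD pCD.
  under [\sum_i pC (mpoly.meval v (mpoly.mderiv i (F + G))) * _]eq_bigr => i _ do
    rewrite mpoly.mderivD mpoly.mevalD pCD mulrDl.
  by rewrite big_split /=; ring.
pose D (A : mp) := \sum_i pC (mpoly.meval v (mpoly.mderiv i A)) * (pX i - pC (v i)).
exists (fun i j => pC (mpoly.meval v (mpoly.mderiv i F)) * pC (mpoly.meval v (mpoly.mderiv j G))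
   + H i j * G + H' i j * (pC (mpoly.meval v F) + D F)).
rewrite -/(Q _) -(QD (fun i j => _ + _)) -QD -!QM.
have -> : Q (fun i j => pC (mpoly.meval v (mpoly.mderiv i F)) * pC (mpoly.meval v (mpoly.mderiv j G))) = D F * D G.
  rewrite /Q /D big_distrl; apply: eq_bigr => i _ /=; rewrite big_distrr.
  by apply: eq_bigr => j _ /=; ring.
have -> : \sum_i pC (mpoly.meval v (mpoly.mderiv i (F * G))) * (pX i - pC (v i)) =
    pC (mpoly.meval v F) * D G + D F * pC (mpoly.meval v G).
  rewrite /D big_distrl big_distrr -big_split; apply: eq_bigr => i _ /=.
  by rewrite mpoly.mderivM mpoly.mevalD !mpoly.mevalM pCD !pCM; ring.
rewrite mpoly.mevalM pCM; move: eF eG; rewrite -/(Q H) -/(Q H') -/(D F) -/(D G).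
move: (D F) (D G) (Q H) (Q H') => DF DG QF QG eF eG.
rewrite {1}eF mulrDl {1}eG; ring.
Qed.

Lemma taylor2_mmap (S : comNzRingType) (f : {rmorphism K -> S}) F v :
  exists H : 'I_n -> 'I_n -> mp, forall h : 'I_n -> S,
  mpoly.mmap f h F = f (mpoly.meval v F)
    + \sum_i f (mpoly.meval v (mpoly.mderiv i F)) * (h i - f (v i))
    + \sum_i \sum_j (h i - f (v i)) * (h j - f (v j)) * mpoly.mmap f h (H i j).
Proof.
have [H eF] := taylor2 F v; exists H => h; rewrite {1}eF !mmap_add mmap_pC.
congr (_ + _ + _); rewrite rmorph_sum; apply: eq_bigr => i _ /=.
  by rewrite mmap_mul rmorphB /= mmap_pX !mmap_pC.
rewrite rmorph_sum; apply: eq_bigr => j _ /=.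
by rewrite !mmap_mul !rmorphB /= !mmap_pX !mmap_pC.
Qed.

(** ** Homogeneous polynomials *)

Local Notation homog d := (mpoly.ishomog1 d mpoly.mdeg).

Lemma homog_mmap (S : comNzRingType) (f : {rmorphism K -> S}) d F (l : S) (h : 'I_n -> S) :
  F \is homog d -> mpoly.mmap f (fun i => l * h i) F = l ^+ d * mpoly.mmap f h F.
Proof.
move=> /mpoly.dhomogP hF; rewrite /mpoly.mmap big_distrr /=.
rewrite big_seq [RHS]big_seq; apply: eq_bigr => m /hF /= <-.
rewrite /mpoly.mmap1 mpoly.mdegE mulrCA; congr (_ * _).
rewrite (eq_bigr (fun i => l ^+ (mpoly.fun_of_multinom m i) * h i ^+ (mpoly.fun_of_multinom m i))).
  by rewrite big_split /= expr_sum.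
by move=> i _; rewrite exprMn.
Qed.

Lemma homog_meval d F (l : K) v :
  F \is homog d -> mpoly.meval (fun i => l * v i) F = l ^+ d * mpoly.meval v F.
Proof. exact: (@homog_mmap K idfun). Qed.

Lemma homog_mderiv d F i : F \is homog d -> mpoly.mderiv i F \is homog d.-1.
Proof.
move=> /mpoly.dhomogP hF; rewrite (mpoly.mpolyE F) raddf_sum /=.
rewrite big_seq; apply: rpred_sum => m /hF hm; rewrite mpoly.mderivZ.
apply: rpredZ; rewrite mpoly.mderivX.
have [->|mi] := eqVneq (mpoly.fun_of_multinom m i) 0%N; first by rewrite scale0r rpred0.
apply: rpredZ; rewrite mpoly.dhomogX /=; move: hm => /= <-.
have hm : mpoly.mnm_add (mpoly.mnm_sub m (mpoly.mnm1 i)) (mpoly.mnm1 i) = m.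
  apply/mpoly.mnmP => j; rewrite mpoly.mnmDE mpoly.mnmBE mpoly.mnm1E.
  by case: eqP => [<-|_]; rewrite ?subnK ?lt0n // subn0 addn0.
by rewrite -{2}hm mpoly.mdegD mpoly.mdeg1 addn1.
Qed.

Lemma homog_pC c : pC c \is homog 0.
Proof.
have := @mpoly.dhomogZ n K mpoly.mdeg 0%N c _ (@mpoly.dhomog1 n K mpoly.mdeg).
by rewrite -mpoly.mul_mpolyC mulr1.
Qed.
Lemma homog_pX i : pX i \is homog 1.
Proof. by rewrite mpoly.dhomogX /= mpoly.mdeg1. Qed.
Lemma homog_linear (c : 'I_n -> K) : \sum_i pC (c i) * pX i \is homog 1.
Proof.
apply: rpred_sum => i _.
exact: mpoly.dhomogM (homog_pC (c i)) (homog_pX i).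
Qed.

Lemma homogeneous_add_pad (l : mp) d e F G : l \is homog 1 ->
  F \is homog d -> G \is homog e -> l ^+ e * F + l ^+ d * G \is homog (d + e).
Proof.
move=> hl hF hG; apply: rpredD.
  by rewrite addnC; apply: mpoly.dhomogM => //; have := mpoly.dhomogMn e hl; rewrite mul1n.
by apply: mpoly.dhomogM => //; have := mpoly.dhomogMn d hl; rewrite mul1n.
Qed.
End MPoly.

(** * Polynomials in power series and near a point *)

Section PolyAnalysis.
Variables (R : realType) (n : nat).
Local Notation C := R[i].
Local Notation mp := (mpoly.mpoly n C).
Local Notation homog d := (mpoly.ishomog1 d mpoly.mdeg).
Implicit Types (F G : mp) (a b : 'I_n -> fps C) (v w : 'I_n -> C) (s e B : R).

(** The value of [F] at a vector of power series. It is locked because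
    unification must never unfold it. *)
Fact pl_key : unit. Proof. exact: tt. Qed.
Definition pl : ('I_n -> fps C) -> mp -> fps C :=
  locked_with pl_key (fun a F => mpoly.mmap (@fps_const C) a F).
Lemma plE a F : pl a F = mpoly.mmap (@fps_const C) a F.
Proof. by rewrite /pl unlock. Qed.

Lemma pl_pX a i : pl a (pX C i) = a i. Proof. by rewrite plE; exact: mmap_pX. Qed.
Lemma pl_pC a c : pl a (pC n c) = fps_const c. Proof. by rewrite plE; exact: mmap_pC. Qed.
Lemma plD a F G : pl a (F + G) = pl a F + pl a G.
Proof. by rewrite !plE; exact: mmap_add. Qed.
Lemma plM a F G : pl a (F * G) = pl a F * pl a G.
Proof. by rewrite !plE; exact: mmap_mul. Qed.

Lemma pl0 a : pl a 0 = 0.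
Proof. by have := pl_pC a 0; rewrite rmorph0 /pC mpoly.mpolyC0. Qed.
Lemma plB a F G : pl a (F - G) = pl a F - pl a G.
Proof. by apply/eqP; rewrite eq_sym subr_eq -plD subrK. Qed.
Lemma plX a F k : pl a (F ^+ k) = pl a F ^+ k.
Proof. by elim: k => [|k IH]; [exact: pl_pC 1 | rewrite !exprS plM IH]. Qed.

Fact mev_key : unit. Proof. exact: tt. Qed.
Definition mev : ('I_n -> C) -> mp -> C := locked_with mev_key (fun w F => mpoly.meval w F).
Lemma mevE w F : mev w F = mpoly.meval w F.
Proof. by rewrite /mev unlock. Qed.
Lemma mev_pX w i : mev w (pX C i) = w i. Proof. by rewrite mevE meval_pX. Qed.
Lemma mev_pC w c : mev w (pC n c) = c. Proof. by rewrite mevE meval_pC. Qed.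
Lemma mevD w F G : mev w (F + G) = mev w F + mev w G.
Proof. by rewrite !mevE mpoly.mevalD. Qed.
Lemma mevM w F G : mev w (F * G) = mev w F * mev w G.
Proof. by rewrite !mevE mpoly.mevalM. Qed.
Lemma mev0 w : mev w 0 = 0. Proof. by rewrite mevE mpoly.meval0. Qed.
Lemma mevB w F G : mev w (F - G) = mev w F - mev w G.
Proof. by rewrite !mevE mpoly.mevalB. Qed.
Lemma mevX w F k : mev w (F ^+ k) = mev w F ^+ k.
Proof. by elim: k => [|k IH]; [exact: mev_pC 1 | rewrite !exprS mevM IH]. Qed.
Lemma mev_sum w I (r : seq I) (P : pred I) (F : I -> mp) :
  mev w (\sum_(i <- r | P i) F i) = \sum_(i <- r | P i) mev w (F i).
Proof. by apply: (big_morph (mev w)) => [? ?|]; rewrite ?mevD ?mev0. Qed.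

Lemma pl_acv s a F : 0 <= s -> (forall i, acv s (a i)) -> acv s (pl a F).
Proof.
move=> s0 ha; elim/mpoly_ring_ind: F => [c|i|F G hF hG|F G hF hG].
- by rewrite pl_pC; apply: acv_const.
- by rewrite pl_pX.
- by rewrite plD; apply: acvD.
- by rewrite plM; apply: acvM.
Qed.

Lemma pl_ev s t a F : 0 <= s -> cn t <= s -> (forall i, acv s (a i)) ->
  ev (pl a F) t = mev (fun i => ev (a i) t) F.
Proof.
move=> s0 ts ha; elim/mpoly_ring_ind: F => [c|i|F G hF hG|F G hF hG].
- by rewrite pl_pC ev_const mev_pC.
- by rewrite pl_pX mev_pX.
- by rewrite plD mevD (evD s0 ts (pl_acv _ s0 ha) (pl_acv _ s0 ha)) hF hG.
- by rewrite plM mevM (evM s0 ts (pl_acv _ s0 ha) (pl_acv _ s0 ha)) hF hG.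
Qed.

Lemma pl_coef0 a F : coef (pl a F) 0 = mev (fun i => coef (a i) 0) F.
Proof.
elim/mpoly_ring_ind: F => [c|i|F G hF hG|F G hF hG].
- by rewrite pl_pC mev_pC.
- by rewrite pl_pX mev_pX.
- by rewrite plD mevD fcoefD hF hG.
- by rewrite plM mevM fcoefM0 hF hG.
Qed.

(** The chain rule, at the level of linear terms. *)
Lemma pl_coef1 a F : coef (pl a F) 1 =
  \sum_i mev (fun j => coef (a j) 0) (mpoly.mderiv i F) * coef (a i) 1.
Proof.
elim/mpoly_ring_ind: F => [c|i|F G hF hG|F G hF hG].
- rewrite pl_pC /= big1 // => i _.
  by rewrite /pC mpoly.mderivC mev0 mul0r.
- rewrite pl_pX (bigD1 i) //= big1 => [|j /negbTE nji]; rewrite mderiv_pX mev_pC.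
    by rewrite eqxx mul1r addr0.
  by rewrite eq_sym nji mul0r.
- rewrite plD fcoefD hF hG -big_split; apply: eq_bigr => i _ /=.
  by rewrite mpoly.mderivD mevD mulrDl.
- rewrite plM fcoefM1 !pl_coef0 hF hG.
  rewrite [X in X + _]mulr_sumr [X in _ + X]mulr_suml -big_split.
  apply: eq_bigr => i _ /=.
  by rewrite mpoly.mderivM mevD !mevM; ring.
Qed.

Lemma pl_comp a (b : fps C) F : coef b 0 = 0 :> C ->
  fps_comp (pl a F) b = pl (fun i => fps_comp (a i) b) F.
Proof.
move=> b0; elim/mpoly_ring_ind: F => [c|i|F G hF hG|F G hF hG].
- by rewrite !pl_pC fps_comp_const.
- by rewrite !pl_pX.
- by rewrite !plD fps_compD hF hG.
- by rewrite !plM fps_compM // hF hG.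
Qed.

Lemma pl_homog d F (l : fps C) a : F \is homog d ->
  pl (fun i => l * a i) F = l ^+ d * pl a F.
Proof. by move=> hF; rewrite !plE; exact: homog_mmap. Qed.

Lemma pl_const v F : pl (fun i => fps_const (v i)) F = fps_const (mev v F).
Proof.
elim/mpoly_ring_ind: F => [c|i|F G hF hG|F G hF hG].
- by rewrite pl_pC mev_pC.
- by rewrite pl_pX mev_pX.
- by rewrite plD hF hG mevD rmorphD.
- by rewrite plM hF hG mevM rmorphM.
Qed.

(** Euler's identity, read off the linear term of [F ((1 + X) v)]. *)
Lemma euler d F v : F \is homog d -> mev v F = 0 ->
  \sum_i mev v (mpoly.mderiv i F) * v i = 0.
Proof.
move=> hF Fv; pose a i : fps C := (1 + fpsX C) * fps_const (v i).
have c0 i : coef (a i) 0 = v i by rewrite fcoefM0 /= addr0 mul1r.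
have c1 i : coef (a i) 1 = v i.
  by rewrite /a mulrC coef_constM fcoefD /= add0r mulr1.
have := pl_coef1 a F; rewrite (pl_homog _ _ hF) pl_const Fv rmorph0 mulr0 fcoef0.
move=> /esym; under eq_bigr => i _ do rewrite c1.
by have -> : (fun j => coef (a j) 0) = v by apply/funext.
Qed.

Lemma pl_bound F B : exists M, forall s N a, 0 <= s ->
  (forall i, pn s (a i) N <= B) -> pn s (pl a F) N <= M.
Proof.
elim/mpoly_ring_ind: F => [c|i|F G [M hM] [M' hM']|F G [M hM] [M' hM']].
- by exists (cn c) => s N a s0 _; rewrite pl_pC pn_const.
- by exists B => s N a s0 h; rewrite pl_pX.
- exists (M + M') => s N a s0 h; rewrite plD; apply: le_trans (pnD _ _ _ s0) _.
  by apply: lerD; [apply: hM | apply: hM'].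
- exists (M * M') => s N a s0 h; rewrite plM; apply: le_trans (pnM _ _ _ s0) _.
  by apply: ler_pM; rewrite ?pn_ge0 ?hM ?hM'.
Qed.

Definition vn w : R := \sum_i cn (w i).
Lemma vn_ge0 w : 0 <= vn w. Proof. by apply: sumr_ge0 => i _; exact: cn_ge0. Qed.
Lemma cn_le_vn w i : cn (w i) <= vn w.
Proof. by rewrite /vn (bigD1 i) //= lerDl sumr_ge0 // => j _; exact: cn_ge0. Qed.
Lemma vn_eq0 w : vn w <= 0 -> forall i, w i = 0.
Proof.
move=> h i; apply/eqP; rewrite -cn_eq0 eq_le cn_ge0 andbT.
exact: le_trans (cn_le_vn w i) h.
Qed.

(** The bound and the Lipschitz estimate are proved together because the product
    rule for the second needs the first. *)
Lemma poly_lipschitz F B : exists L, [/\ 0 <= L,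
  forall w, (forall i, cn (w i) <= B) -> cn (mev w F) <= L &
  forall w w', (forall i, cn (w i) <= B) -> (forall i, cn (w' i) <= B) ->
    cn (mev w F - mev w' F) <= L * vn (fun i => w i - w' i)].
Proof.
elim/mpoly_ring_ind: F => [c|i|F G [L [L0 hL1 hL2]] [M [M0 hM1 hM2]]|F G [L [L0 hL1 hL2]] [M [M0 hM1 hM2]]].
- exists (cn c); split=> [|w _|w w' _ _]; rewrite ?cn_ge0 ?mev_pC //.
  by rewrite subrr cn0 mulr_ge0 ?cn_ge0 ?vn_ge0.
- exists (Num.max B 1); split=> [|w h|w w' _ _]; rewrite ?mev_pX.
  + by rewrite le_max ler01 orbT.
  + by rewrite le_max h.
  + apply: le_trans (cn_le_vn (fun i => w i - w' i) i) _.
    by rewrite ler_peMl ?vn_ge0 // le_max lexx orbT.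
- exists (L + M); split=> [|w h|w w' h h']; rewrite ?addr_ge0 ?mevD //.
    by apply: le_trans (cnD _ _) _; apply: lerD; [apply: hL1|apply: hM1].
  rewrite opprD addrACA mulrDl; apply: le_trans (cnD _ _) _.
  by apply: lerD; [apply: hL2|apply: hM2].
- exists (L * M + L * M); split=> [|w h|w w' h h']; rewrite ?addr_ge0 ?mulr_ge0 ?mevM //.
    rewrite cnM; apply: (@le_trans _ _ (L * M)); last by rewrite lerDl mulr_ge0.
    by apply: ler_pM; rewrite ?cn_ge0 ?hL1 ?hM1.
  set f := mev w F; set g := mev w G.
  set f' := mev w' F; set g' := mev w' G.
  have -> : f * g - f' * g' = f * (g - g') + (f - f') * g' by ring.
  apply: le_trans (cnD _ _) _; rewrite !cnM mulrDl -mulrA; apply: lerD.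
    by apply: ler_pM; rewrite ?cn_ge0 ?hL1 ?hM2.
  by rewrite (mulrC M) mulrA; apply: ler_pM; rewrite ?cn_ge0 ?hL2 ?hM1.
Qed.

(** Strict differentiability: both points may move, which is what the
    injectivity half of the inverse function theorem needs. *)
Lemma poly_strict_diff F v e : 0 < e -> exists2 eta, 0 < eta & forall w w',
  (forall i, cn (w i - v i) <= eta) -> (forall i, cn (w' i - v i) <= eta) ->
  cn (mev w F - mev w' F
      - \sum_i mev v (mpoly.mderiv i F) * (w i - w' i))
    <= e * vn (fun i => w i - w' i).
Proof.
elim/mpoly_ring_ind: F e => [c|k|F G IHF IHG|F G IHF IHG] e e0.
- exists 1 => // w w' _ _; rewrite !mev_pC subrr sub0r cnN big1.
    by rewrite cn0 mulr_ge0 ?vn_ge0 // ltW.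
  by move=> i _; rewrite /pC mpoly.mderivC mev0 mul0r.
- exists 1 => // w w' _ _; rewrite !mev_pX (bigD1 k) //= big1.
    by rewrite mderiv_pX mev_pC eqxx mul1r addr0 subrr cn0 mulr_ge0 ?vn_ge0 // ltW.
  by move=> i /negbTE nik; rewrite mderiv_pX mev_pC eq_sym nik mul0r.
- have e2 : 0 < e / 2 by lra.
  have [d d0 hd] := IHF _ e2; have [d' d'0 hd'] := IHG _ e2.
  exists (Num.min d d'); first by rewrite lt_min d0.
  move=> w w' hw hw'.
  have hF := hd w w' (fun i => le_trans (hw i) (_ : _ <= d)) (fun i => le_trans (hw' i) (_ : _ <= d)).
  have hG := hd' w w' (fun i => le_trans (hw i) (_ : _ <= d')) (fun i => le_trans (hw' i) (_ : _ <= d')).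
  rewrite !ge_min !lexx ?orbT in hF hG; move: {hF hG} (hF isT isT) (hG isT isT).
  set A := \sum_i _; set A' := \sum_i _.
  have -> : \sum_i mev v (mpoly.mderiv i (F + G)) * (w i - w' i) = A + A'.
    rewrite -big_split; apply: eq_bigr => i _ /=.
    by rewrite mpoly.mderivD mevD mulrDl.
  rewrite !mevD.
  set x := mev w F - _ - A; set y := mev w G - _ - A' => hx hy.
  have -> : mev w F + mev w G - (mev w' F + mev w' G) - (A + A') = x + y.
    by rewrite /x /y; ring.
  move: x y hx hy => x y hx hy; have := cnD x y; lra.
- have [L [L0 L1 L2]] := poly_lipschitz F (vn v + 1).
  have [M [M0 M1 M2]] := poly_lipschitz G (vn v + 1).
  pose N := \sum_i cn (mev v (mpoly.mderiv i G)).
  pose N' := \sum_i cn (mev v (mpoly.mderiv i F)).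
  have N0 : 0 <= N by apply: sumr_ge0 => i _; exact: cn_ge0.
  have N'0 : 0 <= N' by apply: sumr_ge0 => i _; exact: cn_ge0.
  have nR0 : 0 <= n%:R :> R by [].
  pose k := 1 + L + M + L * n%:R * N + M * n%:R * N'.
  have LN0 : 0 <= L * n%:R * N by rewrite !mulr_ge0.
  have MN0 : 0 <= M * n%:R * N' by rewrite !mulr_ge0.
  have k0 : 0 < k by rewrite /k; lra.
  have ek : 0 < e / k by rewrite divr_gt0.
  have [d d0 hd] := IHF _ ek; have [d' d'0 hd'] := IHG _ ek.
  pose eta := Num.min (Num.min d d') (Num.min 1 (e / k)).
  have [ed ed' e1 eek] : [/\ eta <= d, eta <= d', eta <= 1 & eta <= e / k].
    by split; rewrite /eta !ge_min lexx ?orbT.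
  exists eta; first by rewrite /eta !lt_min d0 d'0 ltr01 ek.
  move=> w w' hw hw'.
  have near_bd u : (forall i, cn (u i - v i) <= eta) -> forall i, cn (u i) <= vn v + 1.
    move=> hu i; have := cn_triangle (v i) (u i) 0; rewrite !subr0.
    by have := cn_le_vn v i; have := hu i; lra.
  have vn_near u : (forall i, cn (u i - v i) <= eta) -> vn (fun i => u i - v i) <= eta * n%:R.
    move=> hu; apply: le_trans (_ : \sum_(i < n) eta <= _); first exact: ler_sum.
    by rewrite sumr_const card_ord mulr_natr.
  have bv i : cn (v i) <= vn v + 1 by have := cn_le_vn v i; lra.
  have hF := hd w w' (fun i => le_trans (hw i) ed) (fun i => le_trans (hw' i) ed).
  have hG := hd' w w' (fun i => le_trans (hw i) ed') (fun i => le_trans (hw' i) ed').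
  have F1 := L1 _ (near_bd _ hw); have G1 := M1 _ (near_bd _ hw').
  have F2 := L2 _ _ (near_bd _ hw) bv; have G2 := M2 _ _ (near_bd _ hw') bv.
  set A := \sum_i _ in hF; set A' := \sum_i _ in hG.
  have -> : \sum_i mev v (mpoly.mderiv i (F * G)) * (w i - w' i) =
      mev v F * A' + A * mev v G.
    rewrite /A /A' mulr_suml mulr_sumr -big_split; apply: eq_bigr => i _ /=.
    by rewrite mpoly.mderivM mevD !mevM; ring.
  pose V := vn (fun i => w i - w' i); rewrite -/V in hF hG *.
  have V0 : 0 <= V by exact: vn_ge0.
  have lin (D : 'I_n -> C) : cn (\sum_i D i * (w i - w' i)) <= (\sum_i cn (D i)) * V.
    apply: le_trans (cn_sum _ _ _) _; rewrite mulr_suml; apply: ler_sum => i _.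
    by rewrite cnM; apply: ler_wpM2l; rewrite ?cn_ge0 //; apply: (cn_le_vn (fun i => w i - w' i)).
  have hA : cn A <= N' * V by exact: lin.
  have hA' : cn A' <= N * V by exact: lin.
  have {}F2 : cn (mev w F - mev v F) <= L * (eta * n%:R).
    by apply: le_trans F2 _; apply: ler_wpM2l => //; exact: vn_near.
  have {}G2 : cn (mev w' G - mev v G) <= M * (eta * n%:R).
    by apply: le_trans G2 _; apply: ler_wpM2l => //; exact: vn_near.
  rewrite !mevM.
  move: (mev w F) (mev w' F) (mev w G) (mev w' G) (mev v F) (mev v G) hF hG F1 G1 F2 G2.
  move: A A' hA hA' => A A' hA hA' f f' g g' f0 g0 hF hG F1 G1 F2 G2.
  have -> : f * g - f' * g' - (f0 * A' + A * g0) =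
    f * (g - g' - A') + (f - f0) * A' + ((f - f' - A) * g' + A * (g' - g0)) by ring.
  apply: le_trans (cnD _ _) _; apply: le_trans (lerD (cnD _ _) (cnD _ _)) _.
  rewrite !cnM.
  have ekk : e = e / k * k by rewrite divfK // gt_eqF.
  have T1 : cn f * cn (g - g' - A') <= L * (e / k * V) by apply: ler_pM; rewrite ?cn_ge0.
  have T3 : cn (f - f' - A) * cn g' <= (e / k * V) * M by apply: ler_pM; rewrite ?cn_ge0.
  have T2 : cn (f - f0) * cn A' <= (L * (e / k * n%:R)) * (N * V).
    apply: ler_pM; rewrite ?cn_ge0 //; apply: le_trans F2 _.
    by apply: ler_wpM2l => //; apply: ler_wpM2r.
  have T4 : cn A * cn (g' - g0) <= (N' * V) * (M * (e / k * n%:R)).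
    apply: ler_pM; rewrite ?cn_ge0 //; apply: le_trans G2 _.
    by apply: ler_wpM2l => //; apply: ler_wpM2r.
  apply: (@le_trans _ _ (e / k * (k - 1) * V)).
    by rewrite /k; lra.
  have : 0 <= e / k * V by rewrite mulr_ge0 // ltW.
  by move: ekk; set q := e / k => ->; lra.
Qed.

Lemma poly_cont F v e : 0 < e -> exists2 eta, 0 < eta & forall w,
  (forall i, cn (w i - v i) <= eta) -> cn (mev w F - mev v F) < e.
Proof.
move=> e0; have [L [L0 _ hL]] := poly_lipschitz F (vn v + 1).
have nR0 : 0 <= n%:R :> R by [].
have k0 : 0 < L * n%:R + 1 by have : 0 <= L * n%:R by [rewrite mulr_ge0]; lra.
exists (Num.min 1 (e / (L * n%:R + 1) / 2)).
  by rewrite lt_min ltr01 !divr_gt0.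
move=> w hw; have h1 i : cn (w i - v i) <= 1.
  by apply: le_trans (hw i) _; rewrite ge_min lexx.
have h2 i : cn (w i - v i) <= e / (L * n%:R + 1) / 2.
  by apply: le_trans (hw i) _; rewrite ge_min lexx orbT.
apply: le_lt_trans (hL w v _ _) _.
- move=> i; have := cn_triangle (v i) (w i) 0; rewrite !subr0.
  by have := cn_le_vn v i; have := h1 i; lra.
- by move=> i; have := cn_le_vn v i; lra.
have : vn (fun i => w i - v i) <= e / (L * n%:R + 1) / 2 * n%:R.
  apply: le_trans (_ : \sum_(i < n) e / (L * n%:R + 1) / 2 <= _); first exact: ler_sum.
  by rewrite sumr_const card_ord -[_ *+ n]mulr_natr.
move=> /(ler_wpM2l L0) /le_lt_trans; apply.
have -> : L * (e / (L * n%:R + 1) / 2 * n%:R) = e / (L * n%:R + 1) * (L * n%:R) / 2 by ring.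
rewrite ltr_pdivrMr // -mulrAC ltr_pdivrMr //.
have : 0 <= L * n%:R by rewrite mulr_ge0.
nra.
Qed.

Lemma mev_homog d F (l : C) v : F \is homog d ->
  mev (fun i => l * v i) F = l ^+ d * mev v F.
Proof. by move=> hF; rewrite !mevE; exact: homog_meval. Qed.

(** A polynomial function on the affine part [l = 1] of the cone is the
    restriction of a form, so that its zeros can be used as a closed set. *)
Lemma homogenize F (l : mp) : l \is homog 1 -> exists d G, G \is homog d /\
  forall w, mev w l != 0 -> mev w G = mev w l ^+ d * mev (fun i => w i / mev w l) F.
Proof.
move=> hl; elim/mpoly_ring_ind: F => [c|i|F G [d [F' [hF eF]]] [e [G' [hG eG]]]|
    F G [d [F' [hF eF]]] [e [G' [hG eG]]]].
- exists 0%N, (pC n c); split; first exact: homog_pC.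
  by move=> w _; rewrite !mev_pC mul1r.
- exists 1%N, (pX C i); split; first exact: homog_pX.
  by move=> w w0; rewrite !mev_pX expr1 mulrC divfK.
- exists (d + e)%N, (l ^+ e * F' + l ^+ d * G'); split; first exact: homogeneous_add_pad.
  by move=> w w0; rewrite !mevD !mevM !mevX eF // eG // exprD; ring.
- exists (d + e)%N, (F' * G'); split; first exact: mpoly.dhomogM.
  by move=> w w0; rewrite !mevM eF // eG // exprD; ring.
Qed.
End PolyAnalysis.

(** * Fixed points, inverse functions and reversion of power series *)

Lemma sub_sub_opp (V : zmodType) (x y z : V) : x - y - (x - z) = - (y - z).
Proof. by rewrite !opprB addrC addrA subrK addrC. Qed.

Section FixedPoint.
Variable R : realType.
Local Notation C := R[i].

(** The majorant of a composite is at most the composite of the majorants. *)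
Lemma pn_comp (s B : R) (f g : fps C) N : 0 <= s -> pn s g N <= B ->
  pn s (fps_comp f g) N <= pn B f N.
Proof.
move=> s0; case: N => [|N] hB; first by rewrite !pnE !big_ord0.
apply: (@le_trans _ _ (\sum_(k < N.+1) cn (coef f k) * pn s (g ^+ k) N.+1)).
  rewrite pnE; under [leRHS]eq_bigr => k _ do rewrite pnE mulr_sumr.
  rewrite exchange_big /=; apply: ler_sum => m _.
  apply: (@le_trans _ _ ((\sum_(k < m.+1) cn (coef f k) * cn (coef (g ^+ k) m)) * s ^+ m)).
    rewrite ler_wpM2r ?exprn_ge0 //; apply: le_trans (cn_sum _ _ _) _.
    by apply: ler_sum => k _; rewrite cnM.
  rewrite mulr_suml (big_ord_widen N.+1 (fun k => cn (coef f k) * cn (coef (g ^+ k) m) * s ^+ m)) //.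
  rewrite big_mkcond; apply: ler_sum => k _; rewrite mulrA; case: ifP => // _.
  by rewrite !mulr_ge0 ?cn_ge0 ?exprn_ge0.
apply: ler_sum => k _; rewrite ler_wpM2l ?cn_ge0 //.
apply: le_trans (pn_exp _ _ s0 _) _ => //.
by rewrite lerXn2r // ?nnegrE ?pn_ge0 // (le_trans _ hB) // pn_ge0.
Qed.

Lemma acv_comp (s B : R) (f g : fps C) : 0 <= s -> (forall m, pn s g m <= B) ->
  acv B f -> acv s (fps_comp f g).
Proof.
by move=> s0 hB [M hM]; exists M => N; apply: le_trans (pn_comp _ s0 (hB N)) (hM N).
Qed.

(** An operator on vectors of power series that improves agreement by one order
    and is quadratically small has a convergent fixed point: the iterates from
    [0] stabilize coefficientwise inside a fixed ball. *)
Lemma fps_fixpoint (I : Type) (T : (I -> fps C) -> I -> fps C) (K y0 : R) :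
  0 <= K -> 0 < y0 ->
  (forall a, (forall i, ord_ge 1 (a i)) -> forall i, ord_ge 1 (T a i)) ->
  (forall k a b, (forall i, ord_ge 1 (a i)) -> (forall i, ord_ge 1 (b i)) ->
     (forall i, ord_ge k (a i - b i)) -> forall i, ord_ge k.+1 (T a i - T b i)) ->
  (forall s N a y, 0 <= s -> s <= 1 -> y <= y0 -> (forall i, pn s (a i) N <= y) ->
     forall i, pn s (T a i) N <= K * (s + y ^+ 2)) ->
  exists (d : I -> fps C) (s : R), [/\ 0 < s, s <= y0, forall i, T d i = d i,
    forall i, ord_ge 1 (d i) & forall i N, pn s (d i) N <= y0].
Proof.
move=> K0 y00 T1 Tord Tn.
pose D := fix D k := if k is k'.+1 then T (D k') else fun _ : I => 0.
have D1 k i : ord_ge 1 (D k i).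
  by elim: k i => [|k IH] i; [exact: ord_ge_zero | exact: T1].
have Dstep k i : ord_ge k (D k.+1 i - D k i).
  elim: k i => [|k IH] i; first exact: ord_ge0.
  exact: (Tord _ _ _ (D1 k.+1) (D1 k) IH).
have Dlim k j i : ord_ge k (D (j + k)%N i - D k i).
  elim: j => [|j IH]; first by rewrite subrr; exact: ord_ge_zero.
  have -> : D (j.+1 + k)%N i - D k i = (D (j + k).+1 i - D (j + k)%N i) + (D (j + k)%N i - D k i).
    by rewrite addrA subrK.
  by apply: ord_geD IH; apply: ord_geW (Dstep _ _); rewrite leq_addl.
pose d i := FPS (fun k => coef (D k.+1 i) k).
have dD k i : ord_ge k (d i - D k i).
  move=> m lt_mk; apply/eqP; rewrite fcoefB subr_eq0 eq_sym; apply/eqP.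
  have := Dlim m.+1 (k - m.+1)%N i; rewrite subnK // => h.
  exact: (ord_geB_coef h (ltnSn m)).
have d1 i : ord_ge 1 (d i).
  have -> : d i = (d i - D 1%N i) + D 1%N i by rewrite subrK.
  by apply: ord_geD; [exact: dD | exact: D1].
(* this radius makes the ball of size [2 K s <= y0] stable under [T] *)
pose s := Num.min y0 (Num.min 1 (Num.min (y0 / (2 * K + 1)) (1 / (4 * K ^+ 2 + 1)))).
have kp : 0 < 2 * K + 1 by lra.
have kp' : 0 < 4 * K ^+ 2 + 1 by have := sqr_ge0 K; lra.
have s0 : 0 < s by rewrite !lt_min y00 ltr01 !divr_gt0.
have [sy s1 sK sK2] : [/\ s <= y0, s <= 1, s * (2 * K + 1) <= y0 & s * (4 * K ^+ 2 + 1) <= 1].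
  by rewrite -!ler_pdivlMr //; split; rewrite /s !ge_min lexx ?orbT.
have sn : 0 <= s by exact: ltW.
have hy : 2 * K * s <= y0 by lra.
have Dn k i N : pn s (D k i) N <= 2 * K * s.
  elim: k i => [|k IH] i; first by rewrite pn0 !mulr_ge0.
  apply: le_trans (Tn s N (D k) (2 * K * s) sn s1 hy IH i) _.
  have : 0 <= K * s by rewrite mulr_ge0.
  have -> : K * (s + (2 * K * s) ^+ 2) = (K * s) * (1 + s * (4 * K ^+ 2)) by ring.
  have -> : 2 * K * s = K * s * 2 by ring.
  by move=> h; apply: ler_wpM2l => //; lra.
exists d, s; split=> // i.
  apply/eqP; rewrite -subr_eq0; apply/eqP/ord_ge_eq0 => k.
  have -> : T d i - d i = (T d i - D k.+1 i) - (d i - D k.+1 i) by rewrite opprB addrA subrK.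
  apply: ord_geD.
    by apply: (@ord_geW _ _ k.+1) => //; apply: (Tord _ _ _ d1 (D1 k) (dD k)).
  by apply: ord_geN; apply: ord_geW (dD _ _).
move=> N; apply: le_trans hy; apply: le_trans (Dn N i N).
rewrite !pnE; apply: ler_sum => m _; rewrite (ord_geB_coef (dD N i)) //.
Qed.
End FixedPoint.

Lemma add_le_mul_add (R : realDomainType) (x y c m s z : R) :
  x <= c * s -> y <= m * z -> 0 <= c -> 0 <= m -> 0 <= s -> 0 <= z ->
  x + y <= (c + m) * (s + z).
Proof. by move=> hx hy c0 m0 s0 z0; nra. Qed.

Section InverseFunction.
Variables (R : realType) (n : nat).
Local Notation C := R[i].
Local Notation mp := (mpoly.mpoly n C).
Variables (Phi : 'I_n -> mp) (v : 'I_n -> C).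
Let J : 'M[C]_n := \matrix_(i, j) mev v (mpoly.mderiv i (Phi j)).
Hypothesis Junit : J \in unitmx.

Lemma sum_invmx (x : 'I_n -> C) i :
  \sum_j (\sum_k x k * J k j) * invmx J j i = x i.
Proof.
have /matrixP /(_ 0 i) := mulmxKV Junit (\row_k x k).
have /matrixP /(_ 0 i) := mulmxK Junit (\row_k x k).
rewrite !mxE => <- _; apply: eq_bigr => j _; rewrite !mxE; congr (_ * _).
by apply: eq_bigr => k _; rewrite !mxE.
Qed.

(** Analytic inverse function theorem along a line in the target.  The displacement
    [d = a - v] is the fixed point of [d |-> J^-1 (r X - Q(d))], where [Q]
    collects the terms of order at least 2 of the Taylor expansion at [v]. *)
Lemma inverse_function (r : 'I_n -> C) : exists (a : 'I_n -> fps C) (s : R), [/\ 0 < s,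
  forall i, acv s (a i), forall i, coef (a i) 0 = v i &
  forall j, pl a (Phi j) = fps_const (mev v (Phi j)) + fps_const (r j) * fpsX C].
Proof.
have /choice [H hH] : forall j, exists H : 'I_n -> 'I_n -> mp, forall h : 'I_n -> fps C,
    pl h (Phi j) = fps_const (mev v (Phi j))
    + \sum_i fps_const (mev v (mpoly.mderiv i (Phi j))) * (h i - fps_const (v i))
    + \sum_i \sum_k (h i - fps_const (v i)) * (h k - fps_const (v k)) * pl h (H i k).
  move=> j; have [H hH] := taylor2_mmap (@fps_const C) (Phi j) v.
  exists H => h; rewrite plE hH mevE; congr (_ + _ + _).
    by apply: eq_bigr => i _; rewrite mevE.
  by apply: eq_bigr => i _; apply: eq_bigr => k _; rewrite plE.
pose vd (d : 'I_n -> fps C) i := fps_const (v i) + d i.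
pose Q j d : fps C := \sum_i \sum_k d i * d k * pl (vd d) (H j i k).
pose T d i : fps C := \sum_j (fps_const (r j) * fpsX C - Q j d) * fps_const (invmx J j i).
have Q2 j d : (forall i, ord_ge 1 (d i)) -> ord_ge 2 (Q j d).
  move=> d1; apply: ord_ge_sum => i _; apply: ord_ge_sum => k _.
  by rewrite -[2%N]addn0; apply: ord_geM => //; apply: (@ord_geM _ 1 1).
have T1 d : (forall i, ord_ge 1 (d i)) -> forall i, ord_ge 1 (T d i).
  move=> d1 i; apply: ord_ge_sum => j _; rewrite mulrC; apply: ord_geMl.
  apply: ord_geD; first by apply: ord_geMl => -[].
  by apply: ord_geN; apply: ord_geW (Q2 _ _ d1).
have plB_ord k a b F : (forall i, ord_ge k (a i - b i)) -> ord_ge k (pl a F - pl b F).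
  move=> hab; elim/mpoly_ring_ind: F => [c|i|F G hF hG|F G hF hG].
  - by rewrite !pl_pC subrr; exact: ord_ge_zero.
  - by rewrite !pl_pX.
  - by rewrite !plD opprD addrACA; apply: ord_geD.
  - rewrite !plM; have -> : pl a F * pl a G - pl b F * pl b G =
      pl a F * (pl a G - pl b G) + pl b G * (pl a F - pl b F) by ring.
    by apply: ord_geD; apply: ord_geMl.
have Tord k a b : (forall i, ord_ge 1 (a i)) -> (forall i, ord_ge 1 (b i)) ->
     (forall i, ord_ge k (a i - b i)) -> forall i, ord_ge k.+1 (T a i - T b i).
  move=> a1 b1 hab i; rewrite -sumrB; apply: ord_ge_sum => j _.
  rewrite -mulrBl mulrC; apply: ord_geMl.
  rewrite sub_sub_opp; apply: ord_geN; rewrite -sumrB; apply: ord_ge_sum => p _; rewrite -sumrB.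
  apply: ord_ge_sum => q _.
  set h := pl (vd a) _; set h' := pl (vd b) _.
  have -> : a p * a q * h - b p * b q * h' =
    a q * (a p - b p) * h + b p * (a q - b q) * h + (b p * (h - h')) * b q by ring.
  have hh : ord_ge k (h - h').
    apply: plB_ord => m; have -> : vd a m - vd b m = a m - b m by rewrite /vd; ring.
    exact: hab.
  rewrite -add1n; apply: ord_geD; first apply: ord_geD.
  - by rewrite -[(1 + k)%N]addn0; apply: ord_geM => //; apply: ord_geM.
  - by rewrite -[(1 + k)%N]addn0; apply: ord_geM => //; apply: ord_geM.
  - by rewrite -[(1 + k)%N]addn0; apply: ord_geM => //; apply: ord_geM.
have /choice [M hM] : forall p : 'I_n * 'I_n * 'I_n, exists M, forall s N a, 0 <= s ->
    (forall i, pn s (a i) N <= vn v + 1) -> pn s (pl a (H p.1.1 p.1.2 p.2)) N <= M.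
  by move=> p; exact: pl_bound.
have M0 p : 0 <= M p.
  have a0 : forall i : 'I_n, pn 0 (0 : fps C) 0 <= vn v + 1.
    by move=> _; rewrite pn0 addr_ge0 ?vn_ge0.
  by apply: le_trans (hM p 0 0%N (fun=> 0) (lexx _) a0); exact: pn_ge0.
pose K := \sum_i \sum_j (cn (r j) + \sum_p \sum_q M (j, p, q)) * cn (invmx J j i).
have Kt0 i j : 0 <= (cn (r j) + \sum_p \sum_q M (j, p, q)) * cn (invmx J j i).
  rewrite mulr_ge0 ?cn_ge0 // addr_ge0 ?cn_ge0 //.
  by apply: sumr_ge0 => p _; apply: sumr_ge0 => q _; exact: M0.
have K0 : 0 <= K by apply: sumr_ge0 => i _; apply: sumr_ge0 => j _; exact: Kt0.
have Tn s N a y : 0 <= s -> s <= 1 -> y <= 1 -> (forall i, pn s (a i) N <= y) ->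
     forall i, pn s (T a i) N <= K * (s + y ^+ 2).
  move=> s0 s1 y1 ha i.
  have pn_sum (I : finType) (F : I -> fps C) (B : I -> R) :
      (forall i, pn s (F i) N <= B i) -> pn s (\sum_i F i) N <= \sum_i B i.
    move=> h; elim/big_rec2: _ => [|j x z _ le_xz]; first by rewrite pn0.
    by apply: le_trans (pnD _ _ _ s0) _; apply: lerD.
  apply: (@le_trans _ _ (\sum_j ((cn (r j) + \sum_p \sum_q M (j, p, q)) * cn (invmx J j i)) * (s + y ^+ 2))).
    apply: (@pn_sum _) => j; rewrite mulrC pn_constM mulrC mulrAC ler_wpM2r ?cn_ge0 //.
    have y20 : 0 <= y ^+ 2 by exact: sqr_ge0.
    have MM0 : 0 <= \sum_p \sum_q M (j, p, q) by apply: sumr_ge0 => p _; apply: sumr_ge0 => q _; exact: M0.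
    apply: le_trans (pnB _ _ _ s0) _; apply: add_le_mul_add => //; last exact: cn_ge0.
      by rewrite pn_constM ler_wpM2l ?cn_ge0 // pnX.
    rewrite mulr_suml; apply: (@pn_sum _) => p; rewrite mulr_suml; apply: (@pn_sum _) => q.
    apply: le_trans (pnM _ _ _ s0) _; rewrite mulrC; apply: ler_pM; rewrite ?pn_ge0 //.
      apply: (hM (j, p, q)) => // k; apply: le_trans (pnD _ _ _ s0) _.
      by apply: lerD; [apply: le_trans (pn_const _ _ s0) (cn_le_vn v k)|exact: le_trans (ha k) y1].
    by apply: le_trans (pnM _ _ _ s0) _; rewrite expr2; apply: ler_pM; rewrite ?pn_ge0.
  rewrite -mulr_suml ler_wpM2r ?addr_ge0 ?sqr_ge0 //.
  by rewrite /K [leRHS](bigD1 i) //= lerDl sumr_ge0 // => i' _; apply: sumr_ge0 => j _; exact: Kt0.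
have [d [s [s0 _ Td d1 dn]]] := fps_fixpoint K0 ltr01 T1 Tord Tn.
exists (vd d), s; split=> // [i|i|j].
- by apply: acvD; [exact: ltW|apply: acv_const; exact: ltW|exists 1; exact: dn].
- by rewrite /vd fcoefD (d1 i 0%N) // addr0.
have vdB i : vd d i - fps_const (v i) = d i by rewrite /vd addrC addKr.
rewrite hH -addrA; congr (_ + _).
have -> : \sum_i \sum_k (vd d i - fps_const (v i)) * (vd d k - fps_const (v k)) * pl (vd d) (H j i k) = Q j d.
  by apply: eq_bigr => i _; apply: eq_bigr => k _; rewrite !vdB.
apply/eqP; rewrite eq_sym -subr_eq; apply/eqP.
transitivity (\sum_i d i * fps_const (J i j)); last first.
  by apply: eq_bigr => i _; rewrite mxE mulrC vdB.
under eq_bigr => i _ do rewrite -Td /T mulr_suml.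
rewrite exchange_big /=.
rewrite (eq_bigr (fun k => (fps_const (r k) * fpsX C - Q k d) * fps_const ((invmx J *m J) k j))); last first.
  move=> k _; under eq_bigr => i _ do rewrite -mulrA -rmorphM.
  by rewrite -mulr_sumr -rmorph_sum mxE.
rewrite mulVmx // (bigD1 j) //= big1 ?addr0 => [|k /negbTE nkj].
  by rewrite mxE eqxx rmorph1 mulr1.
by rewrite mxE nkj rmorph0 mulr0.
Qed.

(** Finitely many local conditions hold on a common radius. *)
Lemma finite_radius (I : finType) (P : I -> R -> Prop) :
  (forall i d d', d' <= d -> P i d -> P i d') ->
  (forall i, exists2 d, 0 < d & P i d) -> exists2 d, 0 < d & forall i, P i d.
Proof.
move=> Pd h; have /choice [d /all_and2 [d0 hd]] : forall i, exists d, 0 < d /\ P i d.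
  by move=> i; have [d d0 hd] := h i; exists d.
exists (\big[Num.min/1]_i d i) => [|i].
  by elim/big_ind: _ => // x y x0 y0; rewrite lt_min x0.
apply: Pd (hd i); rewrite (bigD1 i) //= ge_min lexx //.
Qed.

(** Strict differentiability makes a map with invertible Jacobian injective. *)
Lemma local_injectivity : exists2 eta, 0 < eta & forall w w',
  (forall i, cn (w i - v i) <= eta) -> (forall i, cn (w' i - v i) <= eta) ->
  (forall j, mev w (Phi j) = mev w' (Phi j)) -> w =1 w'.
Proof.
pose c := \sum_i \sum_j cn (invmx J j i).
have c0 : 0 <= c by apply: sumr_ge0 => i _; apply: sumr_ge0 => j _; exact: cn_ge0.
have e0 : 0 < 1 / (2 * (c + 1)) by rewrite divr_gt0 //; lra.
have [eta eta0 h] := finite_radius (P := fun j d => forall w w',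
  (forall i, cn (w i - v i) <= d) -> (forall i, cn (w' i - v i) <= d) ->
  cn (mev w (Phi j) - mev w' (Phi j)
      - \sum_i mev v (mpoly.mderiv i (Phi j)) * (w i - w' i))
    <= 1 / (2 * (c + 1)) * vn (fun i => w i - w' i))
  (fun j d d' le_d hd w w' hw hw' => hd w w' (fun i => le_trans (hw i) le_d) (fun i => le_trans (hw' i) le_d))
  (fun j => poly_strict_diff (Phi j) v e0).
exists eta => // w w' hw hw' eqw; pose V := vn (fun i => w i - w' i).
have V0 : 0 <= V by exact: vn_ge0.
have hj j : cn (\sum_i (w i - w' i) * J i j) <= 1 / (2 * (c + 1)) * V.
  have := h j w w' hw hw'; rewrite eqw subrr sub0r cnN; apply: le_trans.
  by rewrite le_eqVlt; apply/orP; left; apply/eqP; congr cn; apply: eq_bigr => i _; rewrite mxE mulrC.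
have : V <= 1 / (2 * (c + 1)) * V * c.
  rewrite /V /vn mulr_sumr; apply: ler_sum => i _.
  rewrite -(sum_invmx (fun i => w i - w' i) i) mulr_sumr.
  apply: le_trans (cn_sum _ _ _) _; apply: ler_sum => j _; rewrite cnM.
  by apply: ler_wpM2r; rewrite ?cn_ge0.
have -> : 1 / (2 * (c + 1)) * V * c = V * (c / (c + 1)) / 2 by field; lra.
have : c / (c + 1) <= 1 by rewrite ler_pdivrMr; lra.
move=> h1 h2; have V00 : V <= 0 by nra.
by move=> i; apply/eqP; rewrite -subr_eq0; apply/eqP; apply: (vn_eq0 V00).
Qed.
End InverseFunction.

(** * Points, forms and tangent spaces in homogeneous coordinates *)

Section Projective.
Variables (R : realType) (N : nat).
Local Notation C := R[i].
Local Notation mp := (mpoly.mpoly N.+1 C).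
Local Notation homog d := (mpoly.ishomog1 d mpoly.mdeg).
Implicit Types (F G : mp) (v w : 'rV[C]_N.+1) (X : set (projspace C N)).

Lemma sval_ppoint w : w != 0 -> sval (ppoint w) = <[w]>%VS.
Proof.
move=> w0; rewrite /ppoint.
by have := val_insubd (exist (fun L => \dim L == 1%N) _ (dim_vline_e0 C N)) <[w]>%VS;
  rewrite dim_vline w0.
Qed.

Lemma ppointP (x : projspace C N) : exists2 w, w != 0 & x = ppoint w.
Proof.
case: x => L hL; have L0 : L != 0%VS by rewrite -dimv_eq0 (eqP hL).
have w0 : vpick L != 0 by rewrite vpick0.
exists (vpick L) => //; apply: val_inj; rewrite /= sval_ppoint //.
apply/eqP; rewrite eq_sym eqEdim -memvE memv_pick /= (eqP hL) dim_vline w0 //.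
Qed.

Lemma ppoint_scale (l : C) w : l != 0 -> ppoint (l *: w) = ppoint w.
Proof.
move=> l0; have [->|w0] := eqVneq w 0; first by rewrite scaler0.
apply: val_inj; rewrite /= !sval_ppoint ?scaler_eq0 ?negb_or ?l0 //.
by apply/eqP; rewrite eqEdim -memvE memvZ ?memv_line //= !dim_vline scaler_eq0 negb_or l0 w0.
Qed.

Lemma ppoint_eqP v w : v != 0 -> w != 0 -> ppoint v = ppoint w ->
  exists2 l, l != 0 & v = l *: w.
Proof.
move=> v0 w0 /(congr1 sval); rewrite !sval_ppoint // => e.
have : v \in <[w]>%VS by rewrite -e memv_line.
move=> /vlineP [l ev]; exists l => //; apply: contraNneq v0 => l0.
by rewrite ev l0 scale0r.
Qed.

Lemma vanishes_atE F w : w != 0 -> homogeneous F ->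
  vanishes_at F (ppoint w) <-> mev (w 0) F = 0.
Proof.
move=> w0 [d hF]; rewrite /vanishes_at sval_ppoint //; split.
  by move=> /(_ w (memv_line w)); rewrite mevE.
move=> Fw _ /vlineP [l ->]; rewrite -mevE.
have -> : (l *: w) 0 = (fun i => l * w 0 i) by apply/funext => i; rewrite mxE.
by rewrite (mev_homog _ _ hF) Fw mulr0.
Qed.

Lemma mev_vanishing X F w : vanishing_forms X F -> w != 0 -> X (ppoint w) -> mev (w 0) F = 0.
Proof. by move=> [hF hX] w0 /hX; rewrite vanishes_atE. Qed.

Lemma zariski_closedP X w : zariski_closed X -> w != 0 ->
  (forall F, vanishing_forms X F -> mev (w 0) F = 0) -> X (ppoint w).
Proof.
move=> [S hS eX] w0 h; rewrite eX => F SF /=.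
apply/vanishes_atE => //; first exact: hS.
by apply: h; split; [exact: hS | move=> x; rewrite eX; apply].
Qed.

Lemma tangent_spaceE X v w : v != 0 -> w != 0 -> tangent_space X (ppoint v) (ppoint w) <->
  forall F, vanishing_forms X F ->
    \sum_i mev (v 0) (mpoly.mderiv i F) * w 0 i = 0.
Proof.
move=> v0 w0; rewrite /tangent_space /= !sval_ppoint //; split=> h F hF.
  rewrite -[RHS](h F hF v w (memv_line _) (memv_line _)).
  by apply: eq_bigr => i _; rewrite mevE.
move=> _ _ /vlineP [l ->] /vlineP [k ->]; have [[d hd] _] := hF.
have -> : (l *: v) 0 = (fun i => l * v 0 i) by apply/funext => i; rewrite mxE.
rewrite (eq_bigr (fun i => l ^+ d.-1 * k * (mev (v 0) (mpoly.mderiv i F) * w 0 i))).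
  by rewrite -mulr_sumr h // mulr0.
by move=> i _; rewrite -mevE (mev_homog _ _ (homog_mderiv i hd)) mxE; ring.
Qed.

(** A point is cut out by the equations [w_j l(w') = w'_j l(w)]. *)
Lemma zariski_closed_point (x : projspace C N) : zariski_closed [set x]%classic.
Proof.
have [v v0 ->] := ppointP x.
pose L i j : mp := pC _ (v 0 i) * pX C j - pC _ (v 0 j) * pX C i.
have hL i j : homogeneous (L i j).
  by exists 1%N; apply: rpredB; exact: mpoly.dhomogM (homog_pC _ _) (homog_pX _ _).
exists [set F | exists i j, F = L i j]%classic; first by move=> _ [i [j ->]].
have Lev w i j : mev (w 0) (L i j) = v 0 i * w 0 j - v 0 j * w 0 i.
  by rewrite mevB !mevM !mev_pC !mev_pX.
apply/seteqP; split => [_ -> _ [i [j ->]]|y h].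
  by apply/vanishes_atE => //; rewrite Lev mulrC subrr.
have [w w0 ey] := ppointP y; rewrite /= ey.
have e i j : v 0 i * w 0 j = v 0 j * w 0 i.
  apply/eqP; rewrite -subr_eq0 -Lev; apply/eqP/vanishes_atE => //.
  by rewrite -ey; apply: h; exists i, j.
have [i vi] : exists i, v 0 i != 0.
  apply/existsP; apply: contraR v0; rewrite negb_exists => /forallP h0.
  by apply/eqP/rowP => i; rewrite mxE; apply/eqP; have := h0 i; rewrite negbK.
have ew : w = (w 0 i / v 0 i) *: v.
  by apply/rowP => j; apply: (mulfI vi); rewrite mxE e mulrA (mulrC (v 0 i)) divfK // mulrC.
rewrite ew ppoint_scale //; apply: contraNneq w0 => l0.
by rewrite ew l0 scale0r.
Qed.

Lemma irreducible_closed_point (x : projspace C N) : irreducible_closed [set x]%classic.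
Proof.
split; [exact: zariski_closed_point | by exists x |].
move=> Z1 Z2 _ _ /(_ x erefl) [Zx|Zx]; [left|right]; by move=> _ ->.
Qed.
End Projective.

(** * Local charts of a smooth curve *)

Section LinearAlgebra.
Variable F : fieldType.

Lemma rank_kermx_row (m k : nat) (A : 'M[F]_(m, k)) (g : 'cV_m) (w : 'rV_m) :
  w *m A = 0 -> w *m g != 0 ->
  (\rank (kermx (row_mx A g)) < \rank (kermx A))%N.
Proof.
move=> wA wg; apply: rank_ltmx; rewrite ltmxE; apply/andP; split.
  apply/sub_kermxP.
  have : kermx (row_mx A g) *m row_mx A g = 0 by exact: mulmx_ker.
  by rewrite mul_mx_row => /(congr1 lsubmx); rewrite row_mxKl linear0.
apply: contra wg => h.
have : (w <= kermx (row_mx A g))%MS by apply: submx_trans h; apply/sub_kermxP.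
move/sub_kermxP; rewrite mul_mx_row => /(congr1 rsubmx).
by rewrite row_mxKr linear0 => ->.
Qed.

(** Two linear forms on a space of dimension 4 leave a plane, and each new
    equation is chosen not to vanish on some vector of the remaining kernel. *)
Lemma complete_equations (T : Type) (P : T -> Prop) (g : T -> 'cV[F]_4) (L : 'M[F]_(4, 2)) :
  \rank L = 2%N ->
  (forall w : 'rV_4, w != 0 -> w *m L = 0 -> exists2 x, P x & w *m g x != 0) ->
  exists x y, [/\ P x, P y & forall w : 'rV_4, w *m L = 0 -> w *m g x = 0 -> w *m g y = 0 -> w = 0].
Proof.
move=> rL h.
have nzker (A : 'M[F]_4) : (0 < \rank A)%N -> exists2 w : 'rV_4, w != 0 & (w <= A)%MS.
  rewrite lt0n mxrank_eq0 => A0; exists (nz_row A); first by rewrite nz_row_eq0.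
  exact: nz_row_sub.
have rk : \rank (kermx L) = 2%N by rewrite mxrank_ker rL.
have [w w0 /sub_kermxP wL] := nzker (kermx L) ltac:(by rewrite rk).
have [x Px wx] := h w w0 wL.
have r1 := rank_kermx_row wL wx; rewrite rk in r1.
have [r10|/nzker [w' w'0 /sub_kermxP]] := posnP (\rank (kermx (row_mx L (g x)))).
  exists x, x; split=> // u uL ux _; apply/eqP; rewrite -submx0.
  move/eqP: r10; rewrite mxrank_eq0 => /eqP <-.
  by apply/sub_kermxP; rewrite mul_mx_row uL ux row_mx0.
rewrite mul_mx_row => e; have w'L : w' *m L = 0.
  by move/(congr1 lsubmx): e; rewrite row_mxKl linear0.
have [y Py wy] := h w' w'0 w'L.
have r2 := @rank_kermx_row _ _ (row_mx L (g x)) (g y) w' ltac:(by rewrite mul_mx_row) wy.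
exists x, y; split=> // u uL ux uy; apply/eqP; rewrite -submx0.
have : \rank (kermx (row_mx (row_mx L (g x)) (g y))) == 0%N by move: r1 r2; lia.
rewrite mxrank_eq0 => /eqP <-.
by apply/sub_kermxP; rewrite !mul_mx_row uL ux uy !row_mx0.
Qed.

Lemma unitmx_ker (n : nat) (J : 'M[F]_n) :
  (forall w : 'rV_n, w *m J = 0 -> w = 0) -> J \in unitmx.
Proof.
move=> h; rewrite -row_free_unit -kermx_eq0; apply/eqP/row_matrixP => i.
by rewrite row0; apply: h; rewrite -row_mul mulmx_ker row0.
Qed.
End LinearAlgebra.

Section SeriesFacts.
Variable R : realType.
Local Notation C := R[i].

Lemma ord_ge_unitM k (u g : fps C) : coef u 0 != 0 -> ord_ge k (u * g) -> ord_ge k g.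
Proof.
move=> u0; elim: k => [|k IH] h; first exact: ord_ge0.
have gk := IH (ord_geW (leqnSn k) h).
move=> n; rewrite ltnS leq_eqVlt => /orP[/eqP->|]; last exact: gk.
have := h k (ltnSn k); rewrite mulrC (coef_ord_ge_mul _ gk) => /eqP.
by rewrite mulf_eq0 (negbTE u0) orbF => /eqP.
Qed.

Lemma ord_ge_unitXM k j (u g : fps C) : coef u 0 != 0 -> ord_ge k (u ^+ j * g) -> ord_ge k g.
Proof.
move=> u0; elim: j => [|j IH]; first by rewrite expr0 mul1r.
by rewrite exprS -mulrA => /(ord_ge_unitM u0) /IH.
Qed.

Lemma pn_XnM (s : R) k (b : fps C) N : pn s (fpsX C ^+ k * b) (k + N) = s ^+ k * pn s b N.
Proof.
rewrite !pnE mulr_sumr big_split_ord big1 => [|i _]; last first.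
  by rewrite coef_XnM /= ltn_ord cn0 mul0r.
by rewrite [LHS]add0r; apply: eq_bigr => i _; rewrite coef_XnM /= ltnNge leq_addr addKn exprD mulrCA.
Qed.

Lemma acv_divX (s : R) k (b : fps C) : 0 < s -> acv s (fpsX C ^+ k * b) -> acv s b.
Proof.
move=> s0 [M hM]; exists (M / s ^+ k) => N.
by rewrite ler_pdivlMr ?exprn_gt0 // mulrC -pn_XnM.
Qed.

Definition fshift (b : fps C) := FPS (fun n => coef b n.+1).

Lemma fshiftE b : b = fps_const (coef b 0) + fpsX C * fshift b.
Proof. by apply: fpsP => -[|n]; rewrite fcoefD coef_XM /= ?addr0 ?add0r. Qed.

Lemma fshift_acv (s : R) (b : fps C) : 0 < s -> acv s b -> acv s (fshift b).
Proof.
move=> s0 hb; apply: (@acv_divX s 1) => //.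
have -> : fpsX C ^+ 1 * fshift b = b - fps_const (coef b 0) by rewrite {2}[b]fshiftE addrC addKr.
exact: acvB (ltW s0) hb (acv_const _ (ltW s0)).
Qed.

Lemma ev_split (s : R) (b : fps C) h : 0 < s -> acv s b -> cn h <= s ->
  ev b h = coef b 0 + h * ev (fshift b) h.
Proof.
move=> s0 hb hs; have sn := ltW s0; have hc := fshift_acv s0 hb.
rewrite {1}[b]fshiftE (evD sn hs (acv_const _ sn) (acvM sn (acvX sn) hc)) ev_const.
by rewrite (evM sn hs (acvX sn) hc) evX.
Qed.

Lemma ev_at0 (s : R) (b : fps C) : 0 < s -> acv s b -> ev b 0 = coef b 0.
Proof. by move=> s0 hb; rewrite (ev_split s0 hb) ?cn0 ?mul0r ?addr0 // ltW. Qed.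

Lemma ev_near0 s (a : fps C) : 0 < s -> acv s a -> exists2 M, 0 <= M &
  forall t, cn t <= s -> cn (ev a t - coef a 0) <= M * cn t.
Proof.
move=> s0 ha; have sn := ltW s0; have [M hM] := fshift_acv s0 ha.
exists M; first exact: le_trans (pn_ge0 _ 0 sn) (hM 0%N).
move=> t ts; rewrite (ev_split s0 ha ts) addrC addKr cnM mulrC.
by apply: ler_wpM2r; [exact: cn_ge0 | exact: ev_le_pn hM].
Qed.
End SeriesFacts.

Notation o0 := (Ordinal (isT : 0 < 4)%N).
Notation o1 := (Ordinal (isT : 1 < 4)%N).
Notation o2 := (Ordinal (isT : 2 < 4)%N).
Notation o3 := (Ordinal (isT : 3 < 4)%N).

Lemma forall4 (P : 'I_4 -> Prop) : P o0 -> P o1 -> P o2 -> P o3 -> forall j, P j.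
Proof.
move=> P0 P1 P2 P3 [[|[|[|[|//]]]] hj]; [move: P0|move: P1|move: P2|move: P3];
  by congr P; apply: val_inj.
Qed.

Lemma sum4 (V : nmodType) (F : 'I_4 -> V) : \sum_j F j = F o0 + F o1 + F o2 + F o3.
Proof.
rewrite !big_ord_recl big_ord0 addr0 !addrA.
by congr (_ + _ + _ + _); congr F; apply: val_inj.
Qed.

Section Charts.
Variable R : realType.
Local Notation C := R[i].
Local Notation mp := (mpoly.mpoly 4 C).
Local Notation homog d := (mpoly.ishomog1 d mpoly.mdeg).
Implicit Types (F G p q h : mp) (v w : 'rV[C]_4) (l : 'I_4 -> C) (t : C).

Definition lin l w : C := \sum_i l i * w 0 i.
Definition linp l : mp := \sum_i pC 4 (l i) * pX C i.

Lemma mev_linp l w : mev (w 0) (linp l) = lin l w.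
Proof. by rewrite mev_sum; apply: eq_bigr => i _; rewrite mevM mev_pC mev_pX. Qed.
Lemma pl_linp l (a : 'I_4 -> fps C) : pl a (linp l) = \sum_i fps_const (l i) * a i.
Proof.
rewrite (big_morph (pl a) (plD a) (pl0 a)).
by apply: eq_bigr => i _; rewrite plM pl_pC pl_pX.
Qed.
Lemma coef_pl_linp l (a : 'I_4 -> fps C) k :
  coef (pl a (linp l)) k = lin l (\row_i coef (a i) k).
Proof.
by rewrite pl_linp coef_sums; apply: eq_bigr => i _; rewrite coef_constM mxE.
Qed.
Lemma lin_col n (M : 'M[C]_(4, n)) j w : lin (fun i => M i j) w = (w *m M) 0 j.
Proof. by rewrite mxE; apply: eq_bigr => i _; rewrite mulrC. Qed.
Lemma linD l v w : lin l (v + w) = lin l v + lin l w.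
Proof. by rewrite /lin -big_split; apply: eq_bigr => i _; rewrite mxE mulrDr. Qed.
Lemma homog_linp l : linp l \is homog 1. Proof. exact: homog_linear. Qed.
Lemma linZ l (k : C) w : lin l (k *: w) = k * lin l w.
Proof. by rewrite /lin mulr_sumr; apply: eq_bigr => i _; rewrite mxE mulrCA. Qed.
Lemma mderiv_linp l i : mpoly.mderiv i (linp l) = pC 4 (l i).
Proof.
rewrite raddf_sum /= (bigD1 i) //= big1 ?addr0 => [|j nji].
  by rewrite /pC mpoly.mderiv_mulC mderiv_pX eqxx; rewrite -mpoly.mpolyCM mulr1.
by rewrite /pC mpoly.mderiv_mulC mderiv_pX (negbTE nji) -mpoly.mpolyCM mulr0 mpoly.mpolyC0.
Qed.
End Charts.

Section CurveCharts.
Variable R : realType.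
Local Notation C := R[i].
Local Notation mp := (mpoly.mpoly 4 C).
Local Notation homog d := (mpoly.ishomog1 d mpoly.mdeg).
Variable X : set (projspace C 3).
Hypothesis Xirr : irreducible_closed X.
Hypothesis Xinf : forall x, ~ (X `<=` [set x])%classic.
Implicit Types (F G p q h : mp) (v w : 'rV[C]_4) (l : 'I_4 -> C) (t : C).

Definition evc (a : 'I_4 -> fps C) t : 'rV[C]_4 := \row_i ev (a i) t.

(** The arc [a] through [v] parametrizes a neighbourhood of [v] in the affine
    part [l0 = 1] of the cone over [X], the parameter being [l1 - l1(v)]. *)
Record chart l0 l1 v (a : 'I_4 -> fps C) (s : R) : Prop := Chart {
  chart_gt0 : 0 < s;
  chart_acv : forall i, acv s (a i);
  chart_coef0 : forall i, coef (a i) 0 = v 0 i;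
  chart_forms : forall G, vanishing_forms X G -> pl a G = 0;
  chart_l0 : pl a (linp l0) = 1;
  chart_l1 : pl a (linp l1) = fps_const (lin l1 v) + fpsX C;
  chart_near : exists2 eta, 0 < eta & forall w, X (ppoint w) -> lin l0 w = 1 ->
    (forall i, cn (w 0 i - v 0 i) <= eta) ->
    cn (lin l1 w - lin l1 v) <= s /\ w = evc a (lin l1 w - lin l1 v) }.

Definition phi_of l0 l1 F1 F2 (j : 'I_4) : mp :=
  nth 0 [:: linp l0; linp l1; F1; F2] j.

Section Localization.
Variables (l0 l1 : 'I_4 -> C) (F1 F2 : mp) (v : 'rV[C]_4) (a : 'I_4 -> fps C).
Hypotheses (v0 : v != 0) (Xv : X (ppoint v)) (l0v : lin l0 v = 1).
Hypotheses (F1X : vanishing_forms X F1) (F2X : vanishing_forms X F2).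
Let Phi := phi_of l0 l1 F1 F2.
Let J : 'M[C]_4 := \matrix_(i, j) mev (v 0) (mpoly.mderiv i (Phi j)).
Hypothesis Junit : J \in unitmx.
Hypotheses (a0 : forall i, coef (a i) 0 = v 0 i)
  (aPhi : forall j, pl a (Phi j) =
     fps_const (mev (v 0) (Phi j)) + fps_const (val j == 1%N)%:R * fpsX C).

Let aff w := X (ppoint w) /\ lin l0 w = 1.
(** Congruence of polynomial functions on the affine curve together with the
    arc [a]. *)
Let eqX p q := (forall w, aff w -> mev (w 0) p = mev (w 0) q) /\ pl a p = pl a q.
Let T : mp := linp l1 - pC 4 (lin l1 v).
Let dl i : mp := pX C i - pC 4 (v 0 i).

Let eqX_refl p : eqX p p. Proof. by split. Qed.
Let eqX_trans p q r : eqX p q -> eqX q r -> eqX p r.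
Proof. by move=> [h1 h2] [h3 h4]; split=> [w hw|]; rewrite ?h1 ?h2 ?h3. Qed.
Let eqXD p p' q q' : eqX p p' -> eqX q q' -> eqX (p + q) (p' + q').
Proof. by move=> [h1 h2] [h3 h4]; split=> [w hw|]; rewrite ?mevD ?plD ?h1 ?h3 ?h2 ?h4. Qed.
Let eqXM p p' q q' : eqX p p' -> eqX q q' -> eqX (p * q) (p' * q').
Proof. by move=> [h1 h2] [h3 h4]; split=> [w hw|]; rewrite ?mevM ?plM ?h1 ?h3 ?h2 ?h4. Qed.
Let eqX_sum (f g : 'I_4 -> mp) : (forall i, eqX (f i) (g i)) -> eqX (\sum_i f i) (\sum_i g i).
Proof. by move=> h; elim/big_ind2: _ => // *; exact: eqXD. Qed.

Let aff_neq0 w : lin l0 w = 1 -> w != 0.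
Proof.
move=> h; apply/eqP => w0; move/eqP: h; rewrite w0 /lin big1 => [|i _].
  by rewrite eq_sym oner_eq0.
by rewrite mxE mulr0.
Qed.

Let Phi_eqX j : eqX (Phi j - pC 4 (mev (v 0) (Phi j))) (pC 4 (val j == 1%N)%:R * T).
Proof.
have plC c : pl a (pC 4 c) = fps_const c by exact: pl_pC.
have T1 : pl a T = fpsX C.
  rewrite plB plC; have := aPhi o1; rewrite /Phi /phi_of /=.
  by rewrite mev_linp rmorph1 mul1r => ->; rewrite addrAC subrr add0r.
split=> [w [Xw w1]|]; last first.
  by rewrite plB plC aPhi plM plC T1 addrAC subrr add0r.
rewrite mevB mev_pC mevM mev_pC mevB mev_linp mev_pC.
have w0 := aff_neq0 w1.
case: j => -[|[|[|[|//]]]] hj; rewrite /Phi /phi_of /= ?mev_linp.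
- by rewrite w1 l0v subrr mul0r.
- by rewrite mul1r.
- by rewrite !(mev_vanishing F1X) // subrr mul0r.
- by rewrite !(mev_vanishing F2X) // subrr mul0r.
Qed.

Let taylor_id p : exists H : 'I_4 -> 'I_4 -> mp,
  p - pC 4 (mev (v 0) p) =
  \sum_i dl i * (pC 4 (mev (v 0) (mpoly.mderiv i p)) + \sum_k dl k * H i k).
Proof.
have [H e] := taylor2 p (v 0); exists H; rewrite {1}e -mevE.
rewrite -!addrA addrC -!addrA addNr addr0 -big_split; apply: eq_bigr => i _ /=.
rewrite [RHS]mulrDr -mevE; congr (_ + _); first exact: mulrC.
by rewrite mulr_sumr; apply: eq_bigr => k _; rewrite mulrA.
Qed.

Let mev_dl i : mev (v 0) (dl i) = 0.
Proof. by rewrite mevB mev_pX mev_pC subrr. Qed.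

(** Cramer's rule: after inverting one function, [T] generates the maximal
    ideal of [v] on the curve. *)
Let cramer : exists g, mev (v 0) g != 0 /\ exists hh : 'I_4 -> mp,
  forall i, eqX (g * dl i) (T * hh i).
Proof.
have /choice [H hH] := fun j => taylor_id (Phi j).
pose M : 'M[mp]_4 := \matrix_(i, j)
  (pC 4 (mev (v 0) (mpoly.mderiv i (Phi j))) + \sum_k dl k * H j i k).
pose d := \row_i dl i.
exists (\det M); split.
  have -> : mev (v 0) (\det M) = \det J.
    rewrite mevE -det_map_mx; congr determinant; apply/matrixP => i j.
    rewrite !mxE /= -mevE mevD mev_pC.
    rewrite (mev_sum _ _ xpredT (fun k => dl k * H j i k)) big1 ?addr0 // => k _.
    by rewrite mevM mev_dl mul0r.
  by move: Junit; rewrite unitmxE unitfE.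
exists (fun i => \sum_j pC 4 (val j == 1%N)%:R * \adj M j i) => i.
have -> : \det M * dl i = \sum_j (Phi j - pC 4 (mev (v 0) (Phi j))) * \adj M j i.
  have /matrixP /(_ 0 i) : d *m M *m \adj M = d *m (\det M)%:M by rewrite -mulmxA mul_mx_adj.
  rewrite mul_mx_scalar !mxE => <-; apply: eq_bigr => j _; rewrite hH !mxE.
  by congr (_ * _); apply: eq_bigr => k _; rewrite !mxE.
rewrite mulr_sumr; apply: eqX_sum => j; rewrite mulrCA mulrA.
by apply: eqXM; [exact: Phi_eqX | exact: eqX_refl].
Qed.

Lemma phi_on_curve j w : X (ppoint w) -> lin l0 w = 1 ->
  mev (w 0) (Phi j) = mev (v 0) (Phi j) + (val j == 1%N)%:R * (lin l1 w - lin l1 v).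
Proof.
move=> Xw w1; have := (Phi_eqX j).1 w (conj Xw w1).
rewrite mevB mev_pC mevM mev_pC mevB mev_linp mev_pC => <-.
by rewrite addrC subrK.
Qed.

(** If [G] did not vanish along the arc, it would equal a power of [T] up to
    functions invertible at [v], so that [v] would be an isolated point of the
    irreducible curve. *)
Lemma forms_vanish_on_arc G : vanishing_forms X G -> pl a G = 0.
Proof.
move=> GX; have [g [gv [hh hg]]] := cramer.
apply/eqP/negPn/negP => Ga.
have ga0 : coef (pl a g) 0 != 0.
  by rewrite pl_coef0; have -> : (fun i => coef (a i) 0) = v 0 by apply/funext.
have T1 : pl a T = fpsX C.
  rewrite plB pl_pC; have := aPhi o1; rewrite /Phi /phi_of /=.
  by rewrite mev_linp rmorph1 mul1r => ->; rewrite addrAC subrr add0r.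
have step p : mev (v 0) p = 0 -> exists p', eqX (g * p) (T * p').
  move=> pv; have [H e] := taylor_id p.
  move: e; rewrite pv /pC mpoly.mpolyC0 subr0 => ->.
  eexists (\sum_i hh i * _); rewrite !mulr_sumr; apply: eqX_sum => i.
  by rewrite !mulrA; apply: eqXM (hg i) (eqX_refl _).
(* [T] divides [G] up to a unit only finitely often, since [T] is [X] on the arc *)
have [k [h [hk hv]]] : exists k h, eqX (g ^+ k * G) (T ^+ k * h) /\ mev (v 0) h != 0.
  apply: contrapT => no; apply: (negP Ga); apply/eqP/ord_ge_eq0 => k.
  have [h [_ hk]] : exists h, eqX (g ^+ k * G) (T ^+ k * h).
    elim: k => [|k [h hk]]; first by exists G; rewrite !expr0; exact: eqX_refl.
    have [hv|hv] := eqVneq (mev (v 0) h) 0; last by case: no; exists k, h.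
    have [h' hh'] := step h hv; exists h'.
    rewrite exprS -mulrA; apply: eqX_trans (eqXM (eqX_refl g) hk) _.
    by rewrite mulrCA exprSr -mulrA; apply: eqXM (eqX_refl _) hh'.
  apply: (@ord_ge_unitXM _ _ k _ _ ga0); rewrite -plX -plM hk plM plX T1.
  by rewrite mulrC; apply: ord_geMl => n nk; rewrite coef_Xn; case: ltngtP nk.
have [d [Q [hQ eQ]]] := homogenize (g * h) (homog_linp l0).
pose Z1 := [set x | vanishes_at (linp l0 * Q) x]%classic.
have hlQ : homogeneous (linp l0 * Q).
  by exists (1 + d)%N; apply: mpoly.dhomogM => //; exact: homog_linp.
have Z1c : zariski_closed Z1.
  exists [set linp l0 * Q]%classic; first by move=> _ ->.
  by apply/seteqP; split => [x hx _ -> //|x hx]; exact: hx.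
have [_ _ irr] := Xirr.
have [] := irr Z1 _ Z1c (zariski_closed_point (ppoint v)); last exact: Xinf.
- move=> y Xy; have [w w0 ey] := ppointP y; rewrite ey in Xy *.
  have [lw|lw] := eqVneq (lin l0 w) 0.
    by left; apply/vanishes_atE => //; rewrite mevM mev_linp lw mul0r.
  pose w' := (lin l0 w)^-1 *: w.
  have pw' : ppoint w' = ppoint w by rewrite ppoint_scale // invr_eq0.
  have w'1 : lin l0 w' = 1 by rewrite linZ mulVf.
  have aw' : aff w' by split; rewrite ?pw'.
  have w'0 := aff_neq0 w'1.
  have w'E : (fun i => w 0 i / mev (w 0) (linp l0)) = w' 0.
    by apply/funext => i; rewrite mxE mev_linp mulrC.
  have [ghw|ghw] := eqVneq (mev (w' 0) (g * h)) 0.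
    left; apply/vanishes_atE => //; rewrite mevM eQ; last by rewrite mev_linp.
    by rewrite w'E ghw !mulr0.
  right; rewrite /= -pw'; congr ppoint.
  move: ghw; rewrite mevM mulf_eq0 negb_or => /andP[gw hw].
  have Tw : mev (w' 0) T = 0.
    have Gw : mev (w' 0) G = 0 := mev_vanishing GX w'0 aw'.1.
    have := hk.1 w' aw'; rewrite (mevM _ _ G) Gw mulr0 mevM mevX => /esym/eqP.
    by rewrite mulf_eq0 (negbTE hw) orbF expf_eq0 => /andP[_ /eqP].
  apply/rowP => i; have := (hg i).1 w' aw'.
  rewrite 2!mevM Tw mul0r => /eqP; rewrite mulf_eq0 (negbTE gw) /= mevB mev_pX mev_pC.
  by rewrite subr_eq0 => /eqP.
- move=> XZ; have := XZ _ Xv; rewrite /Z1 /= vanishes_atE // mevM mev_linp l0v mul1r.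
  have l0v' : mev (v 0) (linp l0) != 0 by rewrite mev_linp l0v oner_eq0.
  rewrite eQ // mev_linp l0v expr1n mul1r.
  have -> : (fun i => v 0 i / 1) = v 0 by apply/funext => i; rewrite divr1.
  by rewrite mevM => /eqP; rewrite mulf_eq0 (negbTE gv) (negbTE hv).
Qed.
End Localization.

Lemma evc_row a t : (evc a t) 0 = (fun i => ev (a i) t).
Proof. by apply/funext => i; rewrite mxE. Qed.

Lemma mev_evc a s t F : 0 <= s -> (forall i, acv s (a i)) -> cn t <= s ->
  mev ((evc a t) 0) F = ev (pl a F) t.
Proof. by move=> s0 ha ts; rewrite evc_row (pl_ev _ s0 ts ha). Qed.

Lemma lin_neq0 l w : lin l w != 0 -> w != 0.
Proof.
apply: contra => /eqP ->; rewrite /lin big1 ?eqxx // => i _.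
by rewrite mxE mulr0.
Qed.

Lemma lin_sub l v w : lin l (v - w) = lin l v - lin l w.
Proof. by rewrite /lin -sumrB; apply: eq_bigr => i _; rewrite !mxE mulrBr. Qed.

Lemma cn_lin l w e : (forall i, cn (w 0 i) <= e) -> cn (lin l w) <= (\sum_i cn (l i)) * e.
Proof.
move=> h; apply: le_trans (cn_sum _ _ _) _; rewrite mulr_suml.
by apply: ler_sum => i _; rewrite cnM ler_wpM2l ?cn_ge0.
Qed.

Section ChartFacts.
Variables (l0 l1 : 'I_4 -> C) (v : 'rV[C]_4) (a : 'I_4 -> fps C) (s : R).
Hypothesis ch : chart l0 l1 v a s.

Lemma chart_ge0 : 0 <= s. Proof. exact/ltW/(chart_gt0 ch). Qed.

Lemma chart_lin0 t : cn t <= s -> lin l0 (evc a t) = 1.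
Proof.
move=> ts; rewrite -mev_linp (mev_evc _ chart_ge0 (chart_acv ch) ts) (chart_l0 ch).
exact: (@ev_const _ 1).
Qed.

Lemma chart_lin1 t : cn t <= s -> lin l1 (evc a t) = lin l1 v + t.
Proof.
move=> ts; rewrite -mev_linp (mev_evc _ chart_ge0 (chart_acv ch) ts) (chart_l1 ch).
by rewrite (evD chart_ge0 ts (acv_const _ chart_ge0) (acvX chart_ge0)) ev_const evX.
Qed.

Lemma chart_neq0 t : cn t <= s -> evc a t != 0.
Proof. by move=> ts; apply: (@lin_neq0 l0); rewrite chart_lin0 ?oner_eq0. Qed.

Lemma chart_on t : cn t <= s -> X (ppoint (evc a t)).
Proof.
move=> ts; have [Xc _ _] := Xirr.
apply: zariski_closedP Xc (chart_neq0 ts) _ => F hF.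
rewrite (mev_evc _ chart_ge0 (chart_acv ch) ts) (chart_forms ch hF).
by rewrite ev0.
Qed.
End ChartFacts.

Definition mx2 l0 l1 : 'M[C]_(4, 2) := \matrix_(i, j) (if j == 0 then l0 i else l1 i).

Lemma mulmx_mx2 l0 l1 w : w *m mx2 l0 l1 = \row_j (if j == 0 then lin l0 w else lin l1 w).
Proof.
apply/rowP => j; rewrite !mxE /lin; case: ifP => hj.
  by apply: eq_bigr => i _; rewrite mxE hj mulrC.
by apply: eq_bigr => i _; rewrite mxE hj mulrC.
Qed.

(** Two equations of the curve complete [l0, l1] to coordinates of the ambient
    space at [v]; the inverse function theorem follows [l1] while [l0] and the two
    equations stay constant. *)
Lemma exists_chart l0 l1 v : X (ppoint v) -> lin l0 v = 1 -> \rank (mx2 l0 l1) = 2%N ->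
  (forall w, w != 0 -> lin l0 w = 0 -> lin l1 w = 0 ->
    exists2 F, vanishing_forms X F & \sum_i mev (v 0) (mpoly.mderiv i F) * w 0 i != 0) ->
  exists a s, chart l0 l1 v a s.
Proof.
move=> Xv l0v rk htan.
have v0 : v != 0 by apply: (@lin_neq0 l0); rewrite l0v oner_eq0.
pose grad F : 'cV[C]_4 := \col_i mev (v 0) (mpoly.mderiv i F).
have gradE w F : (w *m grad F) 0 0 = \sum_i mev (v 0) (mpoly.mderiv i F) * w 0 i.
  by rewrite mxE; apply: eq_bigr => i _; rewrite mxE mulrC.
have kerL w : w != 0 -> w *m mx2 l0 l1 = 0 -> exists2 F, vanishing_forms X F & w *m grad F != 0.
  move=> w0; rewrite mulmx_mx2 => /rowP e.
  have [F hF hw] : exists2 F, vanishing_forms X F & \sum_i mev (v 0) (mpoly.mderiv i F) * w 0 i != 0.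
    by apply: htan => //; [have := e 0|have := e 1]; rewrite !mxE.
  exists F => //; apply: contraNneq hw => /matrixP /(_ 0 0).
  by rewrite gradE mxE => ->.
have [F1 [F2 [hF1 hF2 ker0]]] := complete_equations rk kerL.
pose Phi := phi_of l0 l1 F1 F2.
have Junit : (\matrix_(i, j) mev (v 0) (mpoly.mderiv i (Phi j)) : 'M[C]_4) \in unitmx.
  apply: unitmx_ker => w /rowP e.
  have e' j (hj : (j < 4)%N) : \sum_i mev (v 0) (mpoly.mderiv i (Phi (Ordinal hj))) * w 0 i = 0.
    apply: etrans (etrans (e (Ordinal hj)) (mxE _ _ _ _)); rewrite mxE.
    by apply: eq_bigr => i _; rewrite mxE mulrC.
  have colE F : \sum_i mev (v 0) (mpoly.mderiv i F) * w 0 i = 0 -> w *m grad F = 0.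
    by move=> h; apply/matrixP => i j; rewrite !ord1 gradE h mxE.
  have linE l : \sum_i mev (v 0) (mpoly.mderiv i (linp l)) * w 0 i = lin l w.
    by apply: eq_bigr => i _; rewrite mderiv_linp mev_pC.
  apply: ker0.
  - rewrite mulmx_mx2; apply/rowP => j; rewrite !mxE.
    have := e' 0%N isT; rewrite linE => ->; have := e' 1%N isT; rewrite linE => ->.
    by rewrite if_same.
  - exact/colE/(e' 2%N isT).
  - exact/colE/(e' 3%N isT).
have [a [s [s0 ha a0 hPhi]]] := inverse_function Junit (fun j => (val j == 1%N)%:R).
have [eta eta0 inj] := local_injectivity Junit.
have sn := ltW s0.
exists a, s; split=> //.
- by move=> G; apply: forms_vanish_on_arc hPhi G.
- have := hPhi o0; rewrite /Phi /phi_of /= => ->.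
  by rewrite mev_linp l0v rmorph0 mul0r addr0 rmorph1.
- have := hPhi o1; rewrite /Phi /phi_of /= => ->.
  by rewrite mev_linp rmorph1 mul1r.
have near_v : exists2 d, 0 < d & forall t, cn t <= s -> cn t <= d ->
    forall i, cn (ev (a i) t - v 0 i) <= eta.
  have h1 (i : 'I_4) : exists2 d, 0 < d & forall t, cn t <= s -> cn t <= d ->
      cn (ev (a i) t - v 0 i) <= eta.
    have [M M0 hM] := ev_near0 s0 (ha i).
    exists (eta / (M + 1)); first by rewrite divr_gt0 //; lra.
    move=> t ts td; rewrite -a0; apply: le_trans (hM t ts) _.
    have Mp : 0 < M + 1 by lra.
    rewrite ler_pdivlMr // in td; have := cn_ge0 t; nra.
  have [d d0 hd] := finite_radius (P := fun i d => forall t, cn t <= s ->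
      cn t <= d -> cn (ev (a i) t - v 0 i) <= eta)
    (fun i d d' le_d hi t ts td => hi t ts (le_trans td le_d)) h1.
  by exists d => // t ts td i; apply: hd.
have [d d0 hd] := near_v.
pose c := \sum_i cn (l1 i).
have c0 : 0 <= c by apply: sumr_ge0 => i _; exact: cn_ge0.
have cp : 0 < c + 1 by lra.
(* [l1] is [c]-Lipschitz, so this bound on [w - v] controls the parameter *)
pose eta' := Num.min eta (Num.min (s / (c + 1)) (d / (c + 1))).
have [le1 le2 le3] : [/\ eta' <= eta, eta' * (c + 1) <= s & eta' * (c + 1) <= d].
  by rewrite -!ler_pdivlMr //; split; rewrite /eta' !ge_min lexx ?orbT.
have eta'0 : 0 < eta' by rewrite /eta' !lt_min eta0 !divr_gt0.
exists eta' => // w Xw w1 hw.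
set t := lin l1 w - lin l1 v.
have tc : cn t <= c * eta'.
  by rewrite /t -lin_sub; apply: cn_lin => i; rewrite !mxE; apply: hw.
have ts : cn t <= s by lra.
split=> //; apply/rowP => i; rewrite mxE.
apply: (inj (w 0) (fun i => ev (a i) t)) => {i}.
- by move=> i; apply: le_trans (hw i) le1.
- by apply: hd => //; lra.
move=> j; have hc c1 : acv s (fps_const c1 : fps C) by exact: acv_const.
rewrite -(pl_ev _ sn ts ha) hPhi (evD sn ts (hc _) (acvM sn (hc _) (acvX sn))).
rewrite (evM sn ts (hc _) (acvX sn)) !ev_const evX.
exact: (phi_on_curve v0 Xv l0v hF1 hF2 hPhi).
Qed.
End CurveCharts.

(** * The classical topology in coordinates *)

(** Stated over an abstract field, which has the topology of its norm; [R[i]]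
    itself carries no canonical topology. *)
Section Bridge.
Import numFieldNormedType.Exports.
Local Open Scope classical_set_scope.
Variables (C : numClosedFieldType) (n : nat).

Lemma near_coordP (z : C) (P : C -> Prop) : (\forall w \near z, P w) <->
  exists2 d : C, 0 < d & forall w, `|w - z| < d -> P w.
Proof.
split=> [/nbhs_ballP [d d0 hd]|[d d0 hd]].
  by exists d => // w hw; apply: hd; rewrite /ball /= distrC.
by apply/nbhs_ballP; exists d => // w; rewrite /ball /= distrC; exact: hd.
Qed.

Lemma open_coordP (U : set C) : open U <->
  forall z, U z -> exists2 d : C, 0 < d & forall w, `|w - z| < d -> U w.
Proof.
rewrite openE; split=> h z Uz; first exact/near_coordP/h.
exact/near_coordP/h.
Qed.

Lemma rV_cvgP (u : nat -> 'rV[C]_n.+1) (l : 'rV[C]_n.+1) :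
  u @ \oo --> l <-> forall e : C, 0 < e -> exists k0, forall k, (k0 <= k)%N ->
    forall i, `|u k 0 i - l 0 i| < e.
Proof.
split=> [/cvg_ballP h e e0|h].
  have [k0 _ hk] := h e e0; exists k0 => k le_k i.
  by have [_ /(_ 0 i)] := hk k le_k; rewrite /ball /= distrC.
apply/cvg_ballP => e e0; have [k0 hk] := h e e0; exists k0 => // k le_k.
by split=> // i j; rewrite ord1 /ball /= distrC; exact: hk.
Qed.

Lemma rV_openP (A : set 'rV[C]_n.+1) : open A <->
  forall v, A v -> exists2 d : C, 0 < d & forall w : 'rV[C]_n.+1, (forall i, `|w 0 i - v 0 i| < d) -> A w.
Proof.
rewrite openE; split=> h v Av.
  have /nbhs_ballP [d d0 hd] := h v Av; exists d => // w hw; apply: hd; split=> // i j.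
  by rewrite ord1 /ball /= distrC; exact: hw.
have [d d0 hd] := h v Av; apply/nbhs_ballP; exists d => // w hw; apply: hd => i.
by have := hw.2 0 i; rewrite /ball /= distrC.
Qed.

Lemma rV_derive1 (f : C -> 'rV[C]_n.+1) (a : C) (l : 'rV[C]_n.+1) :
  (forall e : C, 0 < e -> exists2 d : C, 0 < d & forall h, h != 0 -> `|h| < d ->
     forall i, `|h^-1 * (f (h + a) 0 i - f a 0 i) - l 0 i| < e) ->
  derive1 f a = l.
Proof.
move=> hl; rewrite /derive1; apply: cvg_lim; first exact: norm_hausdorff.
apply/cvg_ballP => e e0; have [d d0 hd] := hl e e0.
rewrite near_withinE; apply/near_coordP; exists d => // h; rewrite subr0 => hh h0.
split=> // i j; rewrite ord1 /ball /= distrC.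
by have := hd h h0 hh j; rewrite !mxE.
Qed.

Definition cderive1 (f : C -> 'rV[C]_n.+1) (a : C) := derive1 f a.
Definition cderive1n k (f : C -> 'rV[C]_n.+1) (a : C) := derive1n k f a.

Lemma cderive1nS k f a : cderive1n k.+1 f a = cderive1 (cderive1n k f) a.
Proof. by rewrite /cderive1n derive1nS. Qed.
End Bridge.

(** * Convergent arcs are local liftings *)

Section Lifting.
Variable R : realType.
Local Notation C := R[i].
Implicit Types (z w t : C) (a : 'I_4 -> fps C) (f : C -> 'rV[C]_4).

Lemma pos_complex (e : C) : 0 < e -> exists2 r : R, 0 < r & forall z, (`|z| < e) = (cn z < r).
Proof.
case: e => r y; rewrite ltcE /= => /andP[/eqP -> r0]; exists r => // z.
by rewrite cnE ltcR.
Qed.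
Lemma norm_ltR z (r : R) : (`|z| < r%:C%C) = (cn z < r).
Proof. by rewrite cnE ltcR. Qed.
Lemma gt0_R (r : R) : 0 < r -> 0 < r%:C%C :> C.
Proof. by move=> r0; rewrite ltcR. Qed.

Definition dnear t (P : C -> Prop) := exists2 d : R, 0 < d & forall w, cn (w - t) < d -> P w.

Definition arc_deriv a (i : 'I_4) : fps C := dshift 1 (a i).

(** After recentring at [t], the difference quotient is the sum at [h] of the
    shifted series. *)
Lemma derive1_arc a f (s : R) t : (forall i, acv s (a i)) -> cn t < s ->
  dnear t (fun w => f w = evc a w) -> cderive1 (n := 3) f t = evc (arc_deriv a) t.
Proof.
move=> ha ts [d d0 hf]; apply: rV_derive1 => e /pos_complex [r r0 he].
have p0 := cn_ge0 t; pose q := (s - cn t) / 2.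
have q0 : 0 < q by rewrite /q; lra.
have prs : cn t + q <= s by rewrite /q; lra.
have hb i : acv q (recenter (a i) t) := acv_recenter p0 q0 prs (lexx _) (ha i).
have h1 (i : 'I_4) : exists2 m : R, 0 < m & forall h, h != 0 -> cn h < m -> cn h < d -> cn h <= q ->
    cn (h^-1 * (f (h + t) 0 i - f t 0 i) - evc (arc_deriv a) t 0 i) < r.
  have [M M0 hM] := ev_near0 q0 (fshift_acv q0 (hb i)).
  have Mp : 0 < M + 1 by rewrite ltr_wpDl.
  exists (r / (M + 1)); first exact: divr_gt0.
  move=> h h0 hm hd hq.
  have -> : f (h + t) = evc a (h + t) by apply: hf; rewrite addrK.
  have -> : f t = evc a t by apply: hf; rewrite subrr cn0.
  rewrite !mxE (addrC h) -(recenter_ev p0 q0 prs (lexx _) hq (ha i)).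
  rewrite -[X in _ - ev (a i) X]addr0 -(recenter_ev p0 q0 prs (lexx _) _ (ha i)) ?cn0 ?(ltW q0) //.
  rewrite (ev_at0 q0 (hb i)) (ev_split q0 (hb i) hq) addrAC subrr add0r mulKf //.
  apply: le_lt_trans (hM h hq) _.
  rewrite ltr_pdivlMr // in hm; apply: le_lt_trans hm.
  by rewrite mulrC ler_wpM2l ?cn_ge0 // lerDl.
have [m m0 hm] := finite_radius (P := fun i m => forall h, h != 0 -> cn h < m ->
    cn h < d -> cn h <= q ->
    cn (h^-1 * (f (h + t) 0 i - f t 0 i) - evc (arc_deriv a) t 0 i) < r)
  (fun i m m' le_m hi h h0 hm' => hi h h0 (lt_le_trans hm' le_m)) h1.
exists (Num.min m (Num.min d q))%:C%C; first by rewrite gt0_R // !lt_min m0 d0.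
move=> h h0; rewrite norm_ltR !lt_min => /and3P[h2 h3 h4] i; rewrite he.
by apply: hm => //; exact: ltW.
Qed.

Lemma acv_arc_deriv a (s r : R) : 0 <= r -> r < s -> (forall i, acv s (a i)) ->
  forall i, acv r (arc_deriv a i).
Proof.
move=> r0 rs ha i; apply: (@acv_dshift _ r (s - r) s) => //; last by lra.
by rewrite subr_gt0.
Qed.

Lemma dnear_arc (s : R) t f a : cn t < s -> (forall w, cn w < s -> f w = evc a w) ->
  dnear t (fun w => f w = evc a w).
Proof.
move=> ts h; exists (s - cn t); first by rewrite subr_gt0.
move=> w hw; apply: h; have := cnD (w - t) t; rewrite subrK; lra.
Qed.

(** The derivatives at [0] of an arc are its coefficients, up to factorials, so
    that linear independence of derivatives can be read on coefficients. *)
Lemma derive1n_arc a f (s : R) k : 0 < s -> (forall i, acv s (a i)) ->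
  (forall w, cn w < s -> f w = evc a w) ->
  cderive1n (n := 3) k f 0 = \row_i ((k`!)%:R * coef (a i) k).
Proof.
move=> s0 ha hf.
have iter_coef i m : coef (iter k arc_deriv a i) m * (m`!)%:R = ((m + k)`!)%:R * coef (a i) (m + k).
  elim: k m => [|k IH] m; first by rewrite addn0 mulrC.
  rewrite iterS /= bin1 addn1 mulrAC -natrM -factS.
  by rewrite mulrC IH addSnnS.
suff [r [r0 hr1 hr2]] : exists r : R, [/\ 0 < r, forall i, acv r (iter k arc_deriv a i) &
    forall w, cn w < r -> cderive1n (n := 3) k f w = evc (iter k arc_deriv a) w].
  rewrite hr2 ?cn0 //; apply/rowP => i; rewrite !mxE (ev_at0 r0 (hr1 i)).
  by have := iter_coef i 0%N; rewrite mulr1.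
elim: k {iter_coef} => [|k [r [r0 hr1 hr2]]]; first by exists s.
have r20 : 0 <= r / 2 by lra.
exists (r / 2); split; first by lra.
  by move=> i; rewrite iterS; apply: acv_arc_deriv hr1 i => //; lra.
move=> w hw; rewrite cderive1nS iterS.
have hwr : cn w < r by lra.
exact: derive1_arc hr1 hwr (dnear_arc hwr hr2).
Qed.

Lemma arc_analytic a f (s : R) t : (forall i, acv s (a i)) -> cn t < s ->
  dnear t (fun w => f w = evc a w) -> analytic_at (N := 3) f t.
Proof.
move=> ha ts [d d0 hf]; have p0 := cn_ge0 t; pose q := (s - cn t) / 2.
have q0 : 0 < q by rewrite /q; lra.
have prs : cn t + q <= s by rewrite /q; lra.
have hb i : acv q (recenter (a i) t) := acv_recenter p0 q0 prs (lexx _) (ha i).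
exists (fun k => \row_i coef (recenter (a i) t) k).
apply/near_coordP; exists (Num.min d q)%:C%C; first by rewrite gt0_R // lt_min d0.
move=> w; rewrite norm_ltR lt_min => /andP[wd wq]; rewrite hf //.
apply/rV_cvgP => e /pos_complex [r r0 he].
have h1 (i : 'I_4) : exists k0, forall k, (k0 <= k)%N ->
    cn (psum (recenter (a i) t) (w - t) k - ev (a i) w) < r.
  have -> : w = t + (w - t) by rewrite addrC subrK.
  rewrite -(recenter_ev p0 q0 prs (lexx _) (ltW wq) (ha i)) [t + _ - t]addrAC subrr add0r.
  exact: ev_clim (ltW q0) (hb i) (ltW wq) _ r0.
have /choice [k0 hk0] := h1.
exists (\max_i k0 i) => k le_k i; rewrite he mxE.
have -> : series (fun k => (w - t) ^+ k *: \row_i coef (recenter (a i) t) k) k 0 i =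
    psum (recenter (a i) t) (w - t) k.
  rewrite /series /= big_mkord summxE; apply: eq_bigr => m _.
  by rewrite !mxE mulrC.
by apply: hk0; apply: leq_trans le_k; exact: leq_bigmax.
Qed.
End Lifting.

Section ChartLifting.
Variable R : realType.
Local Notation C := R[i].
Variable X : set (projspace C 3).
Hypothesis Xirr : irreducible_closed X.
Implicit Types (l : 'I_4 -> C) (v w : 'rV[C]_4) (t : C).

Lemma quot_cont (x0 y0 : C) (e : R) : y0 != 0 -> 0 < e -> exists2 d : R, 0 < d &
  forall x y, cn (x - x0) < d -> cn (y - y0) < d -> y != 0 /\ cn (x / y - x0 / y0) < e.
Proof.
move=> y00 e0; have c0 : 0 < cn y0 by rewrite cn_gt0.
pose k := cn x0 + cn y0.
have k0 : 0 < k by rewrite ltr_wpDl ?cn_ge0.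
pose d := Num.min (cn y0 / 2) (e * cn y0 * cn y0 / (2 * k)).
exists d; first by rewrite /d lt_min !divr_gt0 ?mulr_gt0.
move=> x y; rewrite /d !lt_min => /andP[_ hx] /andP[hy1 hy2].
have cy : cn y0 / 2 < cn y.
  have := cn_triangle y y0 0; rewrite !subr0 cn_distC; lra.
have cy0 : 0 < cn y by apply: lt_trans cy; rewrite divr_gt0.
have y0' : y != 0 by rewrite -cn_gt0.
split=> //.
have -> : x / y - x0 / y0 = ((x - x0) * y0 + x0 * (y0 - y)) / (y * y0) by field; apply/andP.
rewrite cnM cnV cnM ltr_pdivrMr ?mulr_gt0 //.
apply: le_lt_trans (cnD _ _) _; rewrite !cnM (cn_distC y0).
have h1 : cn (x - x0) * cn y0 <= e * cn y0 * cn y0 / (2 * k) * cn y0.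
  by apply: ler_wpM2r; rewrite ?cn_ge0 // ltW.
have h2 : cn x0 * cn (y - y0) <= cn x0 * (e * cn y0 * cn y0 / (2 * k)).
  by apply: ler_wpM2l; rewrite ?cn_ge0 // ltW.
have h3 : e * cn y0 * cn y0 / (2 * k) * cn y0 + cn x0 * (e * cn y0 * cn y0 / (2 * k)) = e * cn y0 * (cn y0 / 2).
  by rewrite /k; field; rewrite -/k gt_eqF.
have h4 : e * cn y0 * (cn y0 / 2) < e * (cn y * cn y0).
  by rewrite -mulrA (mulrC (cn y)) ltr_pM2l // ltr_pM2l.
lra.
Qed.

Lemma lin_cont l w0 (e : R) : 0 < e -> exists2 d : R, 0 < d & forall w,
  (forall i, cn (w 0 i - w0 0 i) < d) -> cn (lin l w - lin l w0) < e.
Proof.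
move=> e0; pose c := \sum_i cn (l i).
have c0 : 0 <= c by apply: sumr_ge0 => i _; exact: cn_ge0.
have cp : 0 < c + 1 by rewrite ltr_wpDl.
exists (e / (c + 1)); first exact: divr_gt0.
move=> w hw; rewrite -lin_sub.
have : cn (lin l (w - w0)) <= c * (e / (c + 1)).
  by apply: cn_lin => i; rewrite !mxE; apply/ltW/hw.
move/le_lt_trans; apply; rewrite mulrA ltr_pdivrMr // mulrC ltr_pM2l //.
by rewrite ltrDl.
Qed.

(** Affine normalization is continuous; it compares neighbourhoods in the cone with
    neighbourhoods in the chart. *)
Lemma normalize_cont l0 w0 (I : finType) (l : I -> 'I_4 -> C) (e : R) :
  lin l0 w0 != 0 -> 0 < e -> exists2 d : R, 0 < d & forall w,
  (forall i, cn (w 0 i - w0 0 i) < d) -> lin l0 w != 0 /\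
  forall k, cn (lin (l k) w / lin l0 w - lin (l k) w0 / lin l0 w0) < e.
Proof.
move=> l00 e0.
have h0 (m : 'I_4 -> C) : exists2 d : R, 0 < d & forall w, (forall i, cn (w 0 i - w0 0 i) < d) ->
    lin l0 w != 0 /\ cn (lin m w / lin l0 w - lin m w0 / lin l0 w0) < e.
  have [d d0 hd] := quot_cont (lin m w0) l00 e0.
  have [d1 d10 hd1] := lin_cont m w0 d0; have [d2 d20 hd2] := lin_cont l0 w0 d0.
  exists (Num.min d1 d2); first by rewrite lt_min d10.
  move=> w hw; have hw1 i : cn (w 0 i - w0 0 i) < d1 by apply: lt_le_trans (hw i) _; rewrite ge_min lexx.
  have hw2 i : cn (w 0 i - w0 0 i) < d2 by apply: lt_le_trans (hw i) _; rewrite ge_min lexx orbT.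
  exact: hd _ _ (hd1 w hw1) (hd2 w hw2).
have h1 (k : option I) : exists2 d : R, 0 < d & forall w, (forall i, cn (w 0 i - w0 0 i) < d) ->
    lin l0 w != 0 /\ (if k is Some k then cn (lin (l k) w / lin l0 w - lin (l k) w0 / lin l0 w0) < e else True).
  case: k => [k|]; first exact: h0.
  by have [d d0 hd] := h0 l0; exists d => // w /hd [].
have [d d0 hd] := finite_radius (P := fun k d => forall w, (forall i, cn (w 0 i - w0 0 i) < d) ->
    lin l0 w != 0 /\ (if k is Some k then cn (lin (l k) w / lin l0 w - lin (l k) w0 / lin l0 w0) < e else True))
  (fun k d d' le_d hk w hw => hk w (fun i => lt_le_trans (hw i) le_d)) h1.
exists d => // w hw; split; first by have [] := hd None w hw.
by move=> k; have [] := hd (Some k) w hw.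
Qed.

Definition coord (i : 'I_4) (j : 'I_4) : C := (i == j)%:R.
Lemma lin_coord i w : lin (coord i) w = w 0 i.
Proof.
rewrite /lin (bigD1 i) //= big1 ?addr0 => [|j /negbTE nji]; rewrite /coord.
  by rewrite eqxx mul1r.
by rewrite eq_sym nji mul0r.
Qed.

Lemma arc_deriv_lin l (a : 'I_4 -> fps C) : pl (arc_deriv a) (linp l) = dshift 1 (pl a (linp l)).
Proof.
apply: fpsP => m; rewrite [RHS]/= !coef_pl_linp mulr_sumr.
by apply: eq_bigr => i _; rewrite !mxE mulrCA.
Qed.

Lemma chart_at0 l0 l1 v a s : chart X l0 l1 v a s -> evc a 0 = v.
Proof.
move=> ch; apply/rowP => i; rewrite mxE.
by rewrite (ev_at0 (chart_gt0 ch) (chart_acv ch i)) (chart_coef0 ch).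
Qed.

(** The normalization [l0 = 1] makes the arc injective, with [l1] as a left
    inverse, and excludes that its derivative be a multiple of its value.  It is
    open because, near [v], every point of the curve lies on the arc. *)
Lemma chart_lifting l0 l1 v a s : chart X l0 l1 v a s ->
  local_lifting X (ppoint v) (evc a).
Proof.
move=> ch; have s0 := chart_gt0 ch; have sn := ltW s0; have ha := chart_acv ch.
have [eta eta0 hnear] := chart_near ch.
have h1 (i : 'I_4) : exists2 d : R, 0 < d & forall t, cn t < d -> cn (ev (a i) t - v 0 i) < eta.
  have [M M0 hM] := ev_near0 s0 (ha i); have Mp : 0 < M + 1 by rewrite ltr_wpDl.
  exists (Num.min s (eta / (M + 1))); first by rewrite lt_min s0 divr_gt0.
  move=> t; rewrite lt_min => /andP[ts]; rewrite ltr_pdivlMr // => td.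
  rewrite -(chart_coef0 ch); apply: le_lt_trans (hM t (ltW ts)) _; apply: le_lt_trans td.
  by rewrite mulrC ler_wpM2l ?cn_ge0 // lerDl.
have [d d0 hd] := finite_radius (P := fun i d => forall t, cn t < d -> cn (ev (a i) t - v 0 i) < eta)
  (fun i d d' le_d hi t td => hi t (lt_le_trans td le_d)) h1.
pose r := Num.min s d; have r0 : 0 < r by rewrite lt_min s0.
have rs t : cn t < r -> cn t < s by rewrite lt_min => /andP[].
have rd t : cn t < r -> cn t < d by rewrite lt_min => /andP[].
exists [set t | cn t < r]%classic; split.
- split; last by change (cn (0 : C) < r); rewrite cn0.
  apply/open_coordP => z /= hz; exists (r - cn z)%:C%C; first by apply: gt0_R; rewrite subr_gt0.
  move=> w; rewrite norm_ltR => hw; have := cnD (w - z) z; rewrite subrK; lra.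
- by rewrite (chart_at0 ch).
- move=> t /= tr; have ts := rs t tr; have ts' := ltW ts.
  have near_t : dnear t (fun z : C => evc a z = evc a z) by exists 1.
  split; first exact: arc_analytic ha ts near_t.
  + exact (chart_neq0 ch ts').
  + exact (chart_on Xirr ch ts').
  rewrite -/(cderive1 (n := 3) (evc a) t) (derive1_arc ha ts near_t).
  pose q := (s + cn t) / 2.
  have cq : cn t <= q by rewrite /q; lra.
  have q0 : 0 <= q by apply: le_trans cq; exact: cn_ge0.
  have qs : q < s by rewrite /q; lra.
  have had := acv_arc_deriv q0 qs ha.
  have ld l : lin l (evc (arc_deriv a) t) = ev (dshift 1 (pl a (linp l))) t.
    by rewrite -mev_linp (mev_evc _ q0 had cq) arc_deriv_lin.
  have ld0 : lin l0 (evc (arc_deriv a) t) = 0.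
    rewrite ld (chart_l0 ch); have -> : dshift 1 (1 : fps C) = fps_const 0.
      by apply: fpsP => m; rewrite /= addn1 mulr0 if_same.
    by rewrite ev_const.
  have ld1 : lin l1 (evc (arc_deriv a) t) = 1.
    rewrite ld (chart_l1 ch).
    have -> : dshift 1 (fps_const (lin l1 v) + fpsX C) = fps_const 1.
      apply: fpsP => m; rewrite /= addn1 /= add0r bin1.
      by case: m => [|m] /=; rewrite ?mulr1 ?mulr0.
    by rewrite ev_const.
  rewrite free_cons seq1_free; apply/andP; split; last first.
    by apply: (@lin_neq0 _ l1); rewrite ld1 oner_eq0.
  rewrite span_seq1; apply/negP => /vlineP [k e].
  have := chart_lin0 ch ts'; rewrite e linZ ld0 mulr0 => /eqP.
  by rewrite eq_sym oner_eq0.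
- move=> x y /= hx hy; have hx' := ltW (rs x hx); have hy' := ltW (rs y hy).
  move=> /(ppoint_eqP (chart_neq0 ch hx') (chart_neq0 ch hy')) [k k0 e].
  have k1 : k = 1.
    by have := chart_lin0 ch hx'; rewrite e linZ (chart_lin0 ch hy') mulr1.
  have := chart_lin1 ch hx'; rewrite e k1 scale1r (chart_lin1 ch hy').
  by move/addrI.
move=> V /open_coordP Vo VU.
exists [set y | exists w, [/\ y = ppoint w, lin l0 w = 1,
    forall i, cn (w 0 i - v 0 i) < eta & V (lin l1 w - lin l1 v)]]%classic.
  apply/rV_openP => w0 [w00 [w1 [e w11 hw1 Vw1]]].
  have w10 : w1 != 0 by apply: (@lin_neq0 _ l0); rewrite w11 oner_eq0.
  have [k k0 ew] := ppoint_eqP w00 w10 e.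
  have l0w0 : lin l0 w0 = k by rewrite ew linZ w11 mulr1.
  have [e1 e10 he1] := Vo _ Vw1; have [r1 r10 hr1] := pos_complex e10.
  have l00 : lin l0 w0 != 0 by rewrite l0w0.
  have qe l : lin l w0 / lin l0 w0 = lin l w1 by rewrite l0w0 ew linZ mulrC mulKf.
  have h2 (i : 'I_4) : exists2 x : R, 0 < x & cn (w1 0 i - v 0 i) + x <= eta.
    by exists (eta - cn (w1 0 i - v 0 i)); [rewrite subr_gt0|rewrite addrC subrK].
  have [x x0 hx] := finite_radius (P := fun i x => cn (w1 0 i - v 0 i) + x <= eta)
    (fun i d d' le_d hi => le_trans (lerD (lexx _) le_d) hi) h2.
  have m0 : 0 < Num.min x r1 by rewrite lt_min x0.
  pose ll (k : option 'I_4) := if k is Some i then coord i else l1.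
  have [dd dd0 hdd] := normalize_cont ll l00 m0.
  exists dd%:C%C; first exact: gt0_R.
  move=> w hw; have {}hw i : cn (w 0 i - w0 0 i) < dd by rewrite -norm_ltR.
  have [lw hw2] := hdd w hw.
  split; first exact: lin_neq0 lw.
  exists ((lin l0 w)^-1 *: w); split.
  + by rewrite ppoint_scale // invr_eq0.
  + by rewrite linZ mulVf.
  + move=> i; have := hw2 (Some i); rewrite /= !qe !lin_coord lt_min => /andP[h3 _].
    rewrite mxE mulrC; have := hx i.
    have := cn_triangle (w1 0 i) (w 0 i / lin l0 w) (v 0 i); lra.
  + apply: he1; rewrite hr1 linZ mulrC.
    have := hw2 None; rewrite /= qe lt_min => /andP[_].
    by rewrite opprB addrA subrK.
apply/seteqP; split=> [_ [t Vt <-]|y [[w [-> w1 hw Vw]] Xw]].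
  have tr := VU t Vt; have ts := ltW (rs t tr).
  split; last exact (chart_on Xirr ch ts).
  exists (evc a t); split=> //; first exact (chart_lin0 ch ts).
    by move=> i; rewrite mxE; apply: hd; exact: rd.
  by rewrite (chart_lin1 ch ts) addrC addKr.
have [_ ew] := hnear w Xw w1 (fun i => ltW (hw i)).
by exists (lin l1 w - lin l1 v) => //; rewrite -ew.
Qed.
End ChartLifting.

(** * Compactness *)

Section Compactness.
Import numFieldNormedType.Exports.
Local Open Scope classical_set_scope.
Variable R : realType.
Local Notation C := R[i].
Implicit Types (x y : 'rV[R]_(4 + 4)) (w : 'rV[C]_4).

(** Compactness is transferred from a real vector space of dimension 8. *)
Definition realify x : 'rV[C]_4 := \row_i (x 0 (lshift 4 i) +i* x 0 (rshift 4 i))%C.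

Lemma realifyK w : exists x, realify x = w.
Proof.
exists (row_mx (\row_i complex.Re (w 0 i)) (\row_i complex.Im (w 0 i))).
by apply/rowP => i; rewrite mxE row_mxEl row_mxEr !mxE; case: (w 0 i).
Qed.

Lemma realify_near x y (e : R) : (forall i, `|x 0 i - y 0 i| < e / 2) ->
  forall i, cn (realify x 0 i - realify y 0 i) < e.
Proof.
move=> h i; rewrite !mxE; apply: le_lt_trans (cn_ReIm _) _ => /=.
have := h (lshift 4 i); have := h (rshift 4 i); lra.
Qed.

Lemma real_rV_nbhs n (x : 'rV[R]_n.+1) (A : set 'rV[R]_n.+1) : nbhs x A <->
  exists2 d : R, 0 < d & forall y : 'rV[R]_n.+1, (forall i, `|y 0 i - x 0 i| < d) -> A y.
Proof.
split=> [/nbhs_ballP [d d0 hd]|[d d0 hd]].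
  exists d => // y hy; apply: hd; split=> // i j.
  by rewrite ord1 /ball /= distrC; exact: hy.
apply/nbhs_ballP; exists d => // y [_ hy]; apply: hd => i.
by have := hy 0 i; rewrite /ball /= distrC.
Qed.

(** A closed bounded set is compact: finitely many values of the parameter
    suffice, and monotonicity allows their maximum. *)
Lemma uniform_on_compact (K : set 'rV[C]_4) (B : R) (P : nat -> 'rV[C]_4 -> Prop) :
  (forall w, (forall e : R, 0 < e -> exists2 w', K w' & forall i, cn (w' 0 i - w 0 i) < e) -> K w) ->
  (forall w, K w -> forall i, cn (w 0 i) <= B) ->
  (forall m n w, (m <= n)%N -> P m w -> P n w) ->
  (forall y : 'rV[C]_4, K y -> exists2 r : R, 0 < r & exists m, forall w, K w ->
     (forall i, cn (w 0 i - y 0 i) < r) -> P m w) ->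
  exists m, forall w, K w -> P m w.
Proof.
move=> Kc Kb Pm Ploc; pose K' := [set x | K (realify x)].
have K'c : closed K'.
  move=> x hx; apply: Kc => e e0.
  have [|y [Ky hy]] := hx [set y | forall i, `|y 0 i - x 0 i| < e / 2].
    by apply/real_rV_nbhs; exists (e / 2) => //; lra.
  by exists (realify y) => //; exact: realify_near.
have K'b : bounded_set K'.
  exists B; split=> [|M BM x Kx]; first exact: num_real.
  have M0 : 0 <= M by apply: le_trans (le_trans (cn_ge0 _) (Kb _ Kx 0)) (ltW BM).
  rewrite /Num.Def.normr /= mx_normrE; apply: bigmax_le => // -[i j] _ /=; rewrite ord1.
  case: (split_ordP j) => k -> /=.
    have := cn_Re (realify x 0 k); rewrite mxE /= => h.
    by apply: le_trans h _; apply: le_trans (ltW BM); have := Kb _ Kx k; rewrite mxE.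
  have := cn_Im (realify x 0 k); rewrite mxE /= => h.
  by apply: le_trans h _; apply: le_trans (ltW BM); have := Kb _ Kx k; rewrite mxE.
have /compact_near_coveringP cov := bounded_closed_compact K'b K'c.
have [m _ hm] : \forall m \near \oo, K' `<=` (fun x => K (realify x) -> P m (realify x)).
  apply: (cov _ _ (fun m x => K (realify x) -> P m (realify x))) => x Kx.
  have [r r0 [m hm]] := Ploc _ Kx.
  exists ([set y : 'rV[R]_(4 + 4) | forall i, `|y 0 i - x 0 i| < r / 2], [set k | (m <= k)%N]).
    split=> /=; last by exists m.
    by apply/real_rV_nbhs; exists (r / 2) => //; lra.
  move=> [y k] /= [hy mk] Ky; apply: Pm mk _; apply: hm => //.
  exact: realify_near.
exists m => w Kw; have [x ex] := realifyK w.
by rewrite -ex; apply: hm => //=; rewrite /K' /= ex.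
Qed.
End Compactness.

(** * Inversion, reversion and the germ of the projection *)

Section Reversion.
Variable R : realType.
Local Notation C := R[i].
Implicit Types (a b d : fps C) (s r y : R).

(** A factor [X^k] makes the majorant [O(y^k)]. *)
Lemma pn_ord k s a (ha : ord_ge k a) : 0 < s -> acv s a ->
  exists2 M, 0 <= M & forall y N, 0 <= y -> y <= s -> pn y a N <= M * y ^+ k.
Proof.
move=> s0 [M hM]; have [b eb _] := ord_geP ha; have sn := ltW s0.
have M0 : 0 <= M by apply: le_trans (hM 0%N); exact: pn_ge0.
exists (M / s ^+ k); first by rewrite divr_ge0 // exprn_ge0.
move=> y N y0 ys; case: N => [|N].
  by rewrite pnE big_ord0 mulr_ge0 ?divr_ge0 ?exprn_ge0.
rewrite {1}eb; apply: le_trans (pnM _ _ _ y0) _; rewrite mulrC; apply: ler_pM; rewrite ?pn_ge0 //.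
  apply: le_trans (pn_le_radius _ _ y0 ys) _; rewrite ler_pdivlMr ?exprn_gt0 // mulrC.
  by rewrite -pn_XnM -eb.
apply: le_trans (pn_exp _ _ y0 _) _ => //.
by rewrite lerXn2r ?nnegrE ?pn_ge0 ?pnX.
Qed.

Lemma pn_small s d e : coef d 0 = 0 -> 0 < s -> acv s d -> 0 < e ->
  exists r, [/\ 0 < r, r <= s & forall N, pn r d N <= e].
Proof.
move=> d0 s0 hd e0; have [M M0 hM] := pn_ord (ord_ge1 d0) s0 hd.
have Mp : 0 < M + 1 by rewrite ltr_wpDl.
exists (Num.min s (e / (M + 1))); split; first by rewrite lt_min s0 divr_gt0.
  by rewrite ge_min lexx.
move=> N; set r := Num.min _ _.
have r0 : 0 <= r by rewrite le_min (ltW s0) divr_ge0 // ltW.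
have rs : r <= s by rewrite /r ge_min lexx.
have re : r * (M + 1) <= e by rewrite -ler_pdivlMr // /r ge_min lexx orbT.
apply: le_trans (hM r N r0 rs) _; rewrite expr1; lra.
Qed.

(** The inverse is the composite of the geometric series with [1 - b]. *)
Lemma fps_inverse b s : coef b 0 = 1 -> 0 < s -> acv s b -> exists c r,
  [/\ 0 < r, r <= s, acv r c, coef c 0 = 1 & b * c = 1].
Proof.
move=> b0 s0 hb; pose d := 1 - b; pose g : fps C := FPS (fun=> 1).
have d0 : coef d 0 = 0 by rewrite fcoefB b0 subrr.
have hd : acv s d by apply: acvB (ltW s0) _ hb; exact: (acv_const 1 (ltW s0)).
have h2 : 0 < 1 / 2 :> R by lra.
have [r [r0 rs hr]] := pn_small d0 s0 hd h2.
have hg : acv (1 / 2) g.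
  by apply: (@acv_bound _ 1 _ 1) => [||k]; [lra|lra|rewrite cn1 mul1r expr1n].
exists (fps_comp g d), r; split=> //; first exact: acv_comp (ltW r0) hr hg.
  by rewrite coef_comp0.
have eg : (1 - fpsX C) * g = 1.
  apply: fpsP => n; rewrite mulrBl mul1r fcoefB coef_XM fcoef1.
  by case: n => [|n] /=; rewrite ?subr0 ?subrr.
have eb : b = fps_comp (1 - fpsX C) d.
  have -> : 1 - fpsX C = fps_const 1 + fps_const (-1) * fpsX C.
    by rewrite rmorph1 rmorphN1 mulN1r.
  rewrite fps_compD fps_compM // !fps_comp_const fps_compX // rmorphN1 mulN1r.
  by rewrite rmorph1 /d opprB addrC subrK.
by rewrite {1}eb -fps_compM // eg (fps_comp_const 1).
Qed.

Lemma comp_cong k f a b : coef a 0 = 0 -> coef b 0 = 0 -> ord_ge k (a - b) ->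
  ord_ge k (fps_comp f a - fps_comp f b).
Proof.
move=> a0 b0 hab n lt_nk; rewrite fcoefB -sumrB big1 // => m _.
rewrite -mulrBr -fcoefB subrXX; set S := \sum_(_ < _) _.
by rewrite (mulrC (a - b)) (ord_geMl _ hab) ?mulr0.
Qed.

Lemma sqr_mul_diff (K : comNzRingType) (x y c c' : K) :
  x ^+ 2 * c - y ^+ 2 * c' = x * (x * (c - c')) + (x + y) * ((x - y) * c').
Proof. by ring. Qed.

(** The compositional inverse of [e = X + d] is the fixed point of
    [t |-> X - d(t)]. *)
Lemma reversion e s : coef e 0 = 0 -> coef e 1 = 1 -> 0 < s -> acv s e -> exists tau r,
  [/\ 0 < r, forall N, pn r tau N <= s, coef tau 0 = 0, coef tau 1 = 1 &
      fps_comp e tau = fpsX C].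
Proof.
move=> e0 e1 s0 he; pose d := e - fpsX C.
have d2 : ord_ge 2 d.
  by move=> [|[|//]] _; rewrite fcoefB ?e0 ?e1 /= subrr.
have hd : acv s d by apply: acvB (ltW s0) he (acvX (ltW s0)).
have [M M0 hM] := pn_ord d2 s0 hd.
have [d' ed _] := ord_geP d2.
pose T (a : unit -> fps C) (i : unit) := fpsX C - fps_comp d (a i).
have ord10 (a : fps C) : ord_ge 1 a -> coef a 0 = 0 by move=> h; exact: h.
have dcomp a : coef a 0 = 0 -> fps_comp d a = a ^+ 2 * fps_comp d' a.
  by move=> a0; rewrite ed fps_compM // expr2 fps_compM // fps_compX.
have T1 (a : unit -> fps C) : (forall i, ord_ge 1 (a i)) -> forall i, ord_ge 1 (T a i).
  move=> a1 i; apply: ord_ge1; by rewrite fcoefB coef_comp0 (d2 0%N) // subr0.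
have Tord k (a b : unit -> fps C) : (forall i, ord_ge 1 (a i)) -> (forall i, ord_ge 1 (b i)) ->
     (forall i, ord_ge k (a i - b i)) -> forall i, ord_ge k.+1 (T a i - T b i).
  move=> a1 b1 hab i; have a0 := ord10 _ (a1 i); have b0 := ord10 _ (b1 i).
  have -> : T a i - T b i = - (fps_comp d (a i) - fps_comp d (b i))  by exact: sub_sub_opp.
  apply: ord_geN; rewrite !dcomp //.
  set c := fps_comp d' (a i); set c' := fps_comp d' (b i).
  rewrite sqr_mul_diff.
  rewrite -add1n; apply: ord_geD.
    by apply: ord_geM => //; apply: ord_geMl; apply: comp_cong.
  apply: ord_geM; first exact: ord_geD.
  by rewrite mulrC; apply: ord_geMl.
have Tn r N (a : unit -> fps C) y : 0 <= r -> r <= 1 -> y <= s -> (forall i, pn r (a i) N <= y) ->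
     forall i, pn r (T a i) N <= (1 + M) * (r + y ^+ 2).
  move=> r0 r1 ys ha i; have y0 : 0 <= y by apply: le_trans (ha tt); exact: pn_ge0.
  apply: le_trans (pnB _ _ _ r0) _; apply: add_le_mul_add; rewrite ?sqr_ge0 ?ler01 //.
    by rewrite mul1r pnX.
  by apply: le_trans (pn_comp _ r0 (ha i)) _; apply: hM.
have M10 : 0 <= 1 + M by rewrite addr_ge0.
have [t [r [r0 _ Tt t1 tn]]] := fps_fixpoint M10 s0 T1 Tord Tn.
exists (t tt), r; have t0 := ord10 _ (t1 tt); split=> //.
  have h1 : coef (fps_comp d (t tt)) 1 = 0.
    by rewrite dcomp // mulrC; apply: (@ord_geMl _ 2) => //; apply: ord_ge_exp; exact: t1.
  transitivity (coef (T t tt) 1); first by rewrite Tt.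
  by rewrite /T fcoefB h1 subr0.
have -> : e = d + fpsX C by rewrite /d subrK.
rewrite fps_compD fps_compX //; have := Tt tt; rewrite {1}/T => h.
by rewrite -[X in _ + X]h addrC subrK.
Qed.
End Reversion.

Section Germ.
Variable R : realType.
Local Notation C := R[i].
Variable X : set (projspace C 3).
Variable xi : 'I_4 -> 'I_4 -> C.

(** A section near [0] of the projection [xi0 / xi1], with [u = xi0 / xi1] as
    parameter and homogeneous coordinates [(u^3, u^2, p, q)]. *)
Record section_germ (P : 'I_4 -> fps C) (s : R) : Prop := SectionGerm {
  germ_gt0 : 0 < s;
  germ_acv : forall i, acv s (P i);
  germ_forms : forall F, vanishing_forms X F -> pl P F = 0;
  germ_xi0 : pl P (linp (xi o0)) = fpsX C ^+ 3;
  germ_xi1 : pl P (linp (xi o1)) = fpsX C ^+ 2;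
  germ_xi2 : coef (pl P (linp (xi o2))) 0 = 0 /\ coef (pl P (linp (xi o2))) 1 = 1;
  germ_xi3 : coef (pl P (linp (xi o3))) 0 = 1 }.

Lemma cube_mul (K : comNzRingType) (t A : K) : t ^+ 3 * A = t ^+ 2 * (t * A).
Proof. by ring. Qed.
Lemma mul_reorder (K : comNzRingType) (x2 t2 x b : K) :
  x2 * t2 * (x * b) = x * (x2 * (t2 * b)).
Proof. by ring. Qed.

Lemma coef_comp1 (K : comNzRingType) (a b : fps K) :
  coef (fps_comp a b) 1 = coef a 1 * coef b 1.
Proof.
have -> : coef (fps_comp a b) 1 = \sum_(k < 2) coef a k * coef (b ^+ k) 1 by [].
by rewrite big_ord_recl big_ord1 expr0 fcoef1 mulr0 add0r lift0 expr1.
Qed.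

Lemma mul_cancel (K : comNzRingType) (d x x2 c : K) : d * (x * (x2 * c)) = x * x2 * (c * d).
Proof. by ring. Qed.

(** The coordinates [xi] put the arc in the form [(t^3, t^2, t, 1)] up to higher
    order; reverting [u = xi0 / xi1 = t + O(t^2)] turns [u] into the parameter. *)
Lemma exists_germ (a : 'I_4 -> fps C) (s : R) : 0 < s -> (forall i, acv s (a i)) ->
  (forall F, vanishing_forms X F -> pl a F = 0) ->
  (forall (j : 'I_4) k, (k < 4)%N -> coef (pl a (linp (xi j))) k = (j + k == 3)%N%:R) ->
  exists P r, section_germ P r.
Proof.
move=> s0 ha aX hxi; have sn := ltW s0; pose al j := pl a (linp (xi j)).
have hal j : acv s (al j) by apply: pl_acv.
have al_ord (j : 'I_4) k : (k < 4)%N -> (j + k <= 3)%N -> ord_ge k (al j).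
  move=> k4 jk m mk; rewrite /al hxi ?(ltn_trans mk) //.
  by case: eqP => // e; exfalso; move: mk jk e; clear; lia.
have [A eA A0] := ord_geP (al_ord o0 3 isT isT).
have [B eB B0] := ord_geP (al_ord o1 2 isT isT).
rewrite /al hxi //= in A0; rewrite /al hxi //= in B0.
have hA : acv s A by apply: (@acv_divX _ _ 3) => //; rewrite -eA.
have hB : acv s B by apply: (@acv_divX _ _ 2) => //; rewrite -eB.
have [iB [s1 [s10 s1s hiB iB0 BiB]]] := fps_inverse B0 s0 hB.
have s1n := ltW s10; have acv1 c : acv s c -> acv s1 c by exact: acv_le.
pose e := fpsX C * (A * iB).
have he : acv s1 e.
  exact: acvM s1n (acvX s1n) (acvM s1n (acv1 _ hA) hiB).
have e0 : coef e 0 = 0 by rewrite coef_XM.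
have e1 : coef e 1 = 1 by rewrite coef_XM fcoefM0 A0 iB0 mulr1.
have [tau [s2 [s20 htau tau0 tau1 etau]]] := reversion e0 e1 s10 he.
have s2n := ltW s20; have acv_tau c : acv s c -> acv s2 (fps_comp c tau).
  by move=> hc; apply: acv_comp s2n htau (acv1 _ hc).
pose W i := fps_comp (a i) tau.
have hW i : acv s2 (W i) := acv_tau _ (ha i).
have plW F : pl W F = fps_comp (pl a F) tau by rewrite pl_comp.
pose A' := fps_comp A tau; pose B' := fps_comp B tau.
(* after the substitution [t = tau], the ratio [xi0 / xi1 = tau A' / B'] is [X] *)
have uB : fpsX C * B' = tau * A'.
  have h : e * B = fpsX C * A by rewrite /e -!mulrA (mulrC iB) BiB mulr1.
  have := congr1 (fun c => fps_comp c tau) h.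
  by rewrite (fps_compM e B tau0) (fps_compM _ A tau0) etau fps_compX.
have comp_Xn k (b : fps C) : fps_comp (fpsX C ^+ k * b) tau = tau ^+ k * fps_comp b tau.
  rewrite fps_compM //; congr (_ * _); elim: k => [|k IH]; first exact: (fps_comp_const 1).
  by rewrite !exprS fps_compM // IH fps_compX.
have [tau' etau' tau'0] := ord_geP (ord_ge1 tau0).
rewrite tau1 in tau'0; have htau' : acv s2 tau' by apply: (@acv_divX _ _ 1) => //; rewrite -etau'; exists s1.
rewrite expr1 in etau'.
(* in the new parameter [xi1 = X^2 c] and [xi0 = X^3 c], so [c] is divided out *)
pose c := tau' ^+ 2 * B'.
have xi1W : pl W (linp (xi o1)) = fpsX C ^+ 2 * c.
  by rewrite plW -/(al o1) eB comp_Xn -/B' {1}etau' exprMn -mulrA.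
have xi0W : pl W (linp (xi o0)) = fpsX C * (fpsX C ^+ 2 * c).
  rewrite plW -/(al o0) eA comp_Xn -/A' cube_mul -uB {1}etau' exprMn; exact: mul_reorder.
have B'0 : coef B' 0 = 1 by rewrite coef_comp0.
have c0 : coef c 0 = 1 by rewrite fcoefM0 B'0 mulr1 expr2 fcoefM0 tau'0 mulr1.
have hc : acv s2 c by apply: acvM (acvXn 2 s2n htau') (acv_tau _ hB).
have [ic [s3 [s30 s32 hic ic0 cic]]] := fps_inverse c0 s20 hc.
have s3n := ltW s30.
pose P i := ic * W i.
have plP F d : F \is mpoly.ishomog1 d mpoly.mdeg -> pl P F = ic ^+ d * pl W F.
  exact: pl_homog.
have plP1 l : pl P (linp l) = ic * pl W (linp l).
  by rewrite (plP _ _ (homog_linp l)) expr1.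
exists P, s3; split=> //.
- by move=> i; apply: acvM => //; exact: acv_le s3n s32 (hW i).
- move=> F FX; have [[d hd] _] := FX; rewrite (plP _ _ hd) plW aX //.
  by rewrite -(rmorph0 (@fps_const C)) fps_comp_const rmorph0 mulr0.
- by rewrite plP1 xi0W mul_cancel cic mulr1 -exprS.
- by rewrite plP1 xi1W mulrCA (mulrC ic) cic mulr1.
- have w0 : coef (pl W (linp (xi o2))) 0 = 0 by rewrite plW coef_comp0 hxi.
  rewrite plP1 fcoefM0 fcoefM1 w0 ic0 !mulr0 addr0 mul1r; split=> //.
  by rewrite plW coef_comp1 hxi // tau1 mulr1.
- by rewrite plP1 fcoefM0 ic0 mul1r plW coef_comp0 hxi.
Qed.
End Germ.

(** * Analytic continuation of the section *)

Section Continuation.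
Variable R : realType.
Local Notation C := R[i].
Variable X : set (projspace C 3).
Hypothesis Xirr : irreducible_closed X.
Variable xi : 'I_4 -> 'I_4 -> C.
Local Notation xi_ j := (lin (xi j)).
Implicit Types (v w y : 'rV[C]_4) (t u : C).

Let cone w := w != 0 /\ X (ppoint w).

(** Near its base point the curve is tangent to the plane [xi0 = 0]. *)
Hypothesis near_base : forall (e : R) y, 0 < e -> cone y -> xi_ o0 y = 0 -> xi_ o1 y = 0 ->
  exists2 r : R, 0 < r & forall w, cone w -> (forall i, cn (w 0 i - y 0 i) < r) ->
    cn (xi_ o0 w) <= e * cn (xi_ o1 w).
(** Away from the base point, [xi0 / xi1] is a local parameter. *)
Hypothesis u_chart : forall v, X (ppoint v) -> xi_ o1 v = 1 ->
  exists a s, chart X (xi o1) (xi o0) v a s.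

Lemma cone_compact (P : nat -> 'rV[C]_4 -> Prop) :
  (forall m n w, (m <= n)%N -> P m w -> P n w) ->
  (forall y, cone y -> exists2 r : R, 0 < r & exists m, forall w, cone w ->
     (forall i, cn (w 0 i - y 0 i) < r) -> P m w) ->
  exists m, forall w, cone w -> vn (w 0) = 1 -> P m w.
Proof.
move=> Pm Ploc; pose K : set 'rV[C]_4 := [set w | cone w /\ vn (w 0) = 1]%classic.
have [m hm] : exists m, forall w, K w -> P m w.
  apply: (@uniform_on_compact _ K 1 P) => //.
  - move=> w hw.
    have w1 : vn (w 0) = 1.
      have near1 (e : R) : 0 < e -> `|vn (w 0) - 1| <= 4 * e.
        move=> e0; have [w' [_ w'1] h] := hw e e0.
        rewrite -[X in _ - X]w'1 /vn -sumrB; apply: le_trans (ler_norm_sum _ _ _) _.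
        have -> : 4 * e = \sum_(i < 4) e by rewrite sumr_const card_ord mulr_natl.
        apply: ler_sum => i _; have := h i; rewrite ler_norml => hi.
        have := cn_triangle (w' 0 i) (w 0 i) 0; have := cn_triangle (w 0 i) (w' 0 i) 0.
        rewrite !subr0 (cn_distC (w 0 i)); move=> *; apply/andP; split; lra.
      apply/eqP; rewrite -subr_eq0 -normr_le0; apply: le_small => e e0.
      by have := near1 (e / 4); lra.
    have w0 : w != 0.
      apply/eqP => w0; move: w1; rewrite w0 /vn big1 => [/eqP|i _]; last by rewrite mxE cn0.
      by rewrite eq_sym oner_eq0.
    split=> //; split=> //; have [Xc _ _] := Xirr; apply: zariski_closedP => // F FX.
    apply/eqP; rewrite -cn_eq0 eq_le cn_ge0 andbT; apply: le_small => e e0.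
    have [d d0 hd] := poly_cont F (w 0) e0; have [w' [[w'0 Xw'] _] h] := hw d d0.
    have := hd (w' 0) (fun i => ltW (h i)); rewrite (mev_vanishing FX w'0 Xw') sub0r cnN.
    by rewrite add0r => /ltW.
  - by move=> w [_ w1] i; have := cn_le_vn (w 0) i; rewrite w1.
  - move=> y [cy _]; have [r r0 [m hm]] := Ploc y cy.
    by exists r => //; exists m => w [cw _]; exact: hm.
by exists m => w cw w1; apply: hm.
Qed.

Lemma coneZ (k : C) w : k != 0 -> cone w -> cone (k *: w).
Proof. by move=> k0 [w0 Xw]; split; rewrite ?scaler_eq0 ?negb_or ?k0 // ppoint_scale. Qed.

Lemma cone_unit w : cone w -> exists2 k : C, k != 0 & vn ((k *: w) 0) = 1.
Proof.
move=> [w0 _]; have vw : 0 < vn (w 0).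
  rewrite lt_def vn_ge0 andbT; apply: contra w0 => /eqP h.
  apply/eqP/rowP => i; rewrite mxE; apply: (@vn_eq0 _ _ (w 0)); by rewrite h.
exists (vn (w 0))^-1%:C%C.
  by rewrite -cn_gt0 cn_real normr_gt0 invr_eq0 gt_eqF.
have -> : vn (((vn (w 0))^-1%:C%C *: w) 0) = (vn (w 0))^-1 * vn (w 0).
  rewrite {1 3}/vn mulr_sumr; apply: eq_bigr => i _.
  by rewrite mxE cnM cn_real ger0_norm // invr_ge0 ltW.
by rewrite mulVf // gt_eqF.
Qed.

(** A property of points of the projective curve need only be checked locally,
    on representatives of norm 1. *)
Lemma cone_uniform (P : nat -> 'rV[C]_4 -> Prop) :
  (forall m n w, (m <= n)%N -> P m w -> P n w) ->
  (forall m (k : C) w, k != 0 -> P m (k *: w) -> P m w) ->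
  (forall y, cone y -> exists2 r : R, 0 < r & exists m, forall w, cone w ->
     (forall i, cn (w 0 i - y 0 i) < r) -> P m w) ->
  exists m, forall w, cone w -> P m w.
Proof.
move=> Pm PZ Ploc; have [m hm] := cone_compact Pm Ploc; exists m => w cw.
have [k k0 hk] := cone_unit cw; apply: (PZ m k) => //; apply: hm => //.
exact: coneZ.
Qed.

Lemma lin_cont2 l l' w0 (e : R) : 0 < e -> exists2 d : R, 0 < d & forall w,
  (forall i, cn (w 0 i - w0 0 i) < d) ->
  cn (lin l w - lin l w0) < e /\ cn (lin l' w - lin l' w0) < e.
Proof.
move=> e0; have [d d0 hd] := lin_cont l w0 e0; have [d' d'0 hd'] := lin_cont l' w0 e0.
exists (Num.min d d'); first by rewrite lt_min d0.
move=> w hw; split; [apply: hd|apply: hd'] => i; apply: lt_le_trans (hw i) _.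
  by rewrite ge_min lexx.
by rewrite ge_min lexx orbT.
Qed.

(** Locally either the two hypotheses on [w] exclude each other, as they do near
    the base point by [near_base], or [xi0] is bounded away from 0. *)
Lemma growth_bound l : exists m : nat, forall w, cone w -> xi_ o0 w != 0 ->
  cn (xi_ o1 w) <= cn (xi_ o0 w) -> cn (lin l w) <= m%:R * cn (xi_ o0 w).
Proof.
apply: (@cone_uniform (fun m w => xi_ o0 w != 0 ->
  cn (xi_ o1 w) <= cn (xi_ o0 w) -> cn (lin l w) <= m%:R * cn (xi_ o0 w))).
- move=> m n w le_mn h h0 h1; apply: le_trans (h h0 h1) _.
  by rewrite ler_wpM2r ?cn_ge0 // ler_nat.
- move=> m k w k0; rewrite !linZ !cnM => h h0 h1.
  have ck : 0 < cn k by rewrite cn_gt0.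
  have := h (mulf_neq0 k0 h0); rewrite !ler_pM2l // mulrCA ler_pM2l //; exact.
move=> y cy; have [y0|y0] := eqVneq (xi_ o0 y) 0.
  have [y1|y1] := eqVneq (xi_ o1 y) 0.
    have h2 : 0 < 1 / 2 :> R by lra.
    have [r r0 hr] := near_base h2 cy y0 y1; exists r => //; exists 0%N => w cw hw w0 h1.
    have := hr w cw hw; have : 0 < cn (xi_ o0 w) by rewrite cn_gt0.
    lra.
  have c1 : 0 < cn (xi_ o1 y) / 2 by rewrite divr_gt0 // cn_gt0.
  have [d d0 hd] := lin_cont2 (xi o0) (xi o1) y c1; exists d => //; exists 0%N => w cw hw _ h1.
  have [] := hd w hw; rewrite y0 subr0 => h2 h3.
  have := cn_triangle (xi_ o1 w) (xi_ o1 y) 0; rewrite !subr0 cn_distC; lra.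
have c0 : 0 < cn (xi_ o0 y) / 2 by rewrite divr_gt0 // cn_gt0.
have [d d0 hd] := lin_cont2 (xi o0) l y c0; exists d => //.
pose q := (cn (lin l y) + cn (xi_ o0 y) / 2) / (cn (xi_ o0 y) / 2).
have [m qm] : exists m : nat, q <= m%:R.
  by exists (Num.truncn q).+1; apply/ltW/truncnS_gt.
exists m => w cw hw _ _.
have [h2 h3] := hd w hw.
have e1 : cn (xi_ o0 y) / 2 <= cn (xi_ o0 w).
  have := cn_triangle (xi_ o0 w) (xi_ o0 y) 0; rewrite !subr0 cn_distC; lra.
have e2 : cn (lin l w) <= cn (lin l y) + cn (xi_ o0 y) / 2.
  have := cn_triangle (lin l y) (lin l w) 0; rewrite !subr0; lra.
apply: le_trans e2 _; rewrite -[leLHS](@divfK _ (cn (xi_ o0 y) / 2)) ?gt_eqF // -/q.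
apply: ler_pM => //; first by rewrite divr_ge0 ?addr_ge0 ?cn_ge0 // ltW.
exact: ltW.
Qed.

(** A chart with parameter [xi0 / xi1] whose radius and size are controlled by a
    single integer, as required by the compactness argument. *)
Definition good_chart (m : nat) v := exists a : 'I_4 -> fps C,
  (forall k N, pn m.+1%:R^-1 (a k) N <= m.+1%:R) /\
  exists2 eta : R, 0 < eta & forall w, X (ppoint w) -> xi_ o1 w = 1 ->
    (forall k, cn (w 0 k - v 0 k) <= eta) -> w = evc a (xi_ o0 w - xi_ o0 v).

Lemma good_chart_le m n v : (m <= n)%N -> good_chart m v -> good_chart n v.
Proof.
move=> le_mn [a [ha h]]; exists a; split=> // k N.
apply: (@le_trans _ _ m.+1%:R); last by rewrite ler_nat ltnS.
apply: le_trans (ha k N); apply: pn_le_radius; first by rewrite invr_ge0.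
by rewrite lef_pV2 ?posrE ?ltr0n // ler_nat ltnS.
Qed.

(** Recentring a chart at [v0] gives charts at all nearby points. *)
Lemma good_chart_near v0 : X (ppoint v0) -> xi_ o1 v0 = 1 ->
  exists2 r : R, 0 < r & exists m, forall v, X (ppoint v) -> xi_ o1 v = 1 ->
    (forall k, cn (v 0 k - v0 0 k) < r) -> good_chart m v.
Proof.
move=> Xv0 v01; have [a [s ch]] := u_chart Xv0 v01.
have s0 := chart_gt0 ch; have s2 : 0 < s / 2 by lra.
have [eta eta0 hnear] := chart_near ch.
have /choice [M hM] : forall k, exists M, forall N, pn s (a k) N <= M by exact: (chart_acv ch).
have [d d0 hd] := lin_cont (xi o0) v0 s2.
exists (Num.min d (eta / 2)); first by rewrite lt_min d0 /=; lra.
have [m hm1 hm2] : exists2 m : nat, m.+1%:R^-1 <= s / 2 & \sum_k `|M k| <= m.+1%:R.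
  pose q := Num.max (2 / s) (\sum_k `|M k|).
  have qm : q <= (Num.truncn q).+1%:R by apply/ltW/truncnS_gt.
  exists (Num.truncn q); last by apply: le_trans qm; rewrite le_max lexx orbT.
  rewrite -[s / 2]invrK lef_pV2 ?posrE ?invr_gt0 // invf_div.
  by apply: le_trans qm; rewrite le_max lexx.
exists m => v Xv v1 hv.
pose t := xi_ o0 v - xi_ o0 v0.
have ts : cn t <= s / 2.
  by apply/ltW/hd => k; apply: lt_le_trans (hv k) _; rewrite ge_min lexx.
have hveta k : cn (v 0 k - v0 0 k) < eta / 2.
  by apply: lt_le_trans (hv k) _; rewrite ge_min lexx orbT.
have prs : s / 2 + s / 2 <= s by lra.
have sn2 := ltW s2.
exists (fun k => recenter (a k) t); split=> [k N|].
  apply: (@le_trans _ _ (pn (s / 2) (recenter (a k) t) N)).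
    by apply: pn_le_radius; rewrite ?invr_ge0.
  apply: le_trans (recenter_pn sn2 s2 prs ts (hM k) N) _.
  apply: le_trans hm2; apply: le_trans (ler_norm _) _.
  by rewrite (bigD1 k) //= lerDl sumr_ge0.
have [d' d'0 hd'] := lin_cont (xi o0) v s2.
exists (Num.min (d' / 2) (eta / 2)); first by rewrite lt_min; apply/andP; split; lra.
move=> w Xw w1 hw.
have hwd k : cn (w 0 k - v 0 k) < d'.
  by have := hw k; rewrite le_min => /andP[? _]; lra.
have hwe k : cn (w 0 k - v0 0 k) <= eta.
  have := hw k; rewrite le_min => /andP[_ ?].
  have := cn_triangle (v 0 k) (w 0 k) (v0 0 k); have := hveta k; lra.
have [_ ew] := hnear w Xw w1 hwe; rewrite [LHS]ew.
have hs : cn (xi_ o0 w - xi_ o0 v) <= s / 2 by apply/ltW/hd'.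
apply/rowP => k; rewrite !mxE (recenter_ev sn2 s2 prs ts hs (chart_acv ch k)).
by congr ev; rewrite /t [RHS]addrC subrKA.
Qed.

(** The bounds on [u = xi0 / xi1] keep away from the base point, by [near_base],
    and from the points where [xi1] alone vanishes. *)
Lemma uniform_charts (rho1 rho2 : R) : 0 < rho1 -> 0 < rho2 -> exists m, forall v, X (ppoint v) ->
  xi_ o1 v = 1 -> rho1 <= cn (xi_ o0 v) -> cn (xi_ o0 v) <= rho2 -> good_chart m v.
Proof.
move=> p1 p2.
have [m hm] : exists m, forall w, cone w -> xi_ o1 w != 0 ->
    rho1 * cn (xi_ o1 w) <= cn (xi_ o0 w) -> cn (xi_ o0 w) <= rho2 * cn (xi_ o1 w) ->
    good_chart m ((xi_ o1 w)^-1 *: w).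
  apply: (@cone_uniform (fun m w => xi_ o1 w != 0 ->
    rho1 * cn (xi_ o1 w) <= cn (xi_ o0 w) -> cn (xi_ o0 w) <= rho2 * cn (xi_ o1 w) ->
    good_chart m ((xi_ o1 w)^-1 *: w))).
  - by move=> m n w le_mn h h0 h1 h2; apply: good_chart_le le_mn (h h0 h1 h2).
  - move=> m k w k0; rewrite !linZ !cnM => h h0 h1 h2.
    have ck : 0 < cn k by rewrite cn_gt0.
    have := h (mulf_neq0 k0 h0); rewrite !(mulrCA _ (cn k)) !ler_pM2l // => /(_ h1 h2).
    by rewrite scalerA invfM mulrAC mulVf // mul1r.
  move=> y cy; have [y1|y1] := eqVneq (xi_ o1 y) 0; last first.
    have Xv0 : X (ppoint ((xi_ o1 y)^-1 *: y)) by rewrite ppoint_scale ?invr_eq0 //; case: cy.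
    have v01 : xi_ o1 ((xi_ o1 y)^-1 *: y) = 1 by rewrite linZ mulVf.
    have [r r0 [m hm]] := good_chart_near Xv0 v01.
    have [d d0 hd] := normalize_cont (coord R) y1 r0.
    exists d => //; exists m => w [w0 Xw] hw w1 _ _; apply: hm.
    + by rewrite ppoint_scale ?invr_eq0.
    + by rewrite linZ mulVf.
    + move=> k; have [_ /(_ k)] := hd w hw; rewrite !lin_coord !mxE.
      by rewrite !(mulrC (_^-1)).
  have [y0|y0] := eqVneq (xi_ o0 y) 0.
    have h2 : 0 < rho1 / 2 by lra.
    have [r r0 hr] := near_base h2 cy y0 y1; exists r => //; exists 0%N => w cw hw w1 h1 _.
    have := hr w cw hw; have : 0 < cn (xi_ o1 w) by rewrite cn_gt0.
    move: (cn (xi_ o1 w)) (cn (xi_ o0 w)) h1 => A B h1 A0 h3; exfalso; nra.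
  have c0 : 0 < cn (xi_ o0 y) by rewrite cn_gt0.
  have c1 : 0 < cn (xi_ o0 y) / (2 * (1 + rho2)) by rewrite divr_gt0 // mulr_gt0 // addr_gt0.
  have [d d0 hd] := lin_cont2 (xi o0) (xi o1) y c1; exists d => //; exists 0%N => w cw hw _ _ h2.
  have [] := hd w hw; rewrite y1 subr0.
  have := cn_triangle (xi_ o0 w) (xi_ o0 y) 0; rewrite !subr0 (cn_distC (xi_ o0 y)).
  rewrite !ltr_pdivlMr ?mulr_gt0 ?addr_gt0 //.
  move: (cn (xi_ o0 w - xi_ o0 y)) (cn (xi_ o0 w)) (cn (xi_ o0 y)) (cn (xi_ o1 w)) (cn_ge0 (xi_ o0 w - xi_ o0 y)) c0 h2.
  move=> D A Y B D0 Y0 h2 h3 h4 h5; exfalso; nra.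
exists m => v Xv v1 h1 h2; have v0 : v != 0 by apply: (@lin_neq0 _ (xi o1)); rewrite v1 oner_eq0.
have := hm v (conj v0 Xv); rewrite v1 cn1 !mulr1 invr1 scale1r oner_eq0; exact.
Qed.

Lemma ev_Xn (s : R) k u : 0 <= s -> cn u <= s -> ev (fpsX C ^+ k) u = u ^+ k.
Proof.
move=> s0 us; elim: k => [|k IH]; first exact: (@ev_const _ 1).
by rewrite !exprS (evM s0 us (acvX s0) (acvXn k s0 (acvX s0))) evX IH.
Qed.

Section EntireGerm.
Variables (P : 'I_4 -> fps C) (s0 : R).
Hypothesis g : section_germ X xi P s0.

Lemma germ_lin (s : R) l u : 0 <= s -> (forall i, acv s (P i)) -> cn u <= s ->
  lin l (evc P u) = ev (pl P (linp l)) u.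
Proof. by move=> sn hP us; rewrite -mev_linp (mev_evc _ sn hP us). Qed.

Lemma germ_cone (s : R) u : 0 <= s -> (forall i, acv s (P i)) -> cn u <= s -> u != 0 ->
  [/\ cone (evc P u), xi_ o0 (evc P u) = u ^+ 3 & xi_ o1 (evc P u) = u ^+ 2].
Proof.
move=> sn hP us u0.
have e0 : xi_ o0 (evc P u) = u ^+ 3.
  by rewrite (germ_lin _ sn hP us) (germ_xi0 g) (ev_Xn _ sn us).
have e1 : xi_ o1 (evc P u) = u ^+ 2.
  by rewrite (germ_lin _ sn hP us) (germ_xi1 g) (ev_Xn _ sn us).
have w0 : evc P u != 0 by apply: (@lin_neq0 _ (xi o1)); rewrite e1 expf_neq0.
split=> //; split=> //; have [Xc _ _] := Xirr; apply: zariski_closedP => // F FX.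
rewrite (mev_evc _ sn hP us) (germ_forms g FX).
by rewrite ev0.
Qed.

Definition section_point u w := [/\ X (ppoint w), xi_ o1 w = 1, xi_ o0 w = u &
  forall k, w 0 k = ev (P k) u / u ^+ 2].

Lemma exists_section_point (s : R) u : 0 <= s -> (forall i, acv s (P i)) -> cn u <= s -> u != 0 ->
  exists w, section_point u w.
Proof.
move=> sn hP us u0; have [[w0 Xw] e0 e1] := germ_cone sn hP us u0.
have u2 : u ^+ 2 != 0 by rewrite expf_neq0.
exists ((u ^+ 2)^-1 *: evc P u); split.
- by rewrite ppoint_scale // invr_eq0.
- by rewrite linZ e1 mulVf.
- by rewrite linZ e0 [_ ^+ 3]exprSr mulKf.
- by move=> k; rewrite !mxE mulrC.
Qed.

(** Taylor coefficients at a point [u1] of the disc of convergence are bounded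
    in terms of the chart at that point, by the identity theorem. *)
Lemma taylor_bound (s q rho2 : R) (m : nat) u1 v : 0 < q -> cn u1 + q <= s -> u1 != 0 ->
  cn u1 <= rho2 -> (forall i, acv s (P i)) -> section_point u1 v -> good_chart m v ->
  forall i k, cn (coef (recenter (P i) u1) k) * m.+1%:R^-1 ^+ k <= (rho2 + 1) ^+ 2 * m.+1%:R.
Proof.
move=> q0 qs u10 up hP [_ _ v0 hv] [a [ha [eta eta0 hnear]]].
have p0 := cn_ge0 u1; have qn := ltW q0.
have s0' : 0 <= s by apply: le_trans qs; rewrite addr_ge0.
have u1s : cn u1 <= s by lra.
have u12 : u1 ^+ 2 != 0 by rewrite expf_neq0.
pose eps : R := m.+1%:R^-1.
have eps0 : 0 < eps by rewrite invr_gt0.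
have eps1 : eps <= 1 by rewrite invf_le1 // ler1n.
pose c i := (fps_const u1 + fpsX C) ^+ 2 * a i.
have hac i : acv eps (a i) by exists m.+1%:R; exact: ha.
have epsn := ltW eps0.
have hux : acv eps (fps_const u1 + fpsX C) := acvD epsn (acv_const _ epsn) (acvX epsn).
have hc i : acv eps (c i) := acvM epsn (acvXn 2 epsn hux) (hac i).
have hb i : acv q (recenter (P i) u1) := acv_recenter p0 q0 qs (lexx _) (hP i).
(* near [u1] the section lies in the domain of the chart *)
have e20 : 0 < eta * cn (u1 ^+ 2) / 2 by rewrite divr_gt0 // mulr_gt0 // cn_gt0.
have near_u1 : exists2 d : R, 0 < d & forall h, cn h < d -> cn h <= q ->
    u1 + h != 0 /\ forall i, cn (ev (P i) (u1 + h) / (u1 + h) ^+ 2 - v 0 i) <= eta.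
  have h1 (i : 'I_4) : exists2 d : R, 0 < d & forall h, cn h < d -> cn h <= q ->
      u1 + h != 0 /\ cn (ev (P i) (u1 + h) / (u1 + h) ^+ 2 - v 0 i) <= eta.
    have [d d0 hd] := quot_cont (ev (P i) u1) u12 eta0.
    have [M M0 hM] := ev_near0 q0 (hb i); have Mp : 0 < M + 1 by rewrite ltr_wpDl.
    pose B := 2 * cn u1 + 1; have B0 : 0 < B by rewrite /B; lra.
    have cu : 0 < cn u1 by rewrite cn_gt0.
    exists (Num.min (Num.min 1 (cn u1)) (Num.min (d / (M + 1)) (d / B))).
      by rewrite !lt_min ltr01 cu !divr_gt0.
    move=> h; rewrite !lt_min !ltr_pdivlMr // => /andP[/andP[h1 hu] /andP[hM1 hB1]] hq.
    have hne : u1 + h != 0.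
      apply: contraTneq hu => /eqP; rewrite addr_eq0 => /eqP ->.
      by rewrite cnN ltxx.
    split=> //.
    rewrite hv.
    have [|| _ h3] := hd (ev (P i) (u1 + h)) ((u1 + h) ^+ 2); last exact: ltW.
      rewrite -(recenter_ev p0 q0 qs (lexx _) hq (hP i)).
      have c00 : coef (recenter (P i) u1) 0 = ev (P i) u1.
        rewrite -(ev_at0 q0 (hb i)) (recenter_ev p0 q0 qs (lexx _) _ (hP i)) ?addr0 //.
        by rewrite cn0.
      rewrite -c00; apply: le_lt_trans (hM h hq) _; apply: le_lt_trans hM1.
      by rewrite mulrC ler_wpM2l ?cn_ge0 // lerDl.
    have -> : (u1 + h) ^+ 2 - u1 ^+ 2 = h * (2 * u1 + h) by ring.
    rewrite cnM; apply: le_lt_trans hB1; apply: ler_wpM2l; first exact: cn_ge0.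
    by have := cnD (2 * u1) h; rewrite cnM (cn_nat _ 2) /B; lra.
  have [d d0 hd] := finite_radius (P := fun i d => forall h, cn h < d -> cn h <= q ->
      u1 + h != 0 /\ cn (ev (P i) (u1 + h) / (u1 + h) ^+ 2 - v 0 i) <= eta)
    (fun i d d' le_d hi h hd' => hi h (lt_le_trans hd' le_d)) h1.
  exists d => // h hh hq; split; first by have [] := hd o0 h hh hq.
  by move=> i; have [] := hd i h hh hq.
have [d d0 hd] := near_u1.
pose r := Num.min (d / 2) (Num.min q eps).
have [rd rq re] : [/\ r <= d / 2, r <= q & r <= eps].
  by rewrite /r !ge_min !lexx ?orbT; split.
have r0 : 0 < r by rewrite !lt_min q0 eps0 !andbT; lra.
have rn := ltW r0.
have key i : recenter (P i) u1 = c i.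
  apply: (ev_inj r0 (acv_le rn rq (hb i)) (acv_le rn re (hc i))) => h hr.
  have hq : cn h <= q by lra.
  have he : cn h <= eps by lra.
  have hdd : cn h < d by lra.
  have [hne hcl] := hd h hdd hq.
  have hs : cn (u1 + h) <= s by have := cnD u1 h; lra.
  have [w [Xw w1 w0 hw]] := exists_section_point s0' hP hs hne.
  have ew : w = evc a (xi_ o0 w - xi_ o0 v).
    by apply: hnear => // k; rewrite hw; exact: hcl.
  rewrite (recenter_ev p0 q0 qs (lexx _) hq (hP i)).
  have -> : ev (c i) h = (u1 + h) ^+ 2 * ev (a i) h.
    rewrite (evM epsn he (acvXn 2 epsn hux) (hac i)) expr2.
    rewrite (evM epsn he hux hux) (evD epsn he (acv_const _ epsn) (acvX epsn)).
    by rewrite ev_const evX expr2.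
  have /rowP /(_ i) := ew; rewrite w0 v0 mxE hw addrAC subrr add0r => <-.
  by rewrite mulrC divfK // expf_neq0.
move=> i k; rewrite key.
have pnux N : pn eps (fps_const u1 + fpsX C) N <= rho2 + 1.
  apply: le_trans (pnD _ _ _ epsn) _; apply: lerD; first by apply: le_trans (pn_const _ _ epsn) up.
  exact: le_trans (pnX _ epsn) eps1.
have rho20 : 0 <= rho2 + 1 by rewrite addr_ge0 // (le_trans p0).
apply: (@le_trans _ _ (pn eps (c i) k.+1)).
  by rewrite pnS lerDr; exact: pn_ge0.
apply: le_trans (pnM _ _ _ epsn) _; apply: ler_pM; rewrite ?pn_ge0 //.
rewrite !expr2; apply: le_trans (pnM _ _ _ epsn) _.
by apply: ler_pM; rewrite ?pn_ge0.
Qed.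

Lemma geometric_half n : \sum_(k < n) (2^-1 : R) ^+ k <= 2.
Proof.
have -> : \sum_(k < n) (2^-1 : R) ^+ k = 2 - 2 * 2^-1 ^+ n.
  elim: n => [|n IH]; first by rewrite big_ord0 expr0; lra.
  by rewrite big_ord_recr /= IH exprS; lra.
have : 0 <= (2^-1 : R) ^+ n by rewrite exprn_ge0 // invr_ge0.
lra.
Qed.

(** The radius of convergence increases by a fixed amount: Cauchy's estimate,
    applied to the [k]-th derivative on a circle close to the boundary, turns the
    bounds on all Taylor coefficients into a bound on the coefficients at [0]. *)
Lemma continuation_step (rho : R) : s0 <= rho -> exists2 d : R, 0 < d & forall s,
  s0 <= s -> s <= rho -> (forall i, acv s (P i)) -> forall i, acv (s + d) (P i).
Proof.
move=> s0rho; have s0p := germ_gt0 g.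
have hs2 : 0 < s0 / 2 by lra.
have rho0 : 0 < rho by lra.
have [m hm] := uniform_charts hs2 rho0.
pose eps : R := m.+1%:R^-1.
have eps0 : 0 < eps by rewrite invr_gt0.
pose B := (rho + 1) ^+ 2 * m.+1%:R.
pose d := Num.min (eps / 8) (s0 / 2).
have [d8 ds] : d <= eps / 8 /\ d <= s0 / 2 by rewrite /d !ge_min !lexx ?orbT.
have d0 : 0 < d by rewrite lt_min; apply/andP; split; lra.
exists d => // s s0s srho hP i; pose s' := s - d.
have s'0 : 0 < s' by rewrite /s'; lra.
have s'n := ltW s'0; have prs : s' + d <= s by rewrite /s' subrK.
have sn : 0 <= s by lra.
have bound k u1 : cn u1 = s' -> cn (ev (dshift k (P i)) u1) <= B / eps ^+ k.
  move=> cu; have u10 : u1 != 0 by rewrite -cn_gt0 cu.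
  have us : cn u1 <= s by rewrite cu /s'; lra.
  have [v hv] := exists_section_point sn hP us u10.
  have [Xv v1 v0 _] := hv.
  have gc : good_chart m v.
    by apply: hm => //; rewrite v0 cu /s'; lra.
  have urho : cn u1 <= rho by lra.
  have prs1 : cn u1 + d <= s by rewrite cu.
  rewrite ler_pdivlMr ?exprn_gt0 //.
  exact: (taylor_bound d0 prs1 u10 urho hP hv gc i k).
have B0 : 0 <= B by rewrite mulr_ge0 // sqr_ge0.
(* summed over [k], these bounds give [(s' + eps / 2) ^ n] by the binomial formula *)
have coef_bound n (k : 'I_n.+1) : cn (coef (P i) n) * (s' ^+ (n - k) * (eps / 2) ^+ k *+ 'C(n, k)) <= B * 2^-1 ^+ k.
  have hd := acv_dshift k s'n d0 prs (hP i).
  have := cauchy_est s'n hd (bound k) (n - k); rewrite /= subnK; last by rewrite -ltnS.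
  rewrite cnM cn_nat ler_pdivlMr ?exprn_gt0 // => h.
  have -> : cn (coef (P i) n) * (s' ^+ (n - k) * (eps / 2) ^+ k *+ 'C(n, k)) =
     'C(n, k)%:R * cn (coef (P i) n) * s' ^+ (n - k) * eps ^+ k * 2^-1 ^+ k.
    by rewrite exprMn -mulr_natl; ring.
  by rewrite ler_wpM2r // exprn_ge0 // invr_ge0.
have total n : cn (coef (P i) n) * (s' + eps / 2) ^+ n <= B * 2.
  rewrite exprDn mulr_sumr.
  apply: le_trans (_ : \sum_(k < n.+1) B * 2^-1 ^+ k <= _); first by apply: ler_sum => k _; exact: coef_bound.
  by rewrite -mulr_sumr ler_wpM2l // geometric_half.
by apply: acv_bound total; rewrite /s'; lra.
Qed.

Lemma germ_entire (s : R) : 0 <= s -> forall i, acv s (P i).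
Proof.
move=> sn; have s0p := germ_gt0 g.
have [ss0|s0s] := leP s s0; first by move=> i; apply: acv_le sn ss0 (germ_acv g i).
have [d d0 hd] := continuation_step (ltW s0s).
have h n : forall i, acv (Num.min s (s0 + n%:R * d)) (P i).
  elim: n => [|n IH]; first by rewrite mul0r addr0 min_r ?(ltW s0s) //; exact: germ_acv g.
  have nd : 0 <= n%:R * d by rewrite mulr_ge0 // ltW.
  have le_s : Num.min s (s0 + n%:R * d) <= s by rewrite ge_min lexx.
  have ge_s0 : s0 <= Num.min s (s0 + n%:R * d) by rewrite le_min (ltW s0s) lerDl.
  move=> i; apply: acv_le (hd _ ge_s0 le_s IH i).
    by rewrite le_min sn addr_ge0 ?mulr_ge0 // ltW.
  have -> : n.+1%:R * d = n%:R * d + d by rewrite -addn1 natrD mulrDl mul1r.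
  have [h1|h1] := leP s (s0 + n%:R * d); rewrite ge_min; apply/orP.
    by left; lra.
  by right; lra.
have [n hn] : exists n : nat, (s - s0) / d <= n%:R.
  by exists (Num.truncn ((s - s0) / d)).+1; apply/ltW/truncnS_gt.
move=> i; have := h n i; rewrite min_l //.
by move: hn; rewrite ler_pdivrMr //; lra.
Qed.

(** Cauchy's estimate on large circles against the cubic growth. *)
Lemma germ_polynomial l k : (3 < k)%N -> coef (pl P (linp l)) k = 0.
Proof.
move=> k3; have [m hm] := growth_bound l.
have hl (s : R) : 0 <= s -> acv s (pl P (linp l)).
  by move=> sn; apply: pl_acv => // i; apply: germ_entire.
have est (s : R) : 1 <= s -> cn (coef (pl P (linp l)) k) * s ^+ k <= m%:R * s ^+ 3.
  move=> s1; have sn : 0 <= s by lra.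
  apply: (cauchy_est sn (hl s sn)) => u us.
  have us' : cn u <= s by rewrite us.
  have u0 : u != 0 by rewrite -cn_gt0 us; lra.
  have [cw e0 e1] := germ_cone sn (germ_entire sn) us' u0.
  rewrite -(germ_lin _ sn (germ_entire sn) us').
  have := hm _ cw; rewrite e0 e1 !cnX us expf_neq0 //; apply => //.
  by rewrite ler_weXn2l.
apply/eqP; rewrite -cn_eq0; apply/negPn/negP => c0.
have {}c0 : 0 < cn (coef (pl P (linp l)) k) by rewrite lt_def c0 cn_ge0.
pose s := m%:R / cn (coef (pl P (linp l)) k) + 1.
have s1 : 1 <= s by rewrite lerDr divr_ge0 // ltW.
have sp : 0 < s by lra.
have ek : s ^+ k = s ^+ (k - 3) * s ^+ 3 by rewrite -exprD subnK // ltnW.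
have := est s s1; rewrite ek mulrA ler_pM2r ?exprn_gt0 //.
have : s <= s ^+ (k - 3).
  by rewrite -{1}[s]expr1 ler_weXn2l // subn_gt0.
move/(ler_wpM2l (ltW c0)) => h1 h2; have := le_trans h1 h2.
by rewrite /s mulrDr mulr1 mulrC divfK ?gt_eqF //; lra.
Qed.
End EntireGerm.
End Continuation.

(** * Twisted cubics *)

(** The initial coefficients multiply. *)
Lemma fps_mul_eq0 (K : idomainType) (a b : fps K) : a * b = 0 -> a = 0 \/ b = 0.
Proof.
move=> ab; have [->|a0] := eqVneq a 0; first by left.
right; have [k ak hk] : exists2 k, ord_ge k a & coef a k != 0.
  have ex : exists k, coef a k != 0.
    apply: contrapT => no; move/negP: a0; apply; apply/eqP/fpsP => k; rewrite fcoef0.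
    by apply/eqP/negPn/negP => hk; apply: no; exists k.
  exists (ex_minn ex); last by case: ex_minnP.
  case: ex_minnP => m _ hm j jm; apply/eqP/negPn/negP => /hm.
  by rewrite leqNgt jm.
apply: ord_ge_eq0; elim=> [|j IH]; first exact: ord_ge0.
move=> n; rewrite ltnS leq_eqVlt => /orP[/eqP->|]; last exact: IH.
have : coef (a * b) (k + j) = 0 by rewrite ab fcoef0.
rewrite fcoefM (bigD1 (Ordinal (leq_addr j k : k < (k + j).+1)%N)) //= addKn big1 ?addr0.
  by move/eqP; rewrite mulf_eq0 (negbTE hk) => /eqP.
move=> i; rewrite -val_eqE /= => nik; have [ik|ki] := ltnP i k; first by rewrite ak ?mul0r.
by rewrite IH ?mulr0 //; have := ltn_ord i; move: nik ki; lia.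
Qed.

Section TwistedCubic.
Variable R : realType.
Local Notation C := R[i].
Local Notation mp := (mpoly.mpoly 4 C).
Implicit Types (F G : mp) (s t u : C) (w z : 'rV[C]_4).

Definition cub s t : 'rV[C]_4 := \row_(i < 4) (s ^+ (3 - i) * t ^+ i).

Lemma cub_eq0 s t : (cub s t == 0) = (s == 0) && (t == 0).
Proof.
apply/eqP/andP => [/rowP h|[/eqP-> /eqP->]]; last first.
  by apply/rowP => -[[|[|[|[|//]]]] hj]; rewrite !mxE /= !expr0n /= ?mulr0 ?mul0r.
split; apply/eqP.
  have := h o0; rewrite !mxE /= expr0 mulr1 => /eqP.
  by rewrite expf_eq0 /= => /eqP.
have := h o3; rewrite !mxE /= expr0 mul1r => /eqP.
by rewrite expf_eq0 /= => /eqP.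
Qed.

Lemma pair_neq0 s t : (s, t) <> (0, 0) <-> cub s t != 0.
Proof.
rewrite cub_eq0; split=> [h|h [s0 t0]]; last by rewrite s0 t0 eqxx in h.
by apply/negP => /andP[/eqP s0 /eqP t0]; apply: h; rewrite s0 t0.
Qed.

Variable D : 'M[C]_4.
Hypothesis Du : D \in unitmx.

Definition cubic_set : set (projspace C 3) :=
  [set ppoint (v *m D) | v in [set v | v != 0 /\ @standard_twisted_cubic C (ppoint v)]]%classic.

Lemma mulmx_neq0 w : w != 0 -> w *m D != 0.
Proof. by apply: contra => /eqP h; rewrite -(mulmxK Du w) h mul0mx. Qed.

Lemma cubic_set_cub s t : cub s t != 0 -> cubic_set (ppoint (cub s t *m D)).
Proof.
move=> h; exists (cub s t) => //; split=> //; exists s, t; split=> //.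
exact/pair_neq0.
Qed.

Lemma cubic_setP x : cubic_set x -> exists s t, cub s t != 0 /\ x = ppoint (cub s t *m D).
Proof.
move=> [v [v0 [s [t [st ev]]]] <-]; have c0 : cub s t != 0 by apply/pair_neq0.
exists s, t; split=> //; have [k k0 ->] := ppoint_eqP v0 c0 ev.
by rewrite -scalemxAl ppoint_scale.
Qed.

(** The coordinates [z = w D^-1] and the three quadrics. *)
Let zc (j : 'I_4) : 'I_4 -> C := fun i => invmx D i j.
Lemma lin_zc j w : lin (zc j) w = (w *m invmx D) 0 j.
Proof. exact: lin_col. Qed.

Definition quad_form (i j k l : 'I_4) : mp :=
  linp (zc i) * linp (zc j) - linp (zc k) * linp (zc l).

Lemma quad_formE i j k l w : mev (w 0) (quad_form i j k l) =
  (w *m invmx D) 0 i * (w *m invmx D) 0 j - (w *m invmx D) 0 k * (w *m invmx D) 0 l.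
Proof. by rewrite mevB !mevM !mev_linp !lin_zc. Qed.

Lemma quad_form_homog i j k l : homogeneous (quad_form i j k l).
Proof. by exists 2%N; apply: rpredB; apply: (@mpoly.dhomogM _ _ _ 1 _ 1); exact: homog_linp. Qed.

Definition quadric F := [\/ F = quad_form o0 o2 o1 o1, F = quad_form o0 o3 o1 o2 |
  F = quad_form o1 o3 o2 o2].

Lemma quadrics_cub F s t : quadric F -> mev ((cub s t *m D) 0) F = 0.
Proof.
case=> ->; rewrite quad_formE mulmxK // !mxE /=; ring.
Qed.

Lemma quadrics_vanish F : quadric F -> vanishing_forms cubic_set F.
Proof.
move=> hF; have homF : homogeneous F.
  by case: hF => ->; exact: quad_form_homog.
split=> // x /cubic_setP [s [t [c0 ->]]].
by apply/vanishes_atE => //; [exact: mulmx_neq0 | exact: quadrics_cub].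
Qed.

(** The parameters of a point on the three quadrics are [(z0 : z1)] if [z0] is not
    zero; otherwise [z1 = z2 = 0] and they are [(0 : 1)]. *)
Lemma quadrics_cut w : w != 0 -> (forall F, quadric F -> mev (w 0) F = 0) ->
  cubic_set (ppoint w).
Proof.
move=> w0 h; pose z := w *m invmx D; have ew : w = z *m D by rewrite mulmxKV.
have z0 : z != 0 by apply: contra w0 => /eqP zz; rewrite ew zz mul0mx.
have e1 : z 0 o0 * z 0 o2 = z 0 o1 * z 0 o1.
  by apply/eqP; rewrite -subr_eq0 -quad_formE h //; constructor 1.
have e2 : z 0 o0 * z 0 o3 = z 0 o1 * z 0 o2.
  by apply/eqP; rewrite -subr_eq0 -quad_formE h //; constructor 2.
have e3 : z 0 o1 * z 0 o3 = z 0 o2 * z 0 o2.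
  by apply/eqP; rewrite -subr_eq0 -quad_formE h //; constructor 3.
clearbody z; have [z00|z00] := eqVneq (z 0 o0) 0.
  have z10 : z 0 o1 = 0.
    by apply/eqP; move/eqP: e1; rewrite z00 mul0r eq_sym mulf_eq0 orbb.
  have z20 : z 0 o2 = 0.
    by apply/eqP; move/eqP: e3; rewrite z10 mul0r eq_sym mulf_eq0 orbb.
  have z30 : z 0 o3 != 0.
    apply: contra z0 => /eqP z30; apply/eqP/rowP => j; rewrite mxE; move: j; exact: forall4.
  have c0 : cub 0 (z 0 o3) != 0 by rewrite cub_eq0 negb_and z30 orbT.
  suff -> : ppoint w = ppoint (cub 0 (z 0 o3) *m D) by exact: cubic_set_cub.
  have -> : cub 0 (z 0 o3) = (z 0 o3 ^+ 2) *: z.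
    apply/rowP; apply: forall4; rewrite !mxE /=.
    - by rewrite z00 expr0n mul0r mulr0.
    - by rewrite z10 expr0n mul0r mulr0.
    - by rewrite z20 expr0n mul0r mulr0.
    - by rewrite expr0 mul1r -exprSr.
  by rewrite -scalemxAl ppoint_scale ?expf_neq0 // -ew.
have c0 : cub (z 0 o0) (z 0 o1) != 0 by rewrite cub_eq0 negb_and z00.
suff -> : ppoint w = ppoint (cub (z 0 o0) (z 0 o1) *m D) by exact: cubic_set_cub.
have -> : cub (z 0 o0) (z 0 o1) = (z 0 o0 ^+ 2) *: z.
  apply/rowP; apply: forall4; rewrite !mxE /=.
  - by rewrite expr0 mulr1 -exprSr.
  - by rewrite expr1.
  - by rewrite expr1 [in RHS]expr2 -mulrA e1 -expr2.
  - by rewrite expr0 mul1r expr2 -mulrA e2 mulrCA e1; ring.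
by rewrite -scalemxAl ppoint_scale ?expf_neq0 // -ew.
Qed.

Lemma cubic_closed : zariski_closed cubic_set.
Proof.
exists [set F | quadric F]%classic; first by move=> F hF; exact: (quadrics_vanish hF).1.
apply/seteqP; split=> [x Yx F hF|x h]; first exact: (quadrics_vanish hF).2.
have [w w0 ex] := ppointP x; rewrite ex; apply: quadrics_cut => // F hF.
apply/vanishes_atE => //; first exact: (quadrics_vanish hF).1.
by rewrite -ex; exact: h.
Qed.

(** The restriction of the parametrization to a line of parameters is an arc; the
    values 0 and 1 of its variable give the points [(s1, t1)] and [(s2, t2)]. *)
Definition line_fps (s1 s2 : C) : fps C := fps_const s1 + fps_const (s2 - s1) * fpsX C.
Definition cub_fps (s1 t1 s2 t2 : C) (i : 'I_4) : fps C :=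
  \sum_(j < 4) (line_fps s1 s2 ^+ (3 - j) * line_fps t1 t2 ^+ j) * fps_const (D j i).

Lemma line_acv (r : R) s1 s2 : 0 <= r -> acv r (line_fps s1 s2).
Proof.
move=> r0; apply: acvD (acv_const _ r0) _ => //.
exact: acvM r0 (acv_const _ r0) (acvX r0).
Qed.

Lemma acv_sum (r : R) n (f : 'I_n -> fps C) : 0 <= r -> (forall i, acv r (f i)) -> acv r (\sum_i f i).
Proof.
move=> r0 h; elim/big_ind: _ => //; first by exists 0 => N; rewrite pn0.
by move=> x y; apply: acvD.
Qed.

Lemma ev_sum (r : R) u n (f : 'I_n -> fps C) : 0 <= r -> cn u <= r -> (forall i, acv r (f i)) ->
  ev (\sum_i f i) u = \sum_i ev (f i) u.
Proof.
move=> r0 ur; elim: n f => [|n IH] f h.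
  by rewrite !big_ord0 ev0.
by rewrite !big_ord_recr /= (evD r0 ur) ?IH //; apply: acv_sum.
Qed.

Lemma ev_exp (r : R) u (a : fps C) k : 0 <= r -> cn u <= r -> acv r a -> ev (a ^+ k) u = ev a u ^+ k.
Proof.
move=> r0 ur ha; elim: k => [|k IH]; first exact: (@ev_const _ 1).
by rewrite !exprS (evM r0 ur ha (acvXn k r0 ha)) IH.
Qed.

Lemma cub_fps_acv (r : R) s1 t1 s2 t2 i : 0 <= r -> acv r (cub_fps s1 t1 s2 t2 i).
Proof.
move=> r0; apply: acv_sum => // j; apply: acvM => //; last exact: acv_const.
by apply: acvM => //; apply: acvXn => //; apply: line_acv.
Qed.

Lemma ev_line u s1 s2 : ev (line_fps s1 s2) u = s1 + (s2 - s1) * u.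
Proof.
have r0 : 0 <= cn u := cn_ge0 u; have hc c := acv_const c r0.
rewrite (evD r0 (lexx _) (hc _) (acvM r0 (hc _) (acvX r0))) ev_const.
by rewrite (evM r0 (lexx _) (hc _) (acvX r0)) ev_const evX.
Qed.

Lemma ev_cub_fps u s1 t1 s2 t2 F : ev (pl (cub_fps s1 t1 s2 t2) F) u =
  mev ((cub (s1 + (s2 - s1) * u) (t1 + (t2 - t1) * u) *m D) 0) F.
Proof.
have r0 : 0 <= cn u := cn_ge0 u; have ur : cn u <= cn u by [].
rewrite (pl_ev _ r0 ur (fun i => cub_fps_acv _ _ _ _ i r0)); congr mev; apply/funext => i.
have hl x y : acv (cn u) (line_fps x y) := line_acv x y r0.
have hXn x y k : acv (cn u) (line_fps x y ^+ k) := acvXn k r0 (hl x y).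
rewrite /cub_fps (ev_sum r0 ur) => [|j]; last first.
  exact: acvM r0 (acvM r0 (hXn _ _ _) (hXn _ _ _)) (acv_const _ r0).
rewrite mxE; apply: eq_bigr => j _.
rewrite (evM r0 ur (acvM r0 (hXn _ _ _) (hXn _ _ _)) (acv_const _ r0)) ev_const.
rewrite (evM r0 ur (hXn _ _ _) (hXn _ _ _)) !(ev_exp _ r0 ur (hl _ _)) !ev_line.
by rewrite mxE.
Qed.

(** Two forms whose product vanishes on the cubic: restrict them to a line of
    parameters joining points where they would not vanish. *)
Lemma cubic_irreducible : irreducible_closed cubic_set.
Proof.
split; first exact: cubic_closed.
  exists (ppoint (cub 1 0 *m D)); apply: cubic_set_cub.
  by rewrite cub_eq0 negb_and oner_eq0.
move=> Z1 Z2 [S1 hS1 eZ1] [S2 hS2 eZ2] sub; apply: contrapT => /not_orP [].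
have pick Z S : (S `<=` @homogeneous C 3)%classic ->
    Z = [set x | forall F, S F -> vanishes_at F x]%classic -> ~ (cubic_set `<=` Z)%classic ->
    exists s t F, [/\ cub s t != 0, S F & mev ((cub s t *m D) 0) F != 0].
  move=> hS eZ /existsNP [x /not_implyP [/cubic_setP [s [t [c0 ->]]] nZ]].
  apply: contrapT => no; apply: nZ; rewrite eZ => F SF; apply/vanishes_atE; [exact: mulmx_neq0|exact: hS|].
  by apply/eqP/negPn/negP => hF; apply: no; exists s, t, F.
move=> /(pick _ _ hS1 eZ1) [s1 [t1 [F [c1 SF F1]]]] /(pick _ _ hS2 eZ2) [s2 [t2 [G [c2 SG G2]]]].
pose f := pl (cub_fps s1 t1 s2 t2) F; pose g := pl (cub_fps s1 t1 s2 t2) G.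
have van0 (H : mp) x : vanishes_at H x -> mev ((cub 0 0 *m D) 0) H = 0.
  move=> h; have c00 : cub 0 0 = 0 by apply/eqP; rewrite cub_eq0 eqxx.
  by have := h 0 (mem0v _); rewrite c00 mul0mx mevE.
have FG0 s t : mev ((cub s t *m D) 0) F * mev ((cub s t *m D) 0) G = 0.
  have case s' t' : cub s' t' != 0 -> vanishes_at F (ppoint (cub s' t' *m D)) \/
      vanishes_at G (ppoint (cub s' t' *m D)).
    move=> c0; case: (sub _ (cubic_set_cub c0)); rewrite ?eZ1 ?eZ2 => h; [left|right]; exact: h.
  have [c0|c0] := eqVneq (cub s t) 0.
    move/eqP: c0; rewrite cub_eq0 => /andP[/eqP -> /eqP ->].
    by case: (case _ _ c1) => /van0 ->; rewrite ?mul0r ?mulr0.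
  case: (case _ _ c0) => /vanishes_atE ->; rewrite ?mul0r ?mulr0 //.
  - exact: mulmx_neq0.
  - exact: hS1.
  - exact: mulmx_neq0.
  - exact: hS2.
have r1 : 0 <= 1 :> R by [].
have hF : acv 1 f by apply: pl_acv => // i; exact: cub_fps_acv.
have hG : acv 1 g by apply: pl_acv => // i; exact: cub_fps_acv.
have fg : f * g = 0.
  apply: (ev_inj ltr01 (acvM r1 hF hG) (acv_const 0 r1)) => u us.
  by rewrite (evM r1 us hF hG) ev_const !ev_cub_fps FG0.
case: (fps_mul_eq0 fg) => e0.
  move/negP: F1; apply; apply/eqP; have := ev_cub_fps 0 s1 t1 s2 t2 F.
  rewrite -/f e0 ev0 !mulr0 !addr0 => <-.
  by [].
move/negP: G2; apply; apply/eqP; have := ev_cub_fps 1 s1 t1 s2 t2 G.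
rewrite -/g e0 ev0 !mulr1 !(addrC _ (_ - _)) !subrK => <-.
by [].
Qed.
End TwistedCubic.

(** * Algebraically skew curves are twisted cubics *)

Section Forward.
Variable R : realType.
Local Notation C := R[i].
Variable X : set (projspace C 3).
Hypothesis Xirr : irreducible_closed X.
Hypothesis Xinf : forall x, ~ (X `<=` [set x])%classic.
Implicit Types (v w y : 'rV[C]_4) (t u : C) (l : 'I_4 -> C).

(** The equations of the tangent space at [v], which make sense for [w = 0] as
    well. *)
Definition in_tangent v w := forall F, vanishing_forms X F ->
  \sum_i mev (v 0) (mpoly.mderiv i F) * w 0 i = 0.

Lemma in_tangentP v w : v != 0 -> w != 0 ->
  tangent_space X (ppoint v) (ppoint w) <-> in_tangent v w.
Proof. exact: tangent_spaceE. Qed.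

(** By Euler's identity. *)
Lemma in_tangent_self v : v != 0 -> X (ppoint v) -> in_tangent v v.
Proof.
move=> v0 Xv F FX; have [[d hd] _] := FX.
have := @euler R 4 d F (v 0) hd (mev_vanishing FX v0 Xv); exact.
Qed.

Lemma not_in_tangent v w : ~ in_tangent v w ->
  exists2 F, vanishing_forms X F & \sum_i mev (v 0) (mpoly.mderiv i F) * w 0 i != 0.
Proof.
move=> h; apply: contrapT => no; apply: h => F FX; apply/eqP/negPn/negP => hF.
by apply: no; exists F.
Qed.

Lemma rank_mx2 l0 l1 (b0 b1 : 'rV[C]_4) : lin l0 b0 = 1 -> lin l1 b0 = 0 ->
  lin l0 b1 = 0 -> lin l1 b1 = 1 -> \rank (mx2 l0 l1) = 2%N.
Proof.
move=> h00 h10 h01 h11; pose B : 'M[C]_(2, 4) := \matrix_(i < 2) (if i == 0 then b0 else b1).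
have e : B *m mx2 l0 l1 = 1%:M.
  apply/row_matrixP => i; rewrite row_mul rowK mulmx_mx2 row1.
  apply/rowP => j; rewrite !mxE.
  by case: i => -[|[|//]] hi; case: j => -[|[|//]] hj /=; rewrite ?h00 ?h10 ?h01 ?h11.
have := mxrankM_maxr B (mx2 l0 l1); rewrite e mxrank1 => ge.
by apply/eqP; rewrite eqn_leq ge andbT; exact: rank_leq_col.
Qed.

(** The coordinates on the tangent plane dual to a basis: one of them does not
    vanish at the point, and becomes 1 after rescaling. *)
Lemma tangent_coordinates x (U : {vspace 'rV[C]_4}) : X x -> \dim U = 2%N ->
  tangent_space X x = plinear U ->
  exists v l0 l1, [/\ x = ppoint v, lin l0 v = 1, \rank (mx2 l0 l1) = 2%N &
    forall w, w != 0 -> lin l0 w = 0 -> lin l1 w = 0 -> ~ in_tangent v w].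
Proof.
move=> Xx dU eU; have [v v0 ex] := ppointP x.
have memU (k : C) w : k != 0 -> w != 0 -> in_tangent (k *: v) w <-> w \in U.
  move=> k0 w0; rewrite -in_tangentP ?scaler_eq0 ?negb_or ?k0 //.
  by rewrite ppoint_scale // -ex eU /plinear /= sval_ppoint // -memvE.
have szU : size (vbasis U) = 2%N by rewrite size_tuple dU.
have [u1 [u2 eb]] : exists u1 u2 : 'rV[C]_4, vbasis U = [:: u1; u2] :> seq 'rV[C]_4.
  by move: szU; case: (tval _) => [|a [|b [|//]]] //= _; exists a, b.
have combo w : w \in U -> exists a b, w = a *: u1 + b *: u2.
  rewrite -(span_basis (vbasisP U)) eb span_cons span_seq1.
  by move=> /memv_addP [_ /vlineP [a ->] [_ /vlineP [b ->] ->]]; exists a, b.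
have indep a b : a *: u1 + b *: u2 = 0 -> a = 0 /\ b = 0.
  move=> e; have fr : free [tuple u1; u2] by have := basis_free (vbasisP U); rewrite eb.
  have h := freeP fr.
  have := h (fun i => if i == 0 then a else b); rewrite !big_ord_recl big_ord0 /= addr0 => /(_ e) h2.
  by split; [have := h2 0 | have := h2 1].
pose B : 'M[C]_(1 + 1, 4) := col_mx u1 u2.
have [L0 BL] : exists L0, B *m L0 = 1%:M.
  apply/row_freeP; rewrite -kermx_eq0; apply/eqP/row_matrixP => i; rewrite row0.
  set c := row i _; have cB : c *m B = 0 by rewrite -row_mul mulmx_ker row0.
  clearbody c; have ec := hsubmxK c; rewrite -ec mul_row_col in cB.
  rewrite (mx11_scalar (lsubmx c)) (mx11_scalar (rsubmx c)) !mul_scalar_mx in cB.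
  have [l0 r0] := indep _ _ cB.
  by rewrite -ec (mx11_scalar (lsubmx c)) (mx11_scalar (rsubmx c)) l0 r0 !raddf0 row_mx0.
pose m0 i := L0 i 0; pose m1 i := L0 i 1.
have BL1 : u1 *m L0 = row (lshift 1 0) 1%:M.
  by rewrite -BL row_mul rowKu row_id.
have BL2 : u2 *m L0 = row (rshift 1 0) 1%:M.
  by rewrite -BL row_mul rowKd row_id.
have [h00 h10 h01 h11] : [/\ lin m0 u1 = 1, lin m1 u1 = 0, lin m0 u2 = 0 & lin m1 u2 = 1].
  by rewrite !lin_col BL1 BL2 !mxE.
have vU : v \in U.
  by rewrite -(memU 1) ?oner_eq0 // scale1r; apply: in_tangent_self; rewrite -?ex.
have [a [b ev]] := combo v vU.
have ma : lin m0 v = a by rewrite ev linD !linZ h00 h01 mulr1 mulr0 addr0.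
have mb : lin m1 v = b by rewrite ev linD !linZ h10 h11 mulr1 mulr0 add0r.
have zero w : w != 0 -> lin m0 w = 0 -> lin m1 w = 0 -> w \notin U.
  move=> w0 e0 e1; apply: contra w0 => /combo [a' [b' ew]].
  move: e0 e1; rewrite ew !linD !linZ h00 h01 h10 h11 !mulr1 !mulr0 addr0 add0r => -> ->.
  by rewrite !scale0r addr0.
have [a0|a0] := eqVneq a 0.
  have b0 : b != 0.
    by apply: contra v0 => /eqP b0; rewrite ev a0 b0 !scale0r addr0.
  exists (b^-1 *: v), m1, m0; split.
  - by rewrite ppoint_scale ?invr_eq0.
  - by rewrite linZ mb mulVf.
  - exact: rank_mx2 h11 h01 h10 h00.
  - move=> w w0 e0 e1; rewrite memU ?invr_eq0 //; exact/negP/zero.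
exists (a^-1 *: v), m0, m1; split.
- by rewrite ppoint_scale ?invr_eq0.
- by rewrite linZ ma mulVf.
- exact: rank_mx2 h00 h10 h01 h11.
- by move=> w w0 e0 e1; rewrite memU ?invr_eq0 //; exact/negP/zero.
Qed.
End Forward.

Lemma contact_arith (K : realFieldType) (M M' e t : K) : 0 <= t -> (M + e * M') * t <= e ->
  M * t ^+ 3 <= e * (t ^+ 2 - M' * t ^+ 3).
Proof.
move=> t0 /(ler_wpM2l (exprn_ge0 2 t0)); rewrite mulrBr lerBrDr => h.
rewrite (mulrC e (t ^+ 2)); apply: le_trans h; rewrite le_eqVlt; apply/orP; left; apply/eqP; ring.
Qed.

Section Frame.
Variable R : realType.
Local Notation C := R[i].
Variable X : set (projspace C 3).
Hypothesis Xirr : irreducible_closed X.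
Hypothesis Xinf : forall x, ~ (X `<=` [set x])%classic.
Hypothesis Xskew : Defs.skew X.
Implicit Types (v w y : 'rV[C]_4) (t u : C) (l : 'I_4 -> C).
Variables (l0 l1 : 'I_4 -> C) (v : 'rV[C]_4) (a : 'I_4 -> fps C) (s : R).
Hypothesis ch : chart X l0 l1 v a s.
Let D : 'M[C]_4 := \matrix_(j, i) coef (a i) (3 - j).
Hypothesis Du : D \in unitmx.

(** Coordinates in the osculating frame, the last vector of which is [v]. *)
Let xi (j i : 'I_4) : C := invmx D i j.

Lemma lin_xi j w : lin (xi j) w = (w *m invmx D) 0 j.
Proof. exact: lin_col. Qed.

Lemma frame_decomp w i : w 0 i = \sum_j lin (xi j) w * coef (a i) (3 - j).
Proof.
rewrite -{1}(mulmxKV Du w) mxE; apply: eq_bigr => j _.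
by rewrite lin_xi [D _ _]mxE.
Qed.

Lemma frame_coef j k : (k < 4)%N -> coef (pl a (linp (xi j))) k = (j + k == 3)%N%:R.
Proof.
move=> k4; have hk : (3 - k < 4)%N by rewrite ltnS leq_subr.
have -> : coef (pl a (linp (xi j))) k = lin (xi j) (row (Ordinal hk) D).
  by rewrite coef_pl_linp; apply: eq_bigr => i _; rewrite !mxE /= subKn.
rewrite lin_xi -row_mul mulmxV // !mxE; congr (_%:R); congr nat_of_bool.
rewrite -val_eqE /=; lia.
Qed.

Lemma chart_base : v != 0 /\ X (ppoint v).
Proof.
have c0 : cn (0 : C) <= s by rewrite cn0 (ltW (chart_gt0 ch)).
by rewrite -(chart_at0 ch); split; [exact: chart_neq0 ch _ c0 | exact (chart_on Xirr ch c0)].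
Qed.

(** The line [xi0 = xi1 = 0] is spanned by the value and the first derivative of
    the arc at 0. *)
Lemma base_tangent w : lin (xi o0) w = 0 -> lin (xi o1) w = 0 -> in_tangent X v w.
Proof.
move=> w0 w1 F FX; have [v0 Xv] := chart_base.
have e2 : \sum_i mev (v 0) (mpoly.mderiv i F) * coef (a i) 1 = 0.
  have := pl_coef1 a F; rewrite (chart_forms ch FX) fcoef0.
  have -> : (fun j => coef (a j) 0) = v 0 by apply/funext => i; exact: (chart_coef0 ch).
  by move=> <-.
have e3 := in_tangent_self v0 Xv FX.
have hw i : w 0 i = lin (xi o2) w * coef (a i) 1 + lin (xi o3) w * v 0 i.
  by rewrite {1}frame_decomp sum4 w0 w1 !mul0r !add0r /= (chart_coef0 ch).
rewrite (eq_bigr (fun i => lin (xi o2) w * (mev (v 0) (mpoly.mderiv i F) * coef (a i) 1) +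
  lin (xi o3) w * (mev (v 0) (mpoly.mderiv i F) * v 0 i))); last first.
  by move=> i _; rewrite hw; ring.
by rewrite big_split -!mulr_sumr [X in _ * X]e2 e3 !mulr0; exact: addr0.
Qed.

(** A point of the curve on the tangent line at [v] would lie on two tangent
    lines, its own and the one at [v]. *)
Lemma base_unique y : y != 0 -> X (ppoint y) -> lin (xi o0) y = 0 -> lin (xi o1) y = 0 ->
  ppoint y = ppoint v.
Proof.
move=> y0 Xy h0 h1; have [v0 Xv] := chart_base; apply: contrapT => ne.
have : (tangent_space X (ppoint y) `&` tangent_space X (ppoint v))%classic (ppoint y).
  split; apply/in_tangentP => //; [exact: in_tangent_self | exact: base_tangent].
by rewrite Xskew.
Qed.

(** Along the arc, [xi0] is [O(t^3)] whereas [xi1] is [t^2 + O(t^3)]. *)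
Lemma base_contact (e : R) : 0 < e -> exists2 r : R, 0 < r & forall t, cn t < r -> cn t <= s ->
  cn (lin (xi o0) (evc a t)) <= e * cn (lin (xi o1) (evc a t)).
Proof.
move=> e0; have s0 := chart_gt0 ch; have sn := ltW s0; have ha := chart_acv ch.
pose f := pl a (linp (xi o0)); pose g := pl a (linp (xi o1)) - fpsX C ^+ 2.
have e1 : pl a (linp (xi o1)) = fpsX C ^+ 2 + g by rewrite addrC subrK.
have hf : acv s f by exact: pl_acv.
have hg : acv s g.
  by apply: (acvB sn); [exact: pl_acv | exact: (acvXn 2 sn (acvX sn))].
have f3 : ord_ge 3 f.
  by move=> k k3; rewrite frame_coef ?(ltn_trans k3) //; case: k k3 => [|[|[|]]].
have g3 : ord_ge 3 g.
  by move=> k k3; rewrite fcoefB frame_coef ?(ltn_trans k3) // coef_Xn;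
    case: k k3 => [|[|[|]]] //= _; rewrite subrr.
have [M M0 hM] := pn_ord f3 s0 hf; have [M' M'0 hM'] := pn_ord g3 s0 hg.
have K0 : 0 < M + e * M' + 1 by rewrite ltr_wpDl // addr_ge0 // mulr_ge0 // ltW.
exists (e / (M + e * M' + 1)); first exact: divr_gt0.
move=> t tr ts; have t0 := cn_ge0 t.
have ef : lin (xi o0) (evc a t) = ev f t by rewrite -mev_linp (mev_evc _ sn ha ts).
have eg : lin (xi o1) (evc a t) = t ^+ 2 + ev g t.
  rewrite -mev_linp (mev_evc _ sn ha ts) e1.
  by rewrite (evD sn ts (acvXn 2 sn (acvX sn)) hg) (ev_Xn 2 sn ts).
have bf : cn (ev f t) <= M * cn t ^+ 3.
  by apply: (ev_le_pn t0 (lexx _)) => n; apply: hM.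
have bg : cn (ev g t) <= M' * cn t ^+ 3.
  by apply: (ev_le_pn t0 (lexx _)) => n; apply: hM'.
have tri : cn t ^+ 2 - M' * cn t ^+ 3 <= cn (lin (xi o1) (evc a t)).
  rewrite eg; have := cnD (t ^+ 2 + ev g t) (- ev g t); rewrite addrK cnN cnX; lra.
rewrite ef; apply: le_trans bf _.
apply: (@le_trans _ _ (e * (cn t ^+ 2 - M' * cn t ^+ 3))); last by rewrite ler_wpM2l ?(ltW e0).
have kt : (M + e * M') * cn t <= e.
  move: tr; rewrite ltr_pdivlMr // => h; apply: le_trans (ltW h).
  by rewrite mulrC ler_wpM2l // lerDl.
exact: contact_arith t0 kt.
Qed.

(** By uniqueness [y] represents [v], near which the curve is the arc. *)
Lemma near_base (e : R) y : 0 < e -> y != 0 /\ X (ppoint y) ->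
  lin (xi o0) y = 0 -> lin (xi o1) y = 0 ->
  exists2 r : R, 0 < r & forall w, w != 0 /\ X (ppoint w) -> (forall i, cn (w 0 i - y 0 i) < r) ->
    cn (lin (xi o0) w) <= e * cn (lin (xi o1) w).
Proof.
move=> e0 [y0 Xy] h0 h1; have [v0 Xv] := chart_base.
have [k k0 ey] := ppoint_eqP y0 v0 (base_unique y0 Xy h0 h1).
have l0v : lin l0 v = 1.
  by rewrite -(chart_at0 ch) (chart_lin0 ch) // cn0 (ltW (chart_gt0 ch)).
have l0y : lin l0 y = k by rewrite ey linZ l0v mulr1.
have [eta eta0 hnear] := chart_near ch; have [r r0 hr] := base_contact e0.
have m0 : 0 < Num.min eta r by rewrite lt_min eta0.
have l0y0 : lin l0 y != 0 by rewrite l0y.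
have [d d0 hd] := @normalize_cont _ l0 y _
  (fun o : option 'I_4 => if o is Some i then coord _ i else l1) _ l0y0 m0.
exists d => // w [w0 Xw] /hd [lw hw].
have q0 : (lin l0 w)^-1 != 0 by rewrite invr_eq0.
pose w' := (lin l0 w)^-1 *: w.
have norm l : lin l y / lin l0 y = lin l v by rewrite l0y ey linZ mulrAC divff ?mul1r.
have norm' l : lin l w / lin l0 w = lin l w' by rewrite linZ mulrC.
have [ts ew] : cn (lin l1 w' - lin l1 v) <= s /\ w' = evc a (lin l1 w' - lin l1 v).
  apply: hnear; first by rewrite ppoint_scale.
    by rewrite linZ mulVf.
  move=> i; have := hw (Some i); rewrite norm norm' !lin_coord => /ltW h.
  by apply: le_trans h _; rewrite ge_min lexx.
have tr : cn (lin l1 w' - lin l1 v) < r.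
  by have := hw None; rewrite norm norm' => h; apply: lt_le_trans h _; rewrite ge_min lexx orbT.
have := hr _ tr ts; rewrite -ew !linZ !cnM mulrCA.
by rewrite ler_pM2l // cn_gt0.
Qed.

Lemma lin_xi_row j k : lin (xi j) (row k D) = (k == j)%:R.
Proof. by rewrite lin_xi -row_mul mulmxV // !mxE. Qed.

(** If [xi0, xi1] were not coordinates on the tangent line at [v'], some point of
    it would lie on the line [xi0 = xi1 = 0], which is the tangent line at [v]. *)
Lemma u_chart v' : X (ppoint v') -> lin (xi o1) v' = 1 ->
  exists a' s', chart X (xi o1) (xi o0) v' a' s'.
Proof.
move=> Xv' e1; have [v0 Xv] := chart_base.
have v'0 : v' != 0 by apply: (@lin_neq0 _ (xi o1)); rewrite e1 oner_eq0.
apply: (exists_chart Xirr Xinf Xv' e1).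
  by apply: (@rank_mx2 _ _ _ (row o1 D) (row o0 D)); rewrite lin_xi_row.
move=> w w0 h1 h0; apply: not_in_tangent => hw.
have ne : ppoint v' <> ppoint v.
  move=> /(ppoint_eqP v'0 v0) [k _ ev]; move/eqP: e1; rewrite ev linZ.
  have -> : v = row o3 D by apply/rowP => i; rewrite !mxE (chart_coef0 ch).
  by rewrite lin_xi_row mulr0 eq_sym oner_eq0.
have : (tangent_space X (ppoint v') `&` tangent_space X (ppoint v))%classic (ppoint w).
  by split; apply/in_tangentP => //; exact: base_tangent.
by rewrite Xskew.
Qed.

(** The coefficients of the polynomial section are independent since its
    coordinates [xi] are [(u^3, u^2, u + O(u^2), 1 + O(u))].  The point at infinity
    of the cubic lies on the curve because a form vanishing at the other points
    vanishes there. *)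
Lemma exists_cubic_subset : exists2 Q : 'M[C]_4, Q \in unitmx & (cubic_set Q `<=` X)%classic.
Proof.
have [P [r g]] := exists_germ (chart_gt0 ch) (chart_acv ch) (@chart_forms _ _ _ _ _ _ _ ch) frame_coef.
have hP k i : (3 < k)%N -> coef (P i) k = 0.
  move=> k3; have := germ_polynomial Xirr near_base u_chart g (coord R i) k3.
  by rewrite coef_pl_linp lin_coord mxE.
pose Q : 'M[C]_4 := \matrix_(j, i) coef (P i) (3 - j).
have QE k j : (Q *m invmx D) k j = coef (pl P (linp (xi j))) (3 - k).
  by rewrite coef_pl_linp mxE; apply: eq_bigr => i _; rewrite !mxE mulrC.
have Qu : Q \in unitmx.
  apply: unitmx_ker => w wQ; have e j : \sum_k w 0 k * coef (pl P (linp (xi j))) (3 - k) = 0.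
    transitivity ((w *m (Q *m invmx D)) 0 j); last by rewrite mulmxA wQ mul0mx mxE.
    by rewrite [RHS]mxE; apply: eq_bigr => k _; rewrite QE.
  have [x20 x21] := germ_xi2 g.
  have := e o0; rewrite (germ_xi0 g) sum4 !coef_Xn /= !mulr0 !addr0 mulr1 => w0.
  have := e o1; rewrite (germ_xi1 g) sum4 !coef_Xn /= !mulr0 !addr0 add0r mulr1 => w1.
  have := e o2; rewrite sum4 /= w0 w1 x20 x21 !mul0r !add0r mulr0 addr0 mulr1 => w2.
  have := e o3; rewrite sum4 /= w0 w1 w2 (germ_xi3 g) !mul0r !add0r mulr1 => w3.
  by apply/rowP => j; rewrite [RHS]mxE; move: j; exact: forall4.
exists Q => //.
have evP u : evc P u = cub u 1 *m Q.
  apply/rowP => i; have u0 := cn_ge0 u.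
  have -> : evc P u 0 i = ev (\sum_(j < 4) fps_const (Q j i) * fpsX C ^+ (3 - j)) u.
    rewrite mxE; congr ev; apply: fpsP => k; rewrite coef_sums sum4.
    rewrite !coef_constM !coef_Xn ![Q _ _]mxE /=.
    case: k => [|[|[|[|k]]]]; rewrite /= ?mulr1 ?mulr0 ?addr0 ?add0r //.
    by rewrite hP.
  have hX j : acv (cn u) (fpsX C ^+ j) by exact: (acvXn _ u0 (acvX u0)).
  have hc c := acv_const c u0.
  rewrite (ev_sum u0 (lexx _)) => [|j]; last by exact: (acvM u0 (hc _) (hX _)).
  rewrite mxE; apply: eq_bigr => j _; rewrite (evM u0 (lexx _) (hc _) (hX _)).
  by rewrite mulrC (ev_Xn _ u0 (lexx _)) ev_const [cub _ _ _ _]mxE expr1n mulr1.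
have van1 F s1 t1 : vanishing_forms X F -> t1 != 0 -> mev ((cub s1 t1 *m Q) 0) F = 0.
  move=> FX t10; have [[d hd] _] := FX.
  have -> : (cub s1 t1 *m Q) 0 = (fun i => t1 ^+ 3 * (cub (s1 / t1) 1 *m Q) 0 i).
    apply/funext => i.
    have -> : cub s1 t1 = t1 ^+ 3 *: cub (s1 / t1) 1.
      apply/rowP => j; rewrite !mxE expr1n mulr1 expr_div_n.
      have -> : t1 ^+ 3 = t1 ^+ (3 - j) * t1 ^+ j by rewrite -exprD subnK // (ltnSE (ltn_ord j)).
      by rewrite mulrCA [t1 ^+ (3 - j) * _ / _]mulrAC mulfV ?mul1r // expf_neq0.
    by rewrite -scalemxAl mxE.
  rewrite (mev_homog _ _ hd) -evP.
  rewrite (mev_evc _ (cn_ge0 _) (germ_entire Xirr near_base u_chart g (cn_ge0 (s1 / t1))) (lexx _)).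
  by rewrite (germ_forms g FX) ev0 mulr0.
move=> x /cubic_setP [s1 [t1 [c0 ->]]].
have [Xc _ _] := Xirr; apply: (zariski_closedP Xc); first exact: mulmx_neq0.
move=> F FX; have [t10|] := eqVneq t1 0; last exact: van1.
pose G := pl (cub_fps Q s1 0 s1 1) F.
have hG : acv 1 G by apply: pl_acv => // i; apply: cub_fps_acv.
have G0 u : u != 0 -> ev G u = 0.
  by move=> u0; rewrite ev_cub_fps subr0 mul1r add0r; exact: van1.
have -> : mev ((cub s1 t1 *m Q) 0) F = ev G 0.
  by rewrite ev_cub_fps !mulr0 !addr0 t10.
have G1 u : cn u = 1 -> cn (ev G u) <= 0.
  move=> u1; rewrite G0 ?cn0 //; apply/eqP => u0; move: u1; rewrite u0 cn0 => /eqP.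
  by rewrite eq_sym oner_eq0.
rewrite (ev_at0 ltr01 hG); apply/eqP; rewrite -cn_eq0 eq_le cn_ge0 andbT.
by have := cauchy_est ler01 hG G1 0; rewrite expr0 mulr1.
Qed.
End Frame.

Lemma add_rev (K : comNzRingType) (x y z t : K) : x + (y + z + t) = x + t + z + y.
Proof. ring. Qed.

Section SkewIsCubic.
Variable R : realType.
Local Notation C := R[i].
Implicit Types (X : set (projspace C 3)) (v w : 'rV[C]_4).

(** The strict inclusion in a chain of length 1 requires two points. *)
Lemma dim1_infinite X : has_dimension X 1 -> forall x, ~ (X `<=` [set x])%classic.
Proof.
move=> [[Z [hZ lt]] _] x Xx; have [_ nle] := lt 0%N isT; apply: nle.
have [[_ [z Zz] _] Z0X] := hZ 0%N isT; have [_ Z1X] := hZ 1%N isT.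
move=> y /Z1X /Xx ->; by rewrite -(Xx z (Z0X _ Zz)).
Qed.

(** Otherwise a point, [Y] and [X] form a chain of length 2. *)
Lemma dim1_maximal X Y : irreducible_closed X -> has_dimension X 1 ->
  irreducible_closed Y -> (Y `<=` X)%classic -> forall x y, Y x -> Y y -> x <> y -> Y = X.
Proof.
move=> Xirr [_ no] Yirr YX x y Yx Yy xy; apply/seteqP; split=> //; apply: contrapT => XY; apply: no.
exists (fun i => if i is 0%N then [set x]%classic else if i is 1%N then Y else X); split.
  move=> [|[|i]] _; split=> //; first exact: irreducible_closed_point.
  by move=> _ ->; exact: YX.
move=> [|[|//]] _; split=> //; first by move=> _ ->.
by move=> /(_ y Yy) /= e; apply: xy.
Qed.

Lemma skew_is_cubic X : smooth_projective_curve X -> algebraically_skew X -> twisted_cubic X.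
Proof.
move=> [Xirr Xdim Xsm] [Xskew Xosc]; have Xinf := dim1_infinite Xdim.
have [_ [x Xx] _] := Xirr; have [U dU eU] := Xsm x Xx.
have [v [l0 [l1 [ex l0v rk ht]]]] := tangent_coordinates Xx dU eU.
have Xv : X (ppoint v) by rewrite -ex.
have [a [s ch]] : exists a s, chart X l0 l1 v a s.
  apply: (exists_chart Xirr Xinf Xv l0v rk) => w w0 h0 h1.
  by apply: not_in_tangent; exact: ht.
have fr := Xosc _ _ Xv (chart_lifting Xirr ch).
have Du : (\matrix_(j < 4, i < 4) coef (a i) (3 - j)) \in unitmx.
  apply: unitmx_ker => w wD.
  have s0 := chart_gt0 ch; have ha := chart_acv ch.
  have der k : derive1n k (evc a) 0 = \row_i ((k`!)%:R * coef (a i) k).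
    exact: (derive1n_arc k s0 ha (fun _ _ => erefl)).
  move: fr; rewrite -[evc a 0]/(derive1n 0 (evc a) 0) !der => fr.
  have h := @freeP _ _ _ [tuple \row_i ((0`!)%:R * coef (a i) 0); \row_i ((1`!)%:R * coef (a i) 1);
    \row_i ((2`!)%:R * coef (a i) 2); \row_i ((3`!)%:R * coef (a i) 3)] fr.
  have z (m : 'I_4) : w 0 (rev_ord m) / (m`!)%:R = 0.
    apply: (h (fun m : 'I_4 => w 0 (rev_ord m) / (m`!)%:R)); apply/rowP => i.
    have := congr1 (fun z : 'rV[C]_4 => z 0 i) wD; rewrite !mxE sum4 => <-.
    rewrite sum4 !mxE /=.
    have r0 : rev_ord (Ordinal (isT : 0 < 4)%N) = Ordinal (isT : 3 < 4)%N by exact: val_inj.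
    have r1 : rev_ord (Ordinal (isT : 1 < 4)%N) = Ordinal (isT : 2 < 4)%N by exact: val_inj.
    have r2 : rev_ord (Ordinal (isT : 2 < 4)%N) = Ordinal (isT : 1 < 4)%N by exact: val_inj.
    have r3 : rev_ord (Ordinal (isT : 3 < 4)%N) = Ordinal (isT : 0 < 4)%N by exact: val_inj.
    have f0 k : (k`!)%:R != 0 :> C by rewrite pnatr_eq0 -lt0n fact_gt0.
    rewrite r0 r1 r2 r3 !mulrA !divfK // addrC.
    exact: add_rev.
  apply/rowP => j; have := z (rev_ord j); rewrite rev_ordK mxE => /eqP.
  by rewrite mulf_eq0 invr_eq0 pnatr_eq0 (gtn_eqF (fact_gt0 _)) orbF => /eqP.
have [Q Qu QX] := exists_cubic_subset Xirr Xinf Xskew ch Du.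
have c10 : cub 1 0 != 0 :> 'rV[C]_4 by rewrite cub_eq0 oner_eq0.
have c01 : cub 0 1 != 0 :> 'rV[C]_4 by rewrite cub_eq0 oner_eq0 andbF.
exists Q => //; symmetry; apply: (dim1_maximal Xirr Xdim (cubic_irreducible Qu) QX
  (cubic_set_cub Q c10) (cubic_set_cub Q c01)).
move=> /(ppoint_eqP (mulmx_neq0 Qu c10) (mulmx_neq0 Qu c01)) [k _].
rewrite scalemxAl => /(can_inj (mulmxK Qu)) /rowP /(_ 0).
rewrite !mxE /= subn0 !expr0 !expr1n !expr0n /= mul0r mulr0.
by rewrite mulr1 => /eqP; rewrite oner_eq0.
Qed.
End SkewIsCubic.

(** * Twisted cubics are algebraically skew *)

Section CubicAlgebra.
Variable K : fieldType.

(** The coordinates [z] define a symmetric trilinear form on a plane.  The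
    quantities [L0, ..., L3] are its values at the triples formed from the vectors
    [(t, - s)] and [(t', - s')], and the identities express its values at triples of
    basis vectors after a change of basis of determinant [d]. *)
Lemma trilinear_identities (K' : comNzRingType) (s t s' t' z0 z1 z2 z3 A B A' B' d : K') :
  d = s * t' - s' * t ->
  t ^+ 2 * z0 - s * t * z1 *+ 2 + s ^+ 2 * z2 = A ->
  t ^+ 2 * z1 - s * t * z2 *+ 2 + s ^+ 2 * z3 = B ->
  t' ^+ 2 * z0 - s' * t' * z1 *+ 2 + s' ^+ 2 * z2 = A' ->
  t' ^+ 2 * z1 - s' * t' * z2 *+ 2 + s' ^+ 2 * z3 = B' ->
  let L0 := t * A - s * B in let L1 := t' * A - s' * B in
  let L2 := t * A' - s * B' in let L3 := t' * A' - s' * B' in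
  [/\ - (d ^+ 3 * z0) = s' ^+ 3 * L0 - s' ^+ 2 * s * L1 *+ 3 + s' * s ^+ 2 * L2 *+ 3 - s ^+ 3 * L3,
   - (d ^+ 3 * z1) = s' ^+ 2 * t' * L0 - (s' ^+ 2 * t + s' * s * t' *+ 2) * L1
       + (s' * s * t *+ 2 + s ^+ 2 * t') * L2 - s ^+ 2 * t * L3,
   - (d ^+ 3 * z2) = s' * t' ^+ 2 * L0 - (s' * t' * t *+ 2 + s * t' ^+ 2) * L1
       + (s' * t ^+ 2 + s * t * t' *+ 2) * L2 - s * t ^+ 2 * L3 &
   - (d ^+ 3 * z3) = t' ^+ 3 * L0 - t' ^+ 2 * t * L1 *+ 3 + t' * t ^+ 2 * L2 *+ 3 - t ^+ 3 * L3].
Proof. by move=> -> <- <- <- <- /=; split; ring. Qed.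

(** All the values [L0, ..., L3] are zero, hence so is the trilinear form. *)
Lemma apolar_eq0 (s t s' t' z0 z1 z2 z3 : K) : s * t' - s' * t != 0 ->
  t ^+ 2 * z0 - s * t * z1 *+ 2 + s ^+ 2 * z2 = 0 ->
  t ^+ 2 * z1 - s * t * z2 *+ 2 + s ^+ 2 * z3 = 0 ->
  t' ^+ 2 * z0 - s' * t' * z1 *+ 2 + s' ^+ 2 * z2 = 0 ->
  t' ^+ 2 * z1 - s' * t' * z2 *+ 2 + s' ^+ 2 * z3 = 0 ->
  [/\ z0 = 0, z1 = 0, z2 = 0 & z3 = 0].
Proof.
move=> d0 hA hB hA' hB'; have [] := trilinear_identities erefl hA hB hA' hB'.
rewrite !mulr0 !subr0 !mulr0 !mul0rn !subr0 !addr0.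
have d3 : (s * t' - s' * t) ^+ 3 != 0 by rewrite expf_neq0.
have z (x : K) : - ((s * t' - s' * t) ^+ 3 * x) = 0 -> x = 0.
  by move=> /eqP; rewrite oppr_eq0 mulf_eq0 (negbTE d3) => /eqP.
by move=> /z -> /z -> /z -> /z ->.
Qed.

(** The linearized quadrics are [s A = 0], [t A + s B = 0] and [t B = 0], where [A]
    and [B] are the two apolarity conditions. *)
Lemma tangent_apolar (s t z0 z1 z2 z3 : K) : (s != 0) || (t != 0) ->
  let c0 := s ^+ 3 in let c1 := s ^+ 2 * t in let c2 := s * t ^+ 2 in let c3 := t ^+ 3 in
  z0 * c2 + c0 * z2 - (z1 * c1 + c1 * z1) = 0 ->
  z0 * c3 + c0 * z3 - (z1 * c2 + c1 * z2) = 0 ->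
  z1 * c3 + c1 * z3 - (z2 * c2 + c2 * z2) = 0 ->
  t ^+ 2 * z0 - s * t * z1 *+ 2 + s ^+ 2 * z2 = 0 /\
  t ^+ 2 * z1 - s * t * z2 *+ 2 + s ^+ 2 * z3 = 0.
Proof.
move=> st /=; set A := t ^+ 2 * z0 - _ + _; set B := t ^+ 2 * z1 - _ + _ => h1 h2 h3.
have e1 : s * A = 0 by rewrite -[RHS]h1 /A; ring.
have e2 : t * A + s * B = 0 by rewrite -[RHS]h2 /A /B; ring.
have e3 : t * B = 0 by rewrite -[RHS]h3 /B; ring.
have cancel (x y : K) : x != 0 -> x * y = 0 -> y = 0.
  by move=> x0 /eqP; rewrite mulf_eq0 (negbTE x0) => /eqP.
case/orP: st => h.
  have A0 := cancel _ _ h e1; split=> //; apply: (cancel _ _ h).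
  by rewrite -[RHS]e2 A0 mulr0 add0r.
have B0 := cancel _ _ h e3; split=> //; apply: (cancel _ _ h).
by rewrite -[RHS]e2 B0 mulr0 addr0.
Qed.

Lemma cubic_regroup (K' : comNzRingType) (g0 g1 g2 g3 h c x0 x1 x2 x3 : K') :
  g0 * g2 = g1 * g1 -> g0 * g3 = g1 * g2 -> g1 = c * g0 + h ->
  g0 ^+ 2 * (x0 * g0 + x1 * g1 + x2 * g2 + x3 * g3) =
  (x0 + c * x1 + c ^+ 2 * x2 + c ^+ 3 * x3) * g0 ^+ 3
  + h * ((x1 + c * x2 *+ 2 + c ^+ 2 * x3 *+ 3) * g0 ^+ 2
  + h * ((x2 + c * x3 *+ 3) * g0 + h * x3)).
Proof.
move=> e1 e2 e3.
transitivity (g0 ^+ 3 * x0 + g0 ^+ 2 * g1 * x1 + g0 * (g0 * g2) * x2 + g0 * (g0 * g3) * x3).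
  ring.
have -> : g0 * (g0 * g3) = g1 * (g0 * g2) by rewrite e2; ring.
rewrite e1 e3; ring.
Qed.

(** Write [g1 = c g0 + h] with [h] of order exactly 1.  The quadrics turn
    [g0^2 (x0 g0 + ... + x3 g3)] into a cubic form in [g0] and [h], whose
    coefficients vanish one after the other. *)
Lemma contact_order (g0 g1 g2 g3 : fps K) (x0 x1 x2 x3 : K) : coef g0 0 != 0 ->
  g0 * g2 = g1 * g1 -> g0 * g3 = g1 * g2 ->
  coef g0 0 * coef g1 1 - coef g0 1 * coef g1 0 != 0 ->
  ord_ge 4 (fps_const x0 * g0 + fps_const x1 * g1 + fps_const x2 * g2 + fps_const x3 * g3) ->
  [/\ x0 = 0, x1 = 0, x2 = 0 & x3 = 0].
Proof.
move=> p0 e1 e2 W0 hS; pose c := coef g1 0 / coef g0 0.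
pose h := g1 - fps_const c * g0; pose e := FPS (fun n => coef h n.+1).
have h0 : coef h 0 = 0 by rewrite fcoefB coef_constM /c divfK // subrr.
have he : h = fpsX K * e by apply: fpsP => -[|n]; rewrite coef_XM.
have ee : coef e 0 != 0.
  have -> : coef e 0 = coef g1 1 - c * coef g0 1 by rewrite -coef_constM -fcoefB.
  apply: contra W0; rewrite !subr_eq0 => /eqP ->.
  by rewrite /c mulrA [coef g0 0 * _]mulrC divfK // mulrC.
have e3 : g1 = fps_const c * g0 + h by rewrite addrC subrK.
have := ord_geMl (g0 ^+ 2) hS.
rewrite (cubic_regroup _ _ _ _ e1 e2 e3).
rewrite -!rmorphXn -!rmorphM -!rmorphMn -!rmorphD he.
set m0 := x0 + _ + _ + _; set m1 := x1 + _ + _; set m2 := x2 + _ => hS4.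
have g0k k : coef (g0 ^+ k) 0 != 0.
  by elim: k => [|k IH]; rewrite ?exprS ?fcoefM0 ?mulf_neq0 // expr0 oner_eq0.
have z (x y : K) : y != 0 -> x * y = 0 -> x = 0.
  by move=> y0 /eqP; rewrite mulf_eq0 (negbTE y0) orbF => /eqP.
have m00 : m0 = 0.
  have := hS4 0%N isT; rewrite fcoefD coef_constM -mulrA coef_XM addr0; exact: z.
have m10 : m1 = 0.
  have := hS4 1%N isT; rewrite m00 rmorph0 mul0r add0r -mulrA coef_XM fcoefM0 fcoefD.
  rewrite coef_constM -mulrA coef_XM addr0 mulrC => /(z _ _ ee); exact: z.
have m20 : m2 = 0.
  have := hS4 2%N isT; rewrite m00 m10 rmorph0 !mul0r !add0r -!mulrA coef_XM.
  have -> : e * (fpsX K * (e * (fps_const m2 * g0 + fpsX K * (e * fps_const x3)))) =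
    fpsX K * ((e * e) * (fps_const m2 * g0 + fpsX K * (e * fps_const x3))).
    by rewrite mulrCA !mulrA.
  rewrite coef_XM fcoefM0 fcoefD coef_constM coef_XM addr0 fcoefM0 mulrC.
  by move=> /(z _ _ (mulf_neq0 ee ee)); exact: z.
have x30 : x3 = 0.
  have := hS4 3%N isT; rewrite m00 m10 m20 rmorph0 !mul0r !add0r.
  have -> : fpsX K * e * (fpsX K * e * (fpsX K * e * fps_const x3)) =
    fpsX K ^+ 3 * (fps_const x3 * e ^+ 3) by generalize (fpsX K) (fps_const x3); clear; move=> X y; ring.
  rewrite coef_XnM ltnn subnn coef_constM; apply: z.
  by rewrite !exprS expr0 mulr1 !fcoefM0 !mulf_neq0.
move: m20 m10 m00; rewrite /m2 /m1 /m0 x30 !mulr0 !mul0rn !addr0 => x20.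
by rewrite x20 !mulr0 !mul0rn !addr0 => x10; rewrite x10 mulr0 addr0 => x00.
Qed.
End CubicAlgebra.

Section Converse.
Variable R : realType.
Local Notation C := R[i].
Variable D : 'M[C]_4.
Hypothesis Du : D \in unitmx.
Implicit Types (v w z : 'rV[C]_4) (s t : C).
Let zz w j : C := (w *m invmx D) 0 j.

Lemma mderiv_linpM l m (v w : 'rV[C]_4) :
  \sum_i mev (v 0) (mpoly.mderiv i (linp l * linp m)) * w 0 i =
  lin l w * lin m v + lin l v * lin m w.
Proof.
rewrite (eq_bigr (fun i => l i * w 0 i * lin m v + lin l v * (m i * w 0 i))).
  by rewrite big_split -mulr_suml -mulr_sumr.
move=> i _; rewrite mpoly.mderivM mevD !mevM !mderiv_linp !mev_pC !mev_linp; ring.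
Qed.

Lemma mderiv_quad i j k l v w :
  \sum_m mev (v 0) (mpoly.mderiv m (quad_form D i j k l)) * w 0 m =
  zz w i * zz v j + zz v i * zz w j - (zz w k * zz v l + zz v k * zz w l).
Proof.
rewrite /zz -!lin_zc -!mderiv_linpM -sumrB; apply: eq_bigr => m _.
by rewrite -mulrBl -mevB -linearB.
Qed.

Lemma cubic_tangent s t w : cub s t != 0 -> in_tangent (cubic_set D) (cub s t *m D) w ->
  t ^+ 2 * zz w o0 - s * t * zz w o1 *+ 2 + s ^+ 2 * zz w o2 = 0 /\
  t ^+ 2 * zz w o1 - s * t * zz w o2 *+ 2 + s ^+ 2 * zz w o3 = 0.
Proof.
move=> c0 h; have c j : zz (cub s t *m D) j = s ^+ (3 - j) * t ^+ j.
  by rewrite /zz mulmxK // mxE.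
have q F : quadric D F -> \sum_m mev ((cub s t *m D) 0) (mpoly.mderiv m F) * w 0 m = 0.
  by move=> /(quadrics_vanish Du)/h.
have e0 : zz (cub s t *m D) o0 = s ^+ 3 by rewrite c expr0 mulr1.
have e1 : zz (cub s t *m D) o1 = s ^+ 2 * t by rewrite c expr1.
have e2 : zz (cub s t *m D) o2 = s * t ^+ 2 by rewrite c expr1.
have e3 : zz (cub s t *m D) o3 = t ^+ 3 by rewrite c expr0 mul1r.
have q1 := q _ (Or31 _ _ (erefl (quad_form D o0 o2 o1 o1))).
have q2 := q _ (Or32 _ _ (erefl (quad_form D o0 o3 o1 o2))).
have q3 := q _ (Or33 _ _ (erefl (quad_form D o1 o3 o2 o2))).
rewrite mderiv_quad e0 e1 e2 in q1; rewrite mderiv_quad e0 e1 e2 e3 in q2.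
rewrite mderiv_quad e1 e2 e3 in q3.
have st : (s != 0) || (t != 0) by move: c0; rewrite cub_eq0 negb_and.
exact: (tangent_apolar st q1 q2 q3).
Qed.

Lemma cubic_skew : Defs.skew (cubic_set D).
Proof.
move=> x y /cubic_setP [s [t [c0 ->]]] /cubic_setP [s' [t' [c0' ->]]] ne.
apply/seteqP; split=> // z [].
have [w w0 ->] := ppointP z.
move=> /(in_tangentP (cubic_set D) (mulmx_neq0 Du c0) w0) /(cubic_tangent c0) [a1 a2].
move=> /(in_tangentP (cubic_set D) (mulmx_neq0 Du c0') w0) /(cubic_tangent c0') [b1 b2].
have d0 : s * t' - s' * t != 0.
  rewrite subr_eq0; apply/eqP => e; apply: ne.
  have [k k0 [es et]] : exists2 k : C, k != 0 & s' = k * s /\ t' = k * t.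
    move: c0 c0'; rewrite !cub_eq0 !negb_and => st st'.
    have [s0|s0] := eqVneq s 0.
      have t0 : t != 0 by move: st; rewrite s0 eqxx.
      have s'0 : s' = 0.
        by move: e; rewrite s0 mul0r => /esym/eqP; rewrite mulf_eq0 (negbTE t0) orbF => /eqP.
      have t'0 : t' != 0 by move: st'; rewrite s'0 eqxx.
      by exists (t' / t); [rewrite mulf_neq0 ?invr_eq0 | rewrite s0 s'0 mulr0 divfK].
    have et : t' = s' / s * t by rewrite mulrAC -e mulrAC mulfV ?mul1r.
    have s'0 : s' != 0.
      by apply/eqP => s'0; move: st'; rewrite et s'0 !mul0r eqxx.
    by exists (s' / s); [rewrite mulf_neq0 ?invr_eq0 | rewrite divfK].
  have -> : cub s' t' = k ^+ 3 *: cub s t.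
    apply/rowP => -[[|[|[|[|//]]]] hj]; rewrite !mxE /= es et !exprMn /=; ring.
  by rewrite -scalemxAl ppoint_scale // expf_neq0.
have [z0 z1 z2 z3] := apolar_eq0 d0 a1 a2 b1 b2.
have wz : w *m invmx D = 0.
  apply/rowP => j; rewrite [RHS]mxE; move: j; exact: forall4.
by move: w0; rewrite -(mulmxKV Du w) wz mul0mx eqxx.
Qed.
End Converse.

Section Analytic.
Variable R : realType.
Local Notation C := R[i].

Lemma clim_bounded (u : nat -> C) l : clim u l -> exists B, forall n, cn (u n) <= B.
Proof.
move=> /(_ 1 ltr01) [n0 h]; exists (cn l + 1 + \sum_(k < n0) cn (u k)) => n.
have S0 (P : pred 'I_n0) : 0 <= \sum_(k < n0 | P k) cn (u k).
  by apply: sumr_ge0 => k _; exact: cn_ge0.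
have [le_n|lt_n] := leqP n0 n.
  apply: le_trans (_ : cn l + 1 <= _); last by rewrite lerDl S0.
  by have := cnD (u n - l) l; rewrite subrK; have := h n le_n; lra.
rewrite (bigD1 (Ordinal lt_n)) //=; have := cn_ge0 l.
by have := S0 (fun k => k != Ordinal lt_n); lra.
Qed.

(** The terms of a convergent series are bounded, so the series converges
    absolutely on every smaller disc. *)
Lemma analytic_arc (f : C -> 'rV[C]_4) : analytic_at f 0 -> exists a r,
  [/\ 0 < r, forall i, acv r (a i) & forall w, cn w < r -> f w = evc a w].
Proof.
move=> [A /near_coordP [d /pos_complex [r0 r00 e0] hA]].
pose a (i : 'I_4) : fps C := FPS (fun k => A k 0 i).
have lim w i : cn w < r0 -> clim (psum (a i) w) (f w 0 i).
  move=> wr e ee; have := hA w; rewrite e0 subr0 => /(_ wr).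
  move=> /rV_cvgP /(_ e%:C%C (gt0_R ee)) [k0 hk]; exists k0 => k le_k.
  have := hk k le_k i; rewrite norm_ltR /series /= big_mkord summxE.
  by congr (cn (_ - _) < _); apply: eq_bigr => m _; rewrite mxE mulrC.
exists a, (r0 / 4); split; first by lra.
  move=> i; pose c : C := (r0 / 2)%:C%C.
  have cc : cn c = r0 / 2 by rewrite cn_real ger0_norm //; lra.
  have cr : cn c < r0 by rewrite cc; lra.
  have [B hB] := clim_bounded (lim c i cr).
  apply: (@acv_bound _ (r0 / 2) (a i) (B + B)); [lra|lra|move=> k].
  have -> : cn (coef (a i) k) * (r0 / 2) ^+ k = cn (psum (a i) c k.+1 - psum (a i) c k).
    by rewrite /psum big_ord_recr /= addrAC subrr add0r cnM cnX cc.
  apply: le_trans (cnD _ _) _; rewrite cnN; apply: lerD; exact: hB.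
move=> w wr; apply/rowP => i; rewrite mxE; symmetry; apply: ev_lim; apply: lim; lra.
Qed.
End Analytic.

Lemma sum_rev (K : comNzRingType) (x y z t : K) : x + y + z + t = t + z + y + x.
Proof. ring. Qed.

Section Immersed.
Variable K : fieldType.
(** The arc is not immersed at [0] as an arc in projective space. *)
Definition stationary (g0 g1 g2 g3 : fps K) := exists rho : K,
  [/\ coef g0 1 = rho * coef g0 0, coef g1 1 = rho * coef g1 0,
      coef g2 1 = rho * coef g2 0 & coef g3 1 = rho * coef g3 0].

Lemma wronskian_identity (K' : comNzRingType) (p p' q q' r r' s s' : K') : p * r = q * q ->
  p * r' + p' * r = q * q' + q' * q -> p * s = q * r -> p * s' + p' * s = q * r' + q' * r ->
  p * (p * r' - p' * r) = q *+ 2 * (p * q' - p' * q) /\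
  p * (p * s' - p' * s) = q * (p * r' - p' * r) + r * (p * q' - p' * q).
Proof.
move=> e1 e2 e3 e4; split.
  have -> : p * r' - p' * r = (p * r' + p' * r) - p' * r *+ 2 by ring.
  rewrite e2; transitivity (p * (q * q' + q' * q) - p' * (p * r) *+ 2); first ring.
  by rewrite e1; ring.
have -> : p * s' - p' * s = (p * s' + p' * s) - p' * s *+ 2 by ring.
rewrite e4; transitivity (p * (q * r' + q' * r) - p' * (p * s) *+ 2); first ring.
by rewrite e3; ring.
Qed.

(** If [g1 / g0] is stationary then so are [g2 / g0] and [g3 / g0], which the
    quadrics express by it. *)
Lemma wronskian_neq0 (g0 g1 g2 g3 : fps K) : coef g0 0 != 0 ->
  g0 * g2 = g1 * g1 -> g0 * g3 = g1 * g2 -> ~ stationary g0 g1 g2 g3 ->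
  coef g0 0 * coef g1 1 - coef g0 1 * coef g1 0 != 0.
Proof.
move=> p0 e1 e2 ns; apply/eqP => W0; apply: ns.
have ex n := congr1 (fun g => coef g n) e1; have ey n := congr1 (fun g => coef g n) e2.
have := ex 0%N; have := ex 1%N; have := ey 0%N; have := ey 1%N.
rewrite !fcoefM0 !fcoefM1 => y1 y0 x1 x0.
have [w2 w3] := wronskian_identity x0 x1 y0 y1.
have z (x : K) : coef g0 0 * x = 0 -> x = 0.
  by move=> /eqP; rewrite mulf_eq0 (negbTE p0) => /eqP.
rewrite W0 mulr0 in w2; have r0 := z _ w2; rewrite W0 r0 !mulr0 addr0 in w3.
have s0 := z _ w3.
have e (x y : K) : coef g0 0 * x - coef g0 1 * y = 0 -> x = coef g0 1 / coef g0 0 * y.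
  by move=> /eqP; rewrite subr_eq0 mulrAC => /eqP <-; rewrite mulrAC mulfV ?mul1r.
exists (coef g0 1 / coef g0 0); split; try exact: e.
by rewrite divfK.
Qed.

(** At [0] one of [g0], [g3] does not vanish, and the quadrics are invariant under
    reversal of the coordinates. *)
Lemma immersed_contact (g0 g1 g2 g3 : fps K) (x0 x1 x2 x3 : K) :
  ~ [/\ coef g0 0 = 0, coef g1 0 = 0, coef g2 0 = 0 & coef g3 0 = 0] ->
  ~ stationary g0 g1 g2 g3 ->
  g0 * g2 = g1 * g1 -> g0 * g3 = g1 * g2 -> g1 * g3 = g2 * g2 ->
  ord_ge 4 (fps_const x0 * g0 + fps_const x1 * g1 + fps_const x2 * g2 + fps_const x3 * g3) ->
  [/\ x0 = 0, x1 = 0, x2 = 0 & x3 = 0].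
Proof.
move=> nz ns e1 e2 e3 hS; have [p0|p0] := eqVneq (coef g0 0) 0; last first.
  exact: contact_order p0 e1 e2 (wronskian_neq0 p0 e1 e2 ns) hS.
have sq (g : fps K) : coef (g * g) 0 = 0 -> coef g 0 = 0.
  by rewrite fcoefM0 => /eqP; rewrite mulf_eq0 orbb => /eqP.
have q0 : coef g1 0 = 0 by apply: sq; rewrite -e1 fcoefM0 p0 mul0r.
have r0 : coef g2 0 = 0 by apply: sq; rewrite -e3 fcoefM0 q0 mul0r.
have s0 : coef g3 0 != 0 by apply/eqP => s0; apply: nz.
have f1 : g3 * g1 = g2 * g2 by rewrite mulrC.
have f2 : g3 * g0 = g2 * g1 by rewrite mulrC e2 mulrC.
have ns' : ~ stationary g3 g2 g1 g0 by move=> [rho [? ? ? ?]]; apply: ns; exists rho.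
have [] := contact_order (x0 := x3) (x1 := x2) (x2 := x1) (x3 := x0) s0 f1 f2 (wronskian_neq0 s0 f1 f2 ns').
  by rewrite sum_rev.
by move=> -> -> -> ->.
Qed.
End Immersed.

Section Osculation.
Variable R : realType.
Local Notation C := R[i].
Variable D : 'M[C]_4.
Hypothesis Du : D \in unitmx.

(** The quadrics vanish at all nearby points of the arc, hence identically. *)
Lemma lifting_arc x0 (f : C -> 'rV[C]_4) : local_lifting (cubic_set D) x0 f ->
  exists a s, [/\ 0 < s, forall i, acv s (a i), forall w, cn w < s -> f w = evc a w &
    forall F, quadric D F -> pl a F = 0].
Proof.
move=> [U [[oU U0] _ hU _ _]]; have [an f0 _ _] := hU 0 U0.
have [a [r [r0 ha hf]]] := analytic_arc an.
have [e /pos_complex [d d0 hd] hdU] := (open_coordP U).1 oU 0 U0.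
pose m := Num.min r d; have m0 : 0 < m by rewrite lt_min r0.
have mr : m <= r by rewrite ge_min lexx.
have md : m <= d by rewrite ge_min lexx orbT.
exists a, (m / 2); have h2 : 0 < m / 2 by rewrite divr_gt0.
have hm w : cn w <= m / 2 -> cn w < m by move=> h; lra.
have ham i : acv (m / 2) (a i) by apply: acv_le (ha i); lra.
split=> // [w /ltW/hm h|F qF]; first by apply: hf; exact: lt_le_trans h mr.
apply: (ev_inj h2 (pl_acv _ (ltW h2) ham) (acv_const 0 (ltW h2))) => t ts.
rewrite -(mev_evc F (ltW h2) ham ts) ev_const -hf; last exact: lt_le_trans (hm _ ts) mr.
have Ut : U t by apply: hdU; rewrite hd subr0; exact: lt_le_trans (hm _ ts) md.
have [_ ft Xt _] := hU t Ut.
exact: mev_vanishing (quadrics_vanish Du qF) ft Xt.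
Qed.

(** The matrix of the coefficients of order at most 3 has no kernel by
    [immersed_contact], so its rows, which are the derivatives up to factorials,
    are independent. *)
Lemma cubic_osculation x0 (f : C -> 'rV[C]_4) : local_lifting (cubic_set D) x0 f ->
  free [:: f 0; derive1n 1 f 0; derive1n 2 f 0; derive1n 3 f 0].
Proof.
move=> lf; have [a [s [s0 ha hf hq]]] := lifting_arc lf.
have [U [[_ U0] _ hU _ _]] := lf; have [_ f0 _ fr] := hU 0 U0.
pose A k : 'rV[C]_4 := \row_i coef (a i) k.
have der k : derive1n k f 0 = (k`!)%:R *: A k.
  by rewrite [LHS](derive1n_arc k s0 ha hf); apply/rowP => i; rewrite !mxE.
have A0 : f 0 = A 0%N by rewrite -[f 0]/(derive1n 0 f 0) der scale1r.
have A1 : derive1 f 0 = A 1%N by rewrite -[derive1 f 0]/(derive1n 1 f 0) der scale1r.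
pose g j := pl a (linp (fun i => invmx D i j)).
have gE j k : coef (g j) k = (A k *m invmx D) 0 j.
  by rewrite /g coef_pl_linp lin_col.
have quad i j k l : quadric D (quad_form D i j k l) -> g i * g j = g k * g l.
  by move=> /hq /eqP; rewrite /quad_form plB !plM subr_eq0 => /eqP.
have e1 := quad _ _ _ _ (Or31 _ _ (erefl (quad_form D o0 o2 o1 o1))).
have e2 := quad _ _ _ _ (Or32 _ _ (erefl (quad_form D o0 o3 o1 o2))).
have e3 := quad _ _ _ _ (Or33 _ _ (erefl (quad_form D o1 o3 o2 o2))).
have nz : ~ [/\ coef (g o0) 0 = 0, coef (g o1) 0 = 0, coef (g o2) 0 = 0 & coef (g o3) 0 = 0].
  rewrite !gE => -[z0 z1 z2 z3]; have Az : A 0%N *m invmx D = 0.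
    by apply/rowP => j; rewrite [RHS]mxE; move: j; exact: forall4.
  by move: f0; rewrite A0 -(mulmxKV Du (A 0%N)) Az mul0mx eqxx.
have ns : ~ stationary (g o0) (g o1) (g o2) (g o3).
  move=> [rho]; rewrite !gE => -[z0 z1 z2 z3].
  have Az : A 1%N *m invmx D = rho *: (A 0%N *m invmx D).
    by apply/rowP => j; rewrite [RHS]mxE; move: j; exact: forall4.
  rewrite scalemxAl in Az; have {}Az := can_inj (mulmxKV Du) Az.
  move: fr; rewrite A0 A1 => fr.
  have := @freeP _ _ _ [tuple A 0%N; A 1%N] fr (fun i => if i == 0 then - rho else 1).
  rewrite !big_ord_recl big_ord0 /= Az scaleNr scale1r addr0 addNr => /(_ erefl 1) /eqP.
  by rewrite oner_eq0.
pose G : 'M[C]_4 := \matrix_(k, j) coef (g j) k.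
have Gu : G \in unitmx.
  rewrite -unitmx_tr; apply: unitmx_ker => w wG.
  have [] := immersed_contact (x0 := w 0 o0) (x1 := w 0 o1) (x2 := w 0 o2) (x3 := w 0 o3) nz ns e1 e2 e3.
    move=> k k4; have := congr1 (fun z : 'rV[C]_4 => z 0 (Ordinal k4)) wG.
    by rewrite mxE sum4 [RHS]mxE !mxE !fcoefD !coef_constM.
  move=> w0 w1 w2 w3; by apply/rowP => j; rewrite [RHS]mxE; move: j; exact: forall4.
rewrite -[f 0]/(derive1n 0 f 0) !der.
apply/(@freeP _ _ _ [tuple (0`!)%:R *: A 0%N; (1`!)%:R *: A 1%N; (2`!)%:R *: A 2%N; (3`!)%:R *: A 3%N]) => c hc.
pose w : 'rV[C]_4 := \row_m (c m * (m`!)%:R).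
have wG : w *m G = 0.
  have -> : G = (\matrix_(k, i) A k 0 i) *m invmx D.
    apply/matrixP => k j; rewrite [LHS]mxE gE [LHS]mxE [RHS]mxE.
    by apply: eq_bigr => i _; rewrite [in RHS]mxE.
  rewrite mulmxA -[RHS](mul0mx _ (invmx D)) -[in RHS]hc; congr (_ *m _).
  rewrite mulmx_sum_row; apply: eq_bigr => m _.
  have -> : row m (\matrix_(k, i) A k 0 i) = A m by apply/rowP => i; rewrite !mxE.
  rewrite mxE -scalerA; congr (_ *: _); move: (m); exact: forall4.
have w0 : w = 0 by rewrite -(mulmxK Gu w) wG mul0mx.
move=> m; have := congr1 (fun z : 'rV[C]_4 => z 0 m) w0; rewrite !mxE => /eqP.
by rewrite mulf_eq0 pnatr_eq0 (gtn_eqF (fact_gt0 _)) orbF => /eqP.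
Qed.
End Osculation.

Theorem theorem3p15 (R : realType) (X : set (projspace R[i] 3))
    (hX : smooth_projective_curve X) :
  algebraically_skew X <-> twisted_cubic X.
Proof.
split; first exact: skew_is_cubic.
move=> [D Du ->]; split; first exact: cubic_skew.
by move=> x0 f _; exact: cubic_osculation.
Qed.
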